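(* There are positive absolute constants $C_A, C, c$ such that the following holds. Consider the subgaussian Kronecker-sum model with $n\ge 1$ i.i.d. samples and the TeraLasso estimator $\hat\Omega$ described in the context. Suppose that: (A1) $\min_k m_k\ge \log p$, and for $k=1,\dots,L$ the penalty parameters are $\rho_{n,k}=\delta_{n,k}/\varepsilon_k$ with $0<\varepsilon_k<1$ and $\delta_{n,k}\asymp \|\Sigma_0\|_2\sqrt{\frac{\log p}{n m_k}}$ (see the context for the precise meaning of this choice); (A2) $\phi_{\min}(\Omega_0)=\sum_{k=1}^L\phi_{\min}(\Psi_k)\ge \underline{k}_\Omega>0$ and $\phi_{\max}(\Omega_0)=\sum_{k=1}^L\phi_{\max}(\Psi_k)\le \overline{k}_\Omega<\infty$; (A3) $n\,m_{\min}^2\ge C_A^2 (L+1)\,\kappa(\Sigma_0)^4\,(s\log p+Lp)$. Then, with $C_L:=C\sqrt{L+1}$, with probability at least $1-L\exp(-c\log p)$, all of the following hold: $$\frac{\|\hat\Omega-\Omega_0\|_F}{\|\Omega_0\|_2}\le C\,\kappa(\Sigma_0)\Big(\frac{s\log p+Lp}{n\,m_{\min}}\Big)^{1/2},$$ $$\frac{\|\hat\Omega-\Omega_0\|_2}{\|\Omega_0\|_2}\le C_L\,\kappa(\Sigma_0)\Big(\frac{s\log p+Lp}{n\,m_{\min}^2}\Big)^{1/2},$$ $$\frac{\|\hat\Omega-\Omega_0\|_F}{\|\Omega_0\|_F}\le C_L\,\kappa(\Sigma_0)\Big(\frac{s\log p+Lp}{n\,m_{\min}^2}\Big)^{1/2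}.$$
   Context: Dimensions: $L\ge 2$ and $d_1,\dots,d_L$ are positive integers, $p=\prod_{k=1}^L d_k$, $m_k=p/d_k$, $m_{\min}=\min_k m_k$. Norms: $\|A\|_2$ is the operator norm, $\|A\|_F$ the Frobenius norm, $\langle A,B\rangle=\mathrm{tr}(A^TB)$, $|A|$ the determinant, $\phi_{\min},\phi_{\max}$ the smallest and largest eigenvalues of a symmetric matrix, and $\kappa(A)=\phi_{\max}(A)/\phi_{\min}(A)$. For a square matrix $B$, $|B|_{1,\mathrm{off}}=\sum_{i\ne j}|B_{ij}|$. Kronecker sums: for $B_k\in\mathbb{R}^{d_k\times d_k}$, $B_1\oplus\cdots\oplus B_L:=\sum_{k=1}^L I_{d_1}\otimes\cdots\otimes I_{d_{k-1}}\otimes B_k\otimes I_{d_{k+1}}\otimes\cdots\otimes I_{d_L}$. The off-diagonal entries of each $B_k$ are uniquely determined by the Kronecker sum (the diagonals are determined only up to adding multiples of the identity to the factors with total zero). Let $\mathcal K_{\mathbf p}\subset\mathbb{R}^{p\times p}$ be the set of all such Kronecker sums and $\mathcal K_{\mathbf p}^\sharp=\{A\in\mathcal K_{\mathbf p}: A\succ 0\}$. Model: $\Omega_0=\Psi_1\oplus\cdots\oplus\Psi_L\in\mathcal K^\sharp_{\mathbf p}$ with symmetric $\Psi_k\in\mathbb R^{d_k\times d_k}$, and $\Sigma_0=\Omega_0^{-1}$. For a tensor $X\in\mathbb{R}^{d_1\times\cdots\times d_L}$, $\mathrm{vec}(X^T)\in\mathbb{R}^p$ lists the entries $X_{i_1,\dots,i_L}$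 in lexicographic order ($i_1$ varying slowest, $i_L$ fastest). The random tensor $X$ satisfies $\mathrm{vec}(X^T)=\Sigma_0^{1/2}Z$, where $Z\in\mathbb{R}^p$ has independent components with $\mathbb{E}Z_j=0$, $\mathbb{E}Z_j^2=1$ and $\|Z_j\|_{\psi_2}\le C_0$ for all $j$; here $\|Y\|_{\psi_2}=\inf\{t>0:\mathbb{E}\exp(Y^2/t^2)\le 2\}$. $X_1,\dots,X_n$ are i.i.d. copies of $X$ and $\hat S=\frac1n\sum_{i=1}^n \mathrm{vec}(X_i^T)\,\mathrm{vec}(X_i^T)^T$. Sparsity: $s_k=|\{(i,j): i\ne j,\ (\Psi_k)_{ij}\ne 0\}|$ and $s=\sum_{k=1}^L m_k s_k$, which is the number of nonzero off-diagonal entries of $\Omega_0$. TeraLasso estimator: $\hat\Omega=\arg\min_{\Omega\in\mathcal K_{\mathbf p}^\sharp}\big(-\log|\Omega|+\langle\hat S,\Omega\rangle+\sum_{k=1}^L m_k\rho_{n,k}|B_k|_{1,\mathrm{off}}\big)$, where $\Omega=B_1\oplus\cdots\oplus B_L$. Choice of $\delta_{n,k}$ and constants: $a\asymp b$ means $c_1 b\le a\le c_2 b$ for positive constants $c_1,c_2$ independent of $n$, the dimensions and the sparsity parameters. The constants in $\delta_{n,k}$ are taken large enough that $\delta_{n,k}$ dominates, with high probability, the maximal off-diagonal entrywise error $\max_{i\ne j}|(S_n^k-\mathbb{E}S_n^k)_{ij}|$, where $S_n^k=\frac{1}{nm_k}\sum_{i=1}^n X_i^{(k)}(X_i^{(k)})^T$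 and $X_i^{(k)}\in\mathbb{R}^{d_k\times m_k}$ is the mode-$k$ unfolding of $X_i$ (its columns are the mode-$k$ fibers). The numbers $C_0$ and $\varepsilon_k$ are regarded as fixed constants: ''absolute constants'' may depend on $C_0$, $\max_k 1/\varepsilon_k$ and the constants in $\asymp$, but not on $n$, $L$, the dimensions, $s$ or $\Omega_0$. *)

(* Defs.v *)
From HB Require Import structures.
From mathcomp Require Import all_boot all_order all_algebra.
From mathcomp Require Import all_classical all_reals all_analysis.

Set Implicit Arguments.
Unset Strict Implicit.
Unset Printing Implicit Defensive.

Import Order.TTheory GRing.Theory Num.Theory.

Local Open Scope classical_set_scope.
Local Open Scope ring_scope.

Section Dimensions.
Variables (L : nat) (d : 'I_L -> nat).

Definition dimp : nat := (\prod_(k < L) d k)%N.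

Definition comp_dim (k : 'I_L) : nat := (dimp %/ d k)%N.

(* All [comp_dim k] are at most [dimp], so this is their minimum (for L > 0). *)
Definition mmin : nat := (\big[minn/dimp]_(k < L) comp_dim k)%N.

Definition mindex := {dffun forall k : 'I_L, 'I_(d k)}.

Definition stride (k : nat) : nat := (\prod_(l < L | k < l) d l)%N.

Lemma digit_subproof (k : 'I_L) (a : 'I_dimp) : (a %/ stride k %% d k < d k)%N.
Proof.
rewrite ltn_mod lt0n; apply/eqP => dk0; case: a => a.
by rewrite /dimp (bigD1 k) //= dk0 mul0n ltn0.
Qed.

(* The a-th multi-index in lexicographic order (coordinate 0 varies slowest,
   coordinate L-1 fastest): its coordinates are the mixed-radix digits of a. *)
Definition mindex_of (a : 'I_dimp) : mindex :=
  [ffun k => Ordinal (digit_subproof k a)].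

Lemma mindex_ofE (a : 'I_dimp) :
  (\sum_(k < L) mindex_of a k * stride k = a)%N.
Proof.
pose W j := (\prod_(l < L | j <= l) d l)%N.
have WS (k : 'I_L) : W k = (d k * W k.+1)%N.
  rewrite /W (bigD1 k) //=; congr (_ * _)%N; apply: eq_bigl => l.
  by rewrite andbC -val_eqE /= eq_sym -ltn_neqAle.
have step (k : 'I_L) :
    (a %/ W k * W k + mindex_of a k * W k.+1 = a %/ W k.+1 * W k.+1)%N.
  rewrite ffunE /= WS mulnA -mulnDl mulnC [(d k * _)%N]mulnC divnMA.
  by rewrite -divn_eq mulnC.
have H j : (j <= L)%N ->
    (\sum_(k < L | k < j) mindex_of a k * stride k = a %/ W j * W j)%N.
  elim: j => [_|j IH jL].
    have aW : (a < W 0%N)%N by exact: ltn_ord.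
    by rewrite divn_small ?mul0n //; apply: big_pred0.
  rewrite (bigD1 (Ordinal jL)) //= addnC -(step (Ordinal jL)) /=.
  rewrite -(IH (ltnW jL)); congr (_ + _)%N; apply: eq_bigl => k.
  by rewrite -val_eqE /= ltnS andbC -ltn_neqAle.
have := H L (leqnn L).
have -> : W L = 1%N by rewrite /W big_pred0 // => l; rewrite leqNgt ltn_ord.
by rewrite divn1 muln1 => <-; apply: eq_bigl => k; rewrite ltn_ord.
Qed.

Definition mindex_upd (k : 'I_L) (a : mindex) (j : 'I_(d k)) : mindex :=
  [ffun l => eqtype.dfwith (fun l0 => a l0) j l].

End Dimensions.

Section Kronecker.
Variables (R : realType) (L : nat) (d : 'I_L -> nat).
Notation p := (dimp d).

(* A_1 (x) ... (x) A_L *)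
Definition kron (A : forall k, 'M[R]_(d k)) : 'M[R]_p :=
  \matrix_(a, b) \prod_(k < L) A k (mindex_of a k) (mindex_of b k).

Definition kron_sum (B : forall k, 'M[R]_(d k)) : 'M[R]_p :=
  \sum_(k < L) kron (eqtype.dfwith (fun l => 1%:M) (B k)).

Definition tensor := mindex d -> R.

(* vec(X^T) *)
Definition vec (X : tensor) : 'cV[R]_p := \col_a X (mindex_of a).

(* X^(k) (X^(k))^T for the mode-k unfolding X^(k): every mode-k fiber (column of
   X^(k)) contains exactly one multi-index a with a k = i, and its entry in row
   j is the one at [mindex_upd a j]. *)
Definition mode_gram (k : 'I_L) (X : tensor) : 'M[R]_(d k) :=
  \matrix_(i, j) \sum_(a : mindex d | a k == i) X a * X (mindex_upd a j).

End Kronecker.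

Section Matrices.
Variable R : realType.

Definition frobenius m n (A : 'M[R]_(m, n)) : R := Num.sqrt (\tr (A^T *m A)).

(* On column vectors [frobenius] is the Euclidean norm. *)
Definition opnorm m n (A : 'M[R]_(m, n)) : R :=
  sup [set frobenius (A *m x) | x in [set x : 'cV[R]_n | frobenius x <= 1]].

(* Extreme eigenvalues; meant for symmetric matrices, whose eigenvalues form a
   finite set, nonempty in positive dimension. *)
Definition phi_min n (A : 'M[R]_n) : R := inf [set a | eigenvalue A a].
Definition phi_max n (A : 'M[R]_n) : R := sup [set a | eigenvalue A a].

Definition kappa n (A : 'M[R]_n) : R := phi_max A / phi_min A.

Definition posdef n (A : 'M[R]_n) : Prop :=
  A^T = A /\ forall x : 'cV[R]_n, x != 0 -> 0 < (x^T *m A *m x) 0 0.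

Definition possemidef n (A : 'M[R]_n) : Prop :=
  A^T = A /\ forall x : 'cV[R]_n, 0 <= (x^T *m A *m x) 0 0.

Definition is_sqrtmx n (A H : 'M[R]_n) : Prop := possemidef H /\ H *m H = A.

Definition l1_off n (B : 'M[R]_n) : R := \sum_i \sum_(j | j != i) `|B i j|.

Definition offdiag_card n (B : 'M[R]_n) : nat :=
  #|[set ij : 'I_n * 'I_n | (ij.1 != ij.2) && (B ij.1 ij.2 != 0)]%SET|.

End Matrices.

Section Estimator.
Variables (R : realType) (L : nat) (d : 'I_L -> nat).

(* The penalty only involves off-diagonal entries, which are determined by
   [kron_sum B], so this is a function of [kron_sum B]. *)
Definition teralasso_obj (S : 'M[R]_(dimp d)) (rho : 'I_L -> R)
    (B : forall k, 'M[R]_(d k)) : R :=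
  - ln (\det (kron_sum B)) + \tr (S^T *m kron_sum B)
  + \sum_(k < L) (comp_dim d k)%:R * rho k * l1_off (B k).

(* The set of minimizers over positive definite Kronecker sums. *)
Definition teralasso (S : 'M[R]_(dimp d)) (rho : 'I_L -> R) :
    set 'M[R]_(dimp d) :=
  [set kron_sum B | B in [set B | posdef (kron_sum B) /\
     forall B', posdef (kron_sum B') ->
       teralasso_obj S rho B <= teralasso_obj S rho B']].

Definition sparsity (Psi : forall k, 'M[R]_(d k)) : nat :=
  (\sum_(k < L) comp_dim d k * offdiag_card (Psi k))%N.

(* ||Sigma_0||_2 sqrt(log p / (n m_k)) *)
Definition delta_rate (n : nat) (Sigma0 : 'M[R]_(dimp d)) (k : 'I_L) : R :=
  opnorm Sigma0 *
  Num.sqrt (ln (dimp d)%:R / (n%:R * (comp_dim d k)%:R)).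

End Estimator.

Section Probability.
Variables (R : realType) (disp : measure_display) (T : measurableType disp).
Variable P : probability T R.

(* Mutual independence of a finite family: product rule over every subfamily. *)
Definition independent (disp' : measure_display) (U : measurableType disp')
    (I : finType) (Y : I -> T -> U) : Prop :=
  forall (J : {set I}) (B : I -> set U),
    (forall i, i \in J -> measurable (B i)) ->
    P (\bigcap_(i in [set i | i \in J]) (Y i @^-1` B i)) =
      (\prod_(i in J) P (Y i @^-1` B i))%E.

Definition psi2_norm (Y : T -> R) : \bar R :=
  ereal_inf [set t%:E | t in
    [set t : R | 0 < t /\ ('E_P[fun w => expR (Y w ^+ 2 / t ^+ 2)] <= 2%:E)%E]].

Section Model.
Variables (L : nat) (d : 'I_L -> nat) (n : nat).
Notation p := (dimp d).

(* X i = i-th sample, with vec(X_i^T) = Sigma0^{1/2} Z_i. *)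
Definition kron_sum_model (C0 : R) (Psi : forall k, 'M[R]_(d k))
    (Z : 'I_n -> {RV P >-> p.-tuple R}) (X : 'I_n -> T -> tensor R d) : Prop :=
  let Omega0 := kron_sum Psi in
  let Sigma0 := invmx Omega0 in
  let Zc (i : 'I_n) (j : 'I_p) : T -> R := fun w => tnth (Z i w) j in
  [/\ forall k, (Psi k)^T = Psi k,
      posdef Omega0,
      exists2 H, is_sqrtmx Sigma0 H &
        forall i w, vec (X i w) = H *m (\col_j Zc i j w),
      forall i,
        independent (Zc i) /\
        forall j, [/\ ('E_P[Zc i j] = 0)%E,
                      ('E_P[fun w => (Zc i j w ^+ 2)%R] = 1)%E &
                      (psi2_norm (Zc i j) <= C0%:E)%E] &
      independent (fun i w => Z i w) /\
      forall i i', distribution P (Z i) = distribution P (Z i')].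

Definition sample_cov (X : 'I_n -> tensor R d) : 'M[R]_p :=
  n%:R^-1 *: \sum_(i < n) vec (X i) *m (vec (X i))^T.

(* S_n^k *)
Definition mode_cov (k : 'I_L) (X : 'I_n -> tensor R d) : 'M[R]_(d k) :=
  (n%:R * (comp_dim d k)%:R)^-1 *: \sum_(i < n) mode_gram k (X i).

End Model.

(* "Probability at least q", without assuming that A is measurable. *)
Definition prob_ge (q : R) (A : set T) : Prop :=
  exists E : set T, [/\ measurable E, E `<=` A & (q%:E <= P E)%E].

End Probability.

(* c1 is large enough for every delta_{n,k} >= c1 * delta_rate to dominate the
   off-diagonal errors of all S_n^k with high probability, uniformly over the
   models with subgaussian constant C0 and min_k m_k >= log p. *)
Definition dominating (R : realType) (C0 c1 : R) : Prop :=
  exists2 c' : R, 0 < c' &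
  forall (L : nat) (d : 'I_L -> nat) (n : nat)
    (disp : measure_display) (T : measurableType disp) (P : probability T R)
    (Psi : forall k, 'M[R]_(d k))
    (Z : 'I_n -> {RV P >-> (dimp d).-tuple R}) (X : 'I_n -> T -> tensor R d)
    (delta : 'I_L -> R),
  (2 <= L)%N -> (forall k, (0 < d k)%N) -> (1 <= n)%N ->
  kron_sum_model C0 Psi Z X ->
  ln (dimp d)%:R <= (mmin d)%:R :> R ->
  (forall k, c1 * delta_rate n (invmx (kron_sum Psi)) k <= delta k) ->
  prob_ge P (1 - L%:R * expR (- (c' * ln (dimp d)%:R)))
    [set w | forall (k : 'I_L) (i j : 'I_(d k)), i != j ->
      `|mode_cov k (X ^~ w) i j
        - fine 'E_P[fun w' => mode_cov k (X ^~ w') i j]%E| <= delta k].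

(* Main.v *)
Require Import Defs.
From HB Require Import structures.
From mathcomp Require Import all_boot all_order all_algebra.
From mathcomp Require Import all_classical all_reals all_analysis.
From mathcomp Require Import measurable_realfun.
From mathcomp Require Import ring lra zify.
From mathcomp Require complex.

(** The estimator minimises a strongly convex loss plus a penalty, and the proof
    compares the values of the objective at [Omega0] and at a distance [x] from
    it in Frobenius norm.

    Curvature. The divergence of [- ln det] at [Omega0] is at least of order
    [x ^ 2 / opnorm Omega0 ^ 2] ([logdet_gap]), as long as the perturbation is
    small in operator norm; for larger perturbations the bound degrades to a
    linear one, with the right slope. Kronecker sums have an operator norm smaller
    than their Frobenius norm by the factor [sqrt ((L + 1) / mmin d)]
    ([opnorm_kron_sum]), because the identity and the traceless components are
    orthogonal ([frobenius_kron_sum]) and highly repetitive. This is why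
    [n * mmin d ^ 2] appears in the sample size.

    Noise. The loss is perturbed by [tr ((S - Sigma0)^T Delta)], where only the
    partial traces of [S - Sigma0] matter ([trace_kron_sum]). Off the diagonal they
    are the errors of the mode covariances, each dominated by the penalty, which
    leaves a cost proportional to the square root of the sparsity. On the diagonal
    there is no penalty; there the whole gradient has norm of order
    [opnorm Sigma0 * sqrt (D / n)], with [D] the number of diagonal entries of all
    factors plus one ([diag_gradient_tail]). Together with [D <= 2 L p / mmin d]
    this gives the two terms of the rate. The cost is thus linear in the distance
    and the curvature is quadratic, so all minimisers lie in a ball whose radius is
    the ratio of the two ([teralasso_close]); a minimiser exists by compactness
    ([teralasso_nonempty]).

    Concentration. All errors are centred quadratic forms in the noise, and are
    controlled by a Hanson-Wright inequality ([hanson_wright]). Its moment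
    generating function is computed by integrating out one variable at a time: the
    quadratic form that remains is the one that Gaussian integration would give, and
    the pivots multiply to a determinant ([mgf_qform_det]). Independence enters
    through the invariance of the joint law under resampling of one coordinate
    ([resample]). For the off-diagonal errors a union bound over entries is enough
    and also provides the constant [c1] ([dominating_exists]). For the gradient on
    the diagonal, the supremum over directions is reduced to finitely many by
    rounding to integer vectors ([lattice_rounding], [card_lattice_le]). *)

Set Implicit Arguments.
Unset Strict Implicit.
Unset Printing Implicit Defensive.

Import Order.TTheory GRing.Theory Num.Theory.

Local Open Scope classical_set_scope.
Local Open Scope ring_scope.

(** * Spectral theory of real symmetric matrices *)
Section Spectral.
Variable R : realType.

Lemma det_conj (F : comUnitRingType) n (P : 'M[F]_n) (X : 'M[F]_n) :
  P \in unitmx -> \det (invmx P *m X *m P) = \det X.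
Proof.
move=> uP; rewrite !det_mulmx mulrAC -det_mulmx mulVmx // det1 mul1r //.
Qed.

(** The scalar consequences of diagonalisation, which can be stated over [R]
    although the eigenbasis is only available over an algebraically closed
    field. The weights [y] are the squared moduli of the coordinates of [x] in a
    unitary eigenbasis. *)
Definition spectrum_of n (A : 'M[R]_n) (d : 'I_n -> R) : Prop :=
  [/\ forall s, \det (1%:M + s *: A) = \prod_i (1 + s * d i),
      \tr A = \sum_i d i, \tr (A *m A) = \sum_i d i ^+ 2,
      forall i, exists2 x : 'cV[R]_n, x != 0 & A *m x = d i *: x &
      forall x : 'cV[R]_n, exists y : 'I_n -> R,
        [/\ forall i, 0 <= y i, \tr (x^T *m x) = \sum_i y i &
            \tr (x^T *m (A *m A) *m x) = \sum_i d i ^+ 2 * y i]].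

(** A real symmetric matrix becomes hermitian in [C], where the spectral theorem
    gives real eigenvalues; everything in [spectrum_of] is then an identity
    between elements of the image of [f]. A real eigenvector exists because the
    eigenvalues are roots of a polynomial over [R]. *)
Lemma spectrum_of_embedding (C : numClosedFieldType) (f : {rmorphism R -> C})
    n (A : 'M[R]_n) :
  (forall x, Num.conj (f x) = f x) ->
  (forall z, z \is Num.real -> exists x, f x = z) ->
  (forall x, 0 <= f x -> 0 <= x) ->
  A^T = A -> exists d, spectrum_of A d.
Proof.
move=> fJ f_real f_ge0 symA.
have fI : injective f by exact: fmorph_inj.
pose B : 'M[C]_n := map_mx f A.
have Breal : B \is a realmx.
  by apply/mxOverP => i j; rewrite mxE; apply/CrealP; exact: fJ.
have Bsym : B \is symmetricmx.
  apply/is_hermitianmxP; rewrite expr0 scale1r; apply/matrixP => i j.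
  by rewrite !mxE -[in LHS]symA mxE.
have Bherm := realsym_hermsym Bsym Breal.
have := orthomx_spectralP (hermitian_normalmx Bherm).
have := hermitian_spectral_diag_real Bherm.
have := spectral_unitarymx B.
move: (spectralmx B) (spectral_diag B) => P D Punitary Dreal Beq.
have Pun : P \in unitmx by exact: unitarymx_unit.
have [d dE] := choice (fun i => f_real (D 0 i) (mxOverP Dreal 0 i)).
have BBeq : B *m B = invmx P *m diag_mx (\row_i (D 0 i ^+ 2)) *m P.
  have -> : diag_mx (\row_i (D 0 i ^+ 2)) = diag_mx D *m diag_mx D.
    apply/matrixP => i j; rewrite mul_diag_mx !mxE.
    by case: eqP => [->|_]; rewrite ?mulr0n ?mulr0 // !mulr1n expr2.
  by rewrite Beq !mulmxA mulmxK.
have trconj X : \tr (invmx P *m X *m P) = \tr X.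
  by rewrite mxtrace_mulC mulmxA mulmxV // mul1mx.
exists d; split.
- move=> s; apply: fI; rewrite -det_map_mx map_mxD map_mxZ map_mx1 /= -/B.
  have -> : 1%:M + f s *: B = invmx P *m (1%:M + f s *: diag_mx D) *m P.
    rewrite mulmxDr mulmxDl mulmx1 mulVmx // {1}Beq.
    by rewrite -scalemxAr -scalemxAl.
  rewrite det_conj //.
  have -> : 1%:M + f s *: diag_mx D = diag_mx (\row_i (1 + f s * D 0 i)).
    by apply/matrixP => i j; rewrite !mxE; case: eqP => [->|_]; rewrite ?mulr0n ?mulr1n ?mulr0 ?addr0.
  rewrite det_diag rmorph_prod; apply: eq_bigr => i _.
  by rewrite mxE rmorphD rmorph1 rmorphM /= dE.
- apply: fI; rewrite -trace_map_mx -/B Beq trconj rmorph_sum /= mxtrace_diag.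
  by apply: eq_bigr => i _; rewrite dE.
- apply: fI; rewrite -trace_map_mx map_mxM -/B BBeq trconj rmorph_sum /= mxtrace_diag.
  by apply: eq_bigr => i _; rewrite mxE rmorphXn /= dE.
- move=> i.
  have : eigenvalue A (d i).
    rewrite eigenvalue_root_char.
    rewrite -(fmorph_root f) map_char_poly /= -/B -eigenvalue_root_char.
    apply/eigenvalueP; exists (row i P).
      rewrite [X in _ *m X]Beq !mulmxA -row_mul mulmxV // row1 -rowE.
      by rewrite row_diag_mx -scalemxAl -rowE dE.
    apply/negP => /eqP ri0; have := row_mul i P (invmx P).
    rewrite mulmxV // ri0 mul0mx => /rowP /(_ i).
    by rewrite !mxE eqxx => /eqP; rewrite oner_eq0.
  move=> /eigenvalueP[v vA v0]; exists v^T; first by rewrite trmx_eq0.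
  by rewrite -{1}symA -trmx_mul vA linearZ.
- move=> x; have [w wE] : exists w, w = P *m map_mx f x by eexists.
  have PtE : map_mx Num.conj P^T = invmx P.
    by rewrite invmx_unitary.
  have wt : map_mx Num.conj w^T = map_mx f x^T *m invmx P.
    rewrite wE trmx_mul map_mxM PtE; congr (_ *m _).
    by apply/matrixP => i j; rewrite !mxE; exact: fJ.
  have nw i : exists y : R, (0 <= y) /\ (f y = Num.conj (w i 0) * w i 0).
    have h : 0 <= Num.conj (w i 0) * w i 0 by rewrite mulrC mul_conjC_ge0.
    have [y yE] := f_real _ (ger0_real h).
    by exists y; split => //; apply: f_ge0; rewrite yE.
  have [y yP] := choice nw.
  have key (E : 'rV[C]_n) : map_mx f x^T *m (invmx P *m diag_mx E *m P) *m map_mx f x =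
     (\sum_i E 0 i * f (y i))%:M.
    rewrite !mulmxA -wt -[_ *m P *m _]mulmxA -wE.
    apply/matrixP => i j; rewrite !ord1 !mxE mulr1n; apply: eq_bigr => k _.
    rewrite mul_mx_diag !mxE (yP k).2 mulrAC [RHS]mulrC.
    reflexivity.
  have traceE (M : 'M[R]_n) (e : 'I_n -> R) :
     map_mx f M = invmx P *m diag_mx (map_mx f (\row_i e i)) *m P ->
     \tr (x^T *m M *m x) = \sum_i e i * y i.
    move=> ME; apply: fI; rewrite -trace_map_mx !map_mxM ME key mxtrace_scalar mulr1n.
    by rewrite rmorph_sum /=; apply: eq_bigr => i _; rewrite !mxE rmorphM.
  exists y; split.
  + by move=> i; case: (yP i).
  + rewrite -[in LHS](mulmx1 x^T) (traceE 1%:M (fun=> 1)).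
      by apply: eq_bigr => i _; rewrite mul1r.
    have E1 : diag_mx (map_mx f (\row_(i < n) (1 : R))) = 1%:M :> 'M[C]_n.
      by apply/matrixP => i j; rewrite !mxE rmorph1.
    by rewrite map_mx1 E1 mulmx1 mulVmx.
  + apply: traceE; rewrite map_mxM -/B BBeq; congr (_ *m diag_mx _ *m _).
    by apply/matrixP => i j; rewrite !mxE rmorphXn /= dE.
Qed.

Import complex.

Lemma symmetric_spectrum n (A : 'M[R]_n) : A^T = A ->
  exists d, spectrum_of A d.
Proof.
pose C : numClosedFieldType := complex R.
pose f : {rmorphism R -> C} := real_complex R.
have fE a : f a = Complex a 0 by [].
apply: (@spectrum_of_embedding C f).
- move=> x; apply/CrealP; rewrite realE.
  have -> : 0 = f 0 by rewrite rmorph0.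
  by rewrite !fE !lecE /= !eqxx /=; case: (lerP 0 x) => // /ltW.
- move=> z; rewrite realE => /orP[]; case: z => a b; rewrite lecE /= => /andP[/eqP b0 _];
  by exists a; rewrite fE b0.
- by move=> x; rewrite -(rmorph0 f) lecE /= eqxx.
Qed.

End Spectral.

(** * Exponential moments of subgaussian variables *)
Section Scalar.
Variable R : realType.
Implicit Types x y : R.

Lemma sqr_norm_real x : `|x| ^+ 2 = x ^+ 2.
Proof. by rewrite real_normK ?num_real. Qed.

(** A second-order Taylor bound that needs no control on the size of [x]; the
    exponential factor is absorbed by the subgaussian moment. *)
Lemma expR_le_quadratic x : expR x <= 1 + x + x ^+ 2 * expR `|x|.
Proof.
have h1 : expR x - 1 <= x * expR x.
  have := expR_ge1Dx (- x); rewrite -(ler_pM2r (expR_gt0 x)) expRN mulVf ?gt_eqF ?expR_gt0 //.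
  rewrite mulrDl mul1r mulNr; lra.
have h2 := expR_ge1Dx x.
have h3 : expR x - 1 - x <= x * (expR x - 1) by rewrite mulrBr mulr1; lra.
suff : x * (expR x - 1) <= x ^+ 2 * expR `|x| by lra.
have [x0|x0] := leP 0 x.
  by rewrite ger0_norm // expr2 -mulrA ler_wpM2l.
apply: (@le_trans _ _ (x ^+ 2)).
  by rewrite expr2 (ler_wnM2l (ltW x0)) //; lra.
rewrite -[leLHS]mulr1; apply: ler_wpM2l; first exact: sqr_ge0.
have : 0 <= `|x| by []. have := expR_ge1Dx `|x|; lra.
Qed.

(** Convexity of [exp] between [0] and [y]. *)
Lemma expR_convex_le1 (t y : R) : 0 <= t <= 1 -> expR (t * y) <= 1 + t * (expR y - 1).
Proof.
move=> /andP[t0 t1].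
have h1 := expR_ge1Dx (y - t * y); have h2 := expR_ge1Dx (- (t * y)).
have e1 : expR y = expR (t * y) * expR (y - t * y) by rewrite -expRD; congr expR; ring.
have e2 : 1 = expR (t * y) * expR (- (t * y)) by rewrite -expRD subrr expR0.
have p := expR_gt0 (t * y).
have k1 : expR (t * y) * (1 + (y - t * y)) <= expR y by rewrite e1 ler_pM2l.
have k2 : expR (t * y) * (1 - t * y) <= 1 by rewrite [leRHS]e2 ler_pM2l.
have k3 : t * (expR (t * y) * (1 + (y - t * y))) <= t * expR y by rewrite ler_wpM2l.
have k4 : (1 - t) * (expR (t * y) * (1 - t * y)) <= (1 - t) * 1.
  by rewrite ler_wpM2l // subr_ge0.
have -> : expR (t * y) = t * (expR (t * y) * (1 + (y - t * y))) +
   (1 - t) * (expR (t * y) * (1 - t * y)) by ring.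
lra.
Qed.

Lemma le_expR_half x : x <= 2 * expR (x / 2).
Proof. have := expR_ge1Dx (x / 2); lra. Qed.

Lemma sqr_le_expR_half x : 0 <= x -> x ^+ 2 <= 16 * expR (x / 2).
Proof.
move=> x0; have h := expR_ge1Dx (x / 4).
have -> : expR (x / 2) = expR (x / 4) ^+ 2 by rewrite expr2 -expRD; congr expR; lra.
rewrite -[16]/(4 * 4)%:R natrM -expr2 -exprMn ler_sqr ?nnegrE //; first lra.
Qed.

End Scalar.

Section Subgaussian.
Context (R : realType) (d : measure_display) (T : measurableType d)
  (P : probability T R).
Local Open Scope ereal_scope.

Lemma integral_EFin_cst (c : R) : \int[P]_w c%:E = c%:E.
Proof.
by rewrite -[RHS]mule1 -(probability_setT P); exact: integral_cst.
Qed.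

(** The linear term of the Taylor bound integrates to zero, so only an upper
    bound [G] on the quadratic remainder matters. *)
Lemma integral_expR_centered (X G : T -> R) (q : R) :
  measurable_fun setT X -> P.-integrable setT (EFin \o X) ->
  \int[P]_w (X w)%:E = 0 -> measurable_fun setT G ->
  (forall w, X w ^+ 2 * expR `|X w| <= G w)%R ->
  \int[P]_w (G w)%:E <= q%:E ->
  \int[P]_w (expR (X w))%:E <= (expR q)%:E.
Proof.
move=> mX iX X0 mG XG Gq.
have G0 w : (0 <= G w)%R.
  by apply: le_trans (XG w); rewrite mulr_ge0 ?sqr_ge0 ?expR_ge0.
have iG : P.-integrable setT (EFin \o G).
  apply/integrableP; split; first exact/measurable_EFinP.
  rewrite (eq_integral (fun w => (G w)%:E)); first exact: le_lt_trans Gq (ltry _).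
  by move=> w _ /=; rewrite ger0_norm.
have i1 : P.-integrable setT (EFin \o cst (1%R : R)).
  exact: finite_measure_integrable_cst.
apply: (@le_trans _ _ (\int[P]_w ((EFin \o cst (1%R : R)) w + ((EFin \o X) w + (EFin \o G) w)))).
  apply: ge0_le_integral => //=.
  - by apply/measurable_EFinP; apply: measurableT_comp.
  - by do 2 (apply: emeasurable_funD => //); apply/measurable_EFinP.
  - move=> w _; rewrite lee_fin; have := expR_le_quadratic (X w); have := XG w; lra.
rewrite integralD //; last exact: integrableD.
rewrite integralD // X0 add0e integral_EFin_cst.
apply: (@le_trans _ _ (1 + q%:E)); first by rewrite leeD2l.
by rewrite -EFinD lee_fin expR_ge1Dx.
Qed.

Variables (K : R) (Y : T -> R).
Hypothesis K0 : (0 < K)%R.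
Hypothesis mY : measurable_fun setT Y.
Hypothesis Y1 : \int[P]_w (Y w)%:E = 0.
Hypothesis Y2 : \int[P]_w (Y w ^+ 2)%:E = 1.
Hypothesis YK : \int[P]_w (expR (Y w ^+ 2 / K ^+ 2))%:E <= 2%:E.

Lemma integrable_sqr : P.-integrable setT (EFin \o (fun w => (Y w ^+ 2)%R)).
Proof.
have m2 : measurable_fun setT (fun w => (Y w ^+ 2)%R) by apply: measurable_funX.
apply/integrableP; split; first exact/measurable_EFinP.
rewrite (eq_integral (fun w => (Y w ^+ 2)%:E)) ?Y2 ?ltry // => w _ /=.
by rewrite ger0_norm ?sqr_ge0.
Qed.

Lemma integrable_lin (a : R) : P.-integrable setT (EFin \o (fun w => (a * Y w)%R)).
Proof.
apply: (@le_integrable _ _ _ _ _ measurableT _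
  (fun w => (a ^+ 2)%:E + (EFin \o (fun w => (Y w ^+ 2)%R)) w)).
- by apply/measurable_EFinP; apply: measurable_funM.
- move=> w _ /=; rewrite lee_fin [leRHS]ger0_norm ?addr_ge0 ?sqr_ge0 //.
  have := sqr_ge0 (`|a| - `|Y w|); rewrite normrM sqrrB !sqr_norm_real.
  have : (0 <= `|a| * `|Y w|)%R by rewrite mulr_ge0.
  have := sqr_ge0 a; have := sqr_ge0 (Y w); lra.
- apply: integrableD => //; last exact: integrable_sqr.
  exact: finite_measure_integrable_cst.
Qed.

Lemma integral_lin (a : R) : \int[P]_w (a * Y w)%:E = 0.
Proof.
rewrite (eq_integral (fun w => a%:E * (EFin \o (fun w => (1 * Y w)%R)) w)); last first.
  by move=> w _ /=; rewrite mul1r EFinM.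
rewrite integralZl //; last exact: integrable_lin.
rewrite (eq_integral (fun w => (Y w)%:E)) ?Y1 ?mule0 // => w _ /=.
by rewrite mul1r.
Qed.

Let mexp (c e : R) : measurable_fun setT (fun w => c * expR (Y w ^+ 2 / e))%R.
Proof.
apply: measurable_funM => //; apply: measurableT_comp => //.
by apply: measurable_funM => //; apply: measurable_funX.
Qed.

Let int_exp (c : R) : (0 <= c)%R ->
  \int[P]_w (c * expR (Y w ^+ 2 / K ^+ 2))%:E <= (2 * c)%:E.
Proof.
move=> c0; under eq_integral do rewrite EFinM.
rewrite ge0_integralZl_EFin //; first by rewrite mulrC EFinM lee_wpmul2l.
apply/measurable_EFinP.
by have := mexp 1 (K ^+ 2); under eq_fun do rewrite mul1r.
Qed.

(** Jensen's inequality for the power [b * K ^+ 2 <= 1] of the assumed moment,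
    in the linearised form of [expR_convex_le1]. *)
Lemma mgf_sqr (b : R) : (0 <= b)%R -> (b * K ^+ 2 <= 1)%R ->
  \int[P]_w (expR (b * Y w ^+ 2))%:E <= (expR (b * K ^+ 2))%:E.
Proof.
move=> b0 bK; set t := (b * K ^+ 2)%R in bK *.
have t01 : (0 <= t <= 1)%R by rewrite bK mulr_ge0 ?sqr_ge0.
have t0 : (0 <= t)%R by case/andP: t01.
apply: (@le_trans _ _ (\int[P]_w (((1 - t)%R)%:E + (t * expR (Y w ^+ 2 / K ^+ 2))%:E))).
  apply: ge0_le_integral => //=.
  - by apply/measurable_EFinP; apply: measurableT_comp => //; apply: measurable_funM => //;
      apply: measurable_funX.
  - by apply: emeasurable_funD => //; apply/measurable_EFinP; exact: mexp.
  - move=> w _; rewrite -EFinD lee_fin.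
    have -> : (b * Y w ^+ 2 = t * (Y w ^+ 2 / K ^+ 2))%R.
      by rewrite /t; field; rewrite gt_eqF.
    have := expR_convex_le1 (Y w ^+ 2 / K ^+ 2) t01; lra.
rewrite ge0_integralD //=; last 3 first.
- by move=> w _; rewrite lee_fin subr_ge0.
- by move=> w _; rewrite lee_fin mulr_ge0 ?expR_ge0.
- by apply/measurable_EFinP; exact: mexp.
rewrite integral_EFin_cst.
apply: (@le_trans _ _ ((1 - t)%:E + (2 * t)%:E)); first by rewrite leeD2l ?int_exp.
rewrite -EFinD lee_fin; have := expR_ge1Dx t; lra.
Qed.

Definition lin_var : R := (4 * expR 1 * K ^+ 2)%R.

Lemma lin_var_ge : (K ^+ 2 <= lin_var)%R.
Proof.
rewrite /lin_var ler_peMl ?sqr_ge0 //; have := expR_ge1Dx (1%R : R); lra.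
Qed.

(** For small [a] the Taylor remainder is controlled by the moment of [Y ^ 2];
    for large [a] the product [a Y] is at most half of the sum of
    [(a K) ^ 2] and [(Y / K) ^ 2], and centring is irrelevant. *)
Lemma mgf_lin (a : R) :
  \int[P]_w (expR (a * Y w))%:E <= (expR (lin_var * a ^+ 2))%:E.
Proof.
have K20 : (0 < K ^+ 2)%R by rewrite exprn_gt0.
have [aK|aK] := leP (a ^+ 2 * K ^+ 2)%R 1%R.
  apply: (@integral_expR_centered _
    (fun w => 2 * a ^+ 2 * K ^+ 2 * expR 1 * expR (Y w ^+ 2 / K ^+ 2))%R).
  - exact: measurable_funM.
  - exact: integrable_lin.
  - exact: integral_lin.
  - exact: mexp.
  - move=> w; set y := Y w; set u := (y ^+ 2 / K ^+ 2)%R.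
    have u0 : (0 <= u)%R by rewrite divr_ge0 ?sqr_ge0.
    have yu : (y ^+ 2 = u * K ^+ 2)%R by rewrite /u mulfVK // gt_eqF.
    have h1 : (`|a * y| <= 1 + u / 2)%R.
      have : (`|a * y| ^+ 2 <= u)%R.
        rewrite sqr_norm_real exprMn yu mulrCA ler_piMr //.
      have := sqr_ge0 (`|a * y| - 1)%R; rewrite sqrrB1; lra.
    have h2 := le_expR_half u.
    rewrite exprMn yu.
    have -> : (2 * a ^+ 2 * K ^+ 2 * expR 1 * expR u =
      (a ^+ 2 * ((2 * expR (u / 2)) * K ^+ 2)) * (expR (1 + u / 2)))%R.
      rewrite expRD.
      have -> : (expR u = expR (u / 2) * expR (u / 2))%R by rewrite -expRD; congr expR; lra.
      ring.
    apply: ler_pM; rewrite ?ler_expR ?expR_ge0 //.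
      by apply: mulr_ge0; [exact: sqr_ge0|apply: mulr_ge0 => //; exact: sqr_ge0].
    by rewrite ler_wpM2l ?sqr_ge0 // ler_wpM2r ?sqr_ge0.
  - have c0 : (0 <= 2 * a ^+ 2 * K ^+ 2 * expR 1)%R.
      by rewrite mulr_ge0 ?expR_ge0 // mulr_ge0 ?sqr_ge0 // mulr_ge0 ?sqr_ge0.
    apply: (le_trans (int_exp c0)).
    by rewrite lee_fin /lin_var le_eqVlt; apply/orP; left; apply/eqP; ring.
apply: (@le_trans _ _ (\int[P]_w (expR (a ^+ 2 * K ^+ 2 / 2) *
    expR ((2 * K ^+ 2)^-1 * Y w ^+ 2))%:E)).
  apply: ge0_le_integral => //=.
  - by apply/measurable_EFinP; apply: measurableT_comp => //; apply: measurable_funM.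
  - apply/measurable_EFinP; apply: measurable_funM => //.
    by apply: measurableT_comp => //; apply: measurable_funM => //; apply: measurable_funX.
  - move=> w _; rewrite lee_fin -expRD ler_expR.
    have := sqr_ge0 (a * K - Y w / K)%R.
    have -> : ((a * K - Y w / K) ^+ 2 = a ^+ 2 * K ^+ 2 - 2 * (a * Y w) + Y w ^+ 2 / K ^+ 2)%R.
      by field; rewrite gt_eqF.
    have -> : ((2 * K ^+ 2)^-1 * Y w ^+ 2 = Y w ^+ 2 / K ^+ 2 / 2)%R.
      by field; rewrite gt_eqF.
    lra.
under eq_integral do rewrite EFinM.
rewrite ge0_integralZl_EFin //; last first.
  apply/measurable_EFinP; apply: measurableT_comp => //.
  by apply: measurable_funM => //; apply: measurable_funX.
have h : ((2 * K ^+ 2)^-1 * K ^+ 2 = 2^-1)%R by field; rewrite gt_eqF.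
apply: (@le_trans _ _ ((expR (a ^+ 2 * K ^+ 2 / 2))%:E * (expR ((2 * K ^+ 2)^-1 * K ^+ 2))%:E)).
  apply: lee_wpmul2l; first by rewrite lee_fin expR_ge0.
  by apply: mgf_sqr; [rewrite invr_ge0 mulr_ge0 // ltW|rewrite h; lra].
rewrite h -EFinM lee_fin -expRD ler_expR.
have : (a ^+ 2 * K ^+ 2 <= lin_var * a ^+ 2)%R.
  by rewrite mulrC ler_wpM2r ?sqr_ge0 // lin_var_ge.
lra.
Qed.

Lemma mgf_lin_sqr (a b : R) : (0 <= b)%R -> (2 * b * K ^+ 2 <= 1)%R ->
  \int[P]_w (expR (a * Y w + b * Y w ^+ 2))%:E <=
  (expR (2 * lin_var * a ^+ 2 + b * K ^+ 2))%:E.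
Proof.
move=> b0 bK.
(* Young's inequality with the factor that makes both terms equal in the end. *)
set s := expR (2 * lin_var * a ^+ 2 - b * K ^+ 2)%R.
have s0 : (0 < s)%R by exact: expR_gt0.
apply: (@le_trans _ _ (\int[P]_w ((s^-1 / 2 * expR (2 * a * Y w))%:E +
    (s / 2 * expR (2 * b * Y w ^+ 2))%:E))).
  apply: ge0_le_integral => //=.
  - apply/measurable_EFinP; apply: measurableT_comp => //.
    by apply: measurable_funD; apply: measurable_funM => //; apply: measurable_funX.
  - apply: emeasurable_funD; apply/measurable_EFinP; apply: measurable_funM => //;
    apply: measurableT_comp => //; apply: measurable_funM => //; exact: measurable_funX.
  - move=> w _; rewrite -EFinD lee_fin expRD.
    set e1 := expR _; set e2 := expR _.
    have -> : (expR (2 * a * Y w) = e1 ^+ 2)%R.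
      by rewrite expr2 -expRD; congr expR; ring.
    have -> : (expR (2 * b * Y w ^+ 2) = e2 ^+ 2)%R.
      by rewrite /e1 [RHS]expr2 -expRD; congr expR; ring.
    have := mulr_ge0 (ltW (s0)) (sqr_ge0 (e1 / s - e2)%R).
    have -> : (s * (e1 / s - e2) ^+ 2 = e1 ^+ 2 / s - 2 * (e1 * e2) + s * e2 ^+ 2)%R.
      by field; rewrite gt_eqF.
    have -> : (s^-1 / 2 * e1 ^+ 2 = e1 ^+ 2 / s / 2)%R by ring.
    lra.
have ml : measurable_fun setT (fun w => (expR (2 * a * Y w))%:E).
  by apply/measurable_EFinP; apply: measurableT_comp => //; apply: measurable_funM.
have mq : measurable_fun setT (fun w => (expR (2 * b * Y w ^+ 2))%:E).
  by apply/measurable_EFinP; apply: measurableT_comp => //; apply: measurable_funM => //;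
     apply: measurable_funX.
have s20 : (0 <= s / 2)%R by rewrite divr_ge0 // ltW.
have s20' : (0 <= s^-1 / 2)%R by rewrite divr_ge0 // invr_ge0 ltW.
have [c1 c1E] : exists c1, c1 = (s^-1 / 2)%R by exists (s^-1 / 2)%R.
have [c2 c2E] : exists c2, c2 = (s / 2)%R by exists (s / 2)%R.
rewrite -c1E -c2E in s20 s20' *; under eq_integral do rewrite 2!EFinM.
rewrite ge0_integralD //; last 4 first.
- by move=> w _; rewrite -EFinM lee_fin mulr_ge0 ?expR_ge0.
- exact: measurable_funeM.
- by move=> w _; rewrite -EFinM lee_fin mulr_ge0 ?expR_ge0.
- exact: measurable_funeM.
rewrite !ge0_integralZl_EFin //.
have h1 := mgf_lin (2 * a).
have h2 : \int[P]_w (expR (2 * b * Y w ^+ 2))%:E <= (expR (2 * b * K ^+ 2))%:E.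
  by apply: mgf_sqr => //; rewrite mulr_ge0.
apply: (@le_trans _ _ (c1%:E * (expR (lin_var * (2 * a) ^+ 2))%:E +
                       c2%:E * (expR (2 * b * K ^+ 2))%:E)).
  by apply: leeD; apply: lee_wpmul2l => //; rewrite lee_fin.
rewrite c1E c2E -!EFinM -EFinD lee_fin le_eqVlt; apply/orP; left; apply/eqP.
rewrite /s -expRN mulrAC -expRD [(expR _ / 2 * _)%R]mulrAC -expRD.
set e := expR (_ + _); set e' := expR (_ + _); set e'' := expR (_ + _).
have -> : e = e'' by rewrite /e /e''; congr expR; ring.
have -> : e' = e'' by rewrite /e' /e''; congr expR; ring.
by field.
Qed.

Definition sqr_var : R := (32 * K ^+ 4 * expR (K ^- 2))%R.

(** The Taylor remainder of [b (Y ^ 2 - 1)] is quadratic in [b] and is again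
    dominated by a multiple of [exp (Y ^ 2 / K ^ 2)]. *)
Lemma mgf_centered_sqr (b : R) : (2 * `|b| * K ^+ 2 <= 1)%R ->
  \int[P]_w (expR (b * (Y w ^+ 2 - 1)))%:E <= (expR (sqr_var * b ^+ 2))%:E.
Proof.
move=> bK.
have K20 : (0 < K ^+ 2)%R by rewrite exprn_gt0.
apply: (@integral_expR_centered _
  (fun w => 16 * K ^+ 4 * b ^+ 2 * expR (K ^- 2) * expR (Y w ^+ 2 / K ^+ 2))%R).
- by apply: measurable_funM => //; apply: measurable_funB => //; apply: measurable_funX.
- rewrite (_ : _ \o _ = (fun w => b%:E * (EFin \o (fun w => (Y w ^+ 2)%R)) w + (- b)%:E)).
    apply: integrableD => //; last exact: finite_measure_integrable_cst.
    by apply: integrableZl => //; exact: integrable_sqr.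
  by apply/funext => w /=; rewrite -EFinM -EFinD mulrBr mulr1.
- rewrite (eq_integral (fun w => b%:E * (EFin \o (fun w => (Y w ^+ 2)%R)) w + (- b)%:E)).
    rewrite integralD //=; last 2 first.
    + by apply: integrableZl => //; exact: integrable_sqr.
    + exact: finite_measure_integrable_cst.
    rewrite integralZl //; last exact: integrable_sqr.
    by rewrite /= Y2 integral_EFin_cst mule1 -EFinD subrr.
  by move=> w _ /=; rewrite -EFinM -EFinD mulrBr mulr1.
- exact: mexp.
- move=> w; set y := Y w; set u := ((y ^+ 2 + 1) / K ^+ 2)%R.
  have y0 := sqr_ge0 y.
  have u0 : (0 <= u)%R by apply: divr_ge0; [exact: addr_ge0|exact: ltW].
  have yu : (y ^+ 2 + 1 = u * K ^+ 2)%R by rewrite /u mulfVK // gt_eqF.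
  have habs : (`|y ^+ 2 - 1| <= y ^+ 2 + 1)%R by rewrite ler_norml; apply/andP; split; lra.
  have h1 : (`|b * (y ^+ 2 - 1)| <= u / 2)%R.
    rewrite normrM; apply: (@le_trans _ _ (`|b| * (u * K ^+ 2))%R).
      by rewrite -yu ler_wpM2l.
    have : (u * (2 * `|b| * K ^+ 2) <= u * 1)%R by rewrite ler_wpM2l.
    have -> : (`|b| * (u * K ^+ 2) = u * (2 * `|b| * K ^+ 2) / 2)%R by field.
    lra.
  have h2 := sqr_le_expR_half u0.
  have h3 : ((y ^+ 2 - 1) ^+ 2 <= u ^+ 2 * K ^+ 4)%R.
    rewrite (_ : (K ^+ 4 = (K ^+ 2) ^+ 2)%R); last by ring.
    by rewrite -exprMn -yu -[leLHS]sqr_norm_real ler_sqr ?nnegrE // addr_ge0.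
  have -> : (16 * K ^+ 4 * b ^+ 2 * expR (K ^- 2) * expR (y ^+ 2 / K ^+ 2) =
      (b ^+ 2 * ((16 * expR (u / 2)) * K ^+ 4)) * expR (u / 2))%R.
    have h : (expR (u / 2) * expR (u / 2) = expR (K ^- 2) * expR (y ^+ 2 / K ^+ 2))%R.
      by rewrite -2!expRD; congr expR; rewrite /u; field; rewrite gt_eqF.
    transitivity (16 * K ^+ 4 * b ^+ 2 * (expR (K ^- 2) * expR (y ^+ 2 / K ^+ 2)))%R.
      by ring.
    by rewrite -h; ring.
  rewrite exprMn; apply: ler_pM; rewrite ?ler_expR ?expR_ge0 //.
    by apply: mulr_ge0; exact: sqr_ge0.
  apply: ler_wpM2l; first exact: sqr_ge0. apply: le_trans h3 _.
  by rewrite ler_wpM2r // exprn_even_ge0.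
- have c0 : (0 <= 16 * K ^+ 4 * b ^+ 2 * expR (K ^- 2))%R.
    rewrite mulr_ge0 ?expR_ge0 // mulr_ge0 ?sqr_ge0 // mulr_ge0 //.
    exact: exprn_even_ge0.
  apply: (le_trans (int_exp c0)).
  by rewrite lee_fin /sqr_var le_eqVlt; apply/orP; left; apply/eqP; ring.
Qed.

End Subgaussian.

(** * Frobenius and operator norms *)
Section Frobenius.
Variable R : realType.

Lemma trace_gramE m n (A : 'M[R]_(m, n)) :
  \tr (A^T *m A) = \sum_i \sum_j A i j ^+ 2.
Proof.
rewrite exchange_big; apply: eq_bigr => j _; rewrite mxE; apply: eq_bigr => i _.
by rewrite mxE expr2.
Qed.

Lemma trace_gram_ge0 m n (A : 'M[R]_(m, n)) : 0 <= \tr (A^T *m A).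
Proof. by rewrite trace_gramE; do 2!apply: sumr_ge0 => ? _; exact: sqr_ge0. Qed.

Lemma frobenius_ge0 m n (A : 'M[R]_(m, n)) : 0 <= frobenius A.
Proof. exact: sqrtr_ge0. Qed.

Lemma sqr_frobenius m n (A : 'M[R]_(m, n)) : frobenius A ^+ 2 = \tr (A^T *m A).
Proof. by rewrite sqr_sqrtr // trace_gram_ge0. Qed.

Lemma frobenius_le m n m' n' (A : 'M[R]_(m, n)) (B : 'M[R]_(m', n')) (c : R) :
  0 <= c -> \tr (A^T *m A) <= c ^+ 2 * \tr (B^T *m B) ->
  frobenius A <= c * frobenius B.
Proof.
move=> c0 h; rewrite -ler_sqr ?nnegrE ?frobenius_ge0 ?mulr_ge0 ?frobenius_ge0 //.
by rewrite exprMn !sqr_frobenius.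
Qed.

Lemma frobenius_eq0 m n (A : 'M[R]_(m, n)) : (frobenius A == 0) = (A == 0).
Proof.
apply/eqP/eqP => [A0|->]; last first.
  by rewrite /frobenius mulmx0 mxtrace0 sqrtr0.
have : \sum_i \sum_j A i j ^+ 2 = 0.
  by rewrite -trace_gramE -sqr_frobenius A0 expr0n.
move=> /psumr_eq0P h; apply/matrixP => i j; rewrite mxE.
have := h (fun i _ => sumr_ge0 _ (fun j _ => sqr_ge0 (A i j))) i isT.
move=> /psumr_eq0P h'; have := h' (fun j _ => sqr_ge0 (A i j)) j isT.
by move/eqP; rewrite sqrf_eq0 => /eqP.
Qed.

Lemma frobeniusZ m n (a : R) (A : 'M[R]_(m, n)) : frobenius (a *: A) = `|a| * frobenius A.
Proof.
rewrite /frobenius -sqrtr_sqr -sqrtrM ?sqr_ge0 // !trace_gramE mulr_sumr.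
congr Num.sqrt; apply: eq_bigr => i _; rewrite mulr_sumr; apply: eq_bigr => j _.
by rewrite mxE exprMn.
Qed.

Lemma cauchy_schwarz (I : finType) (f g : I -> R) :
  (\sum_i f i * g i) ^+ 2 <= (\sum_i f i ^+ 2) * (\sum_i g i ^+ 2).
Proof.
set a := \sum_i f i ^+ 2; set b := \sum_i g i ^+ 2; set c := \sum_i f i * g i.
have a0 : 0 <= a by apply: sumr_ge0 => i _; exact: sqr_ge0.
have : 0 <= \sum_i (a * g i - c * f i) ^+ 2 by apply: sumr_ge0 => i _; exact: sqr_ge0.
have -> : \sum_i (a * g i - c * f i) ^+ 2 = a * (a * b - c ^+ 2).
  transitivity (\sum_i (a ^+ 2 * g i ^+ 2 - 2 * a * c * (f i * g i) + c ^+ 2 * f i ^+ 2)).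
    by apply: eq_bigr => i _; ring.
  rewrite !big_split /= sumrN -!mulr_sumr -/a -/b -/c; ring.
have [a_gt0|] := ltrP 0 a; first by rewrite pmulr_rge0 // subr_ge0.
move=> a_le0 _; have a00 : a = 0 by apply: le_anti; rewrite a_le0.
have f0 i : f i = 0.
  have /psumr_eq0P := a00 => /(_ (fun i _ => sqr_ge0 (f i)) i isT) /eqP.
  by rewrite sqrf_eq0 => /eqP.
by rewrite /c big1 ?expr0n ?a00 ?mul0r // => i _; rewrite f0 mul0r.
Qed.

Lemma trace_mulE m n (A B : 'M[R]_(m, n)) : \tr (A^T *m B) = \sum_i \sum_j A i j * B i j.
Proof.
rewrite exchange_big; apply: eq_bigr => j _; rewrite mxE; apply: eq_bigr => i _.
by rewrite mxE.
Qed.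

Lemma trace_cauchy_schwarz m n (A B : 'M[R]_(m, n)) :
  `|\tr (A^T *m B)| <= frobenius A * frobenius B.
Proof.
rewrite -ler_sqr ?nnegrE ?mulr_ge0 ?frobenius_ge0 // sqr_norm_real exprMn !sqr_frobenius.
rewrite !trace_gramE trace_mulE !pair_big /=.
exact: (cauchy_schwarz (fun p => A p.1 p.2) (fun p => B p.1 p.2)).
Qed.

End Frobenius.

Section OperatorNorm.
Variable R : realType.

Let vals m n (A : 'M[R]_(m, n)) : set R :=
  [set frobenius (A *m x) | x in [set x : 'cV[R]_n | frobenius x <= 1]].

Lemma frobenius_mulmx_le m n (A : 'M[R]_(m, n)) (x : 'cV[R]_n) :
  frobenius (A *m x) <= frobenius A * frobenius x.
Proof.
apply: frobenius_le; first exact: frobenius_ge0.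
rewrite sqr_frobenius !trace_gramE mulr_suml; apply: ler_sum => i _.
rewrite big_ord1 mxE; have := cauchy_schwarz (A i) (fun j => x j 0).
move=> h; apply: (le_trans h); apply: ler_wpM2l.
  by apply: sumr_ge0 => j _; exact: sqr_ge0.
by apply: ler_sum => j _; rewrite big_ord1.
Qed.

Let vals_sup m n (A : 'M[R]_(m, n)) : has_sup (vals A).
Proof.
split.
  exists 0, 0; first by rewrite /= /frobenius mulmx0 mxtrace0 sqrtr0 ler01.
  by rewrite /frobenius !mulmx0 mxtrace0 sqrtr0.
exists (frobenius A) => _ [x /= x1 <-]; apply: le_trans (frobenius_mulmx_le _ _) _.
by rewrite ler_piMr ?frobenius_ge0.
Qed.

Lemma opnorm_ge0 m n (A : 'M[R]_(m, n)) : 0 <= opnorm A.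
Proof.
apply: (@le_trans _ _ (frobenius (A *m 0))); first exact: frobenius_ge0.
apply: sup_upper_bound; first exact: vals_sup.
by exists 0 => //=; rewrite /frobenius mulmx0 mxtrace0 sqrtr0 ler01.
Qed.

Lemma opnorm_mulmx m n (A : 'M[R]_(m, n)) (x : 'cV[R]_n) :
  frobenius (A *m x) <= opnorm A * frobenius x.
Proof.
have [x0|x0] := eqVneq x 0.
  by rewrite x0 /frobenius !mulmx0 mxtrace0 sqrtr0 mulr0.
have xn0 : 0 < frobenius x by rewrite lt_neqAle frobenius_ge0 eq_sym frobenius_eq0 x0.
rewrite -ler_pdivrMr //.
have -> : frobenius (A *m x) / frobenius x = frobenius (A *m ((frobenius x)^-1 *: x)).
  by rewrite -scalemxAr frobeniusZ ger0_norm ?invr_ge0 ?ltW // mulrC.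
apply: sup_upper_bound; first exact: vals_sup.
exists ((frobenius x)^-1 *: x) => //=.
by rewrite frobeniusZ ger0_norm ?invr_ge0 ?(ltW xn0) // mulVf // gt_eqF.
Qed.

Lemma opnorm_le m n (A : 'M[R]_(m, n)) (c : R) : 0 <= c ->
  (forall x : 'cV[R]_n, frobenius (A *m x) <= c * frobenius x) -> opnorm A <= c.
Proof.
move=> c0 h; apply: ge_sup; first by case: (vals_sup A).
move=> _ [x /= x1 <-]; apply: le_trans (h x) _.
by rewrite ler_piMr.
Qed.

Lemma opnorm_triangle m n (A B : 'M[R]_(m, n)) : opnorm (A + B) <= opnorm A + opnorm B.
Proof.
apply: opnorm_le; first by rewrite addr_ge0 ?opnorm_ge0.
move=> x; rewrite mulmxDl.
set u := A *m x; set v := B *m x.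
have : frobenius (u + v) <= frobenius u + frobenius v.
  rewrite -ler_sqr ?nnegrE ?addr_ge0 ?frobenius_ge0 // sqr_frobenius.
  have := trace_cauchy_schwarz u v; rewrite ler_norml => /andP[_].
  rewrite [(u + v)^T]linearD /= mulmxDl !mulmxDr !mxtraceD -!sqr_frobenius.
  have -> : \tr (v^T *m u) = \tr (u^T *m v) by rewrite -mxtrace_tr trmx_mul trmxK.
  rewrite sqrrD; lra.
have := opnorm_mulmx A x; have := opnorm_mulmx B x; rewrite -/u -/v; lra.
Qed.

Lemma opnorm_sum m n (I : Type) (r : seq I) (F : I -> 'M[R]_(m, n)) :
  opnorm (\sum_(i <- r) F i) <= \sum_(i <- r) opnorm (F i).
Proof.
elim: r => [|i r IH]; last by rewrite !big_cons; apply: le_trans (opnorm_triangle _ _) _; rewrite lerD2l.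
rewrite !big_nil; apply: opnorm_le => // x.
by rewrite mul0mx /frobenius trmx0 mul0mx mxtrace0 sqrtr0 mul0r.
Qed.

Lemma quad_form_le n (A : 'M[R]_n) (x : 'cV[R]_n) :
  `|\tr (x^T *m A *m x)| <= opnorm A * \tr (x^T *m x).
Proof.
rewrite -mulmxA; apply: le_trans (trace_cauchy_schwarz _ _) _.
rewrite -sqr_frobenius expr2 mulrA [leRHS]mulrC ler_wpM2l ?frobenius_ge0 //.
exact: opnorm_mulmx.
Qed.

End OperatorNorm.

(** * Determinants and condition numbers of symmetric matrices *)
Section ScalarLog.
Variable R : realType.
Implicit Types x y t : R.

Lemma expR_ge_sqr y : -2 <= y -> (1 + y / 2) ^+ 2 <= expR y.
Proof.
move=> y2; have -> : expR y = expR (y / 2) ^+ 2.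
  by rewrite expr2 -expRD; congr expR; lra.
rewrite ler_sqr ?nnegrE ?expR_ge0 //; last lra.
exact: expR_ge1Dx.
Qed.

(** Squaring [1 + y <= exp y] at half the argument is accurate enough to second
    order; the same holds for [expR_ge_1D]. *)
Lemma expR_le_1B x : `|x| <= 4^-1 -> expR (- x - x ^+ 2) <= 1 - x.
Proof.
rewrite ler_norml => /andP[x1 x2].
have h : (1 + (x + x ^+ 2) / 2) ^+ 2 <= expR (x + x ^+ 2).
  by apply: expR_ge_sqr; have := sqr_ge0 x; lra.
have -> : - x - x ^+ 2 = - (x + x ^+ 2) by ring.
rewrite expRN invf_ple ?posrE ?expR_gt0 //; last lra.
apply: le_trans h; rewrite -div1r ler_pdivrMr; last lra.
have -> : (1 + (x + x ^+ 2) / 2) ^+ 2 * (1 - x) =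
  1 + x ^+ 2 * ((1 - x) * (1 + x) ^+ 2 / 4 - x) by field.
suff : 0 <= x ^+ 2 * ((1 - x) * (1 + x) ^+ 2 / 4 - x) by lra.
apply: mulr_ge0; first exact: sqr_ge0.
nra.
Qed.

Lemma expR_ge_1D x : `|x| <= 2^-1 -> 1 + x <= expR (x - x ^+ 2 / 8).
Proof.
rewrite ler_norml => /andP[x1 x2].
have x3 : x ^+ 2 <= 2^-1 ^+ 2 by nra.
apply: le_trans (expR_ge_sqr _); last by lra.
have -> : (1 + (x - x ^+ 2 / 8) / 2) ^+ 2 =
  1 + x + x ^+ 2 * ((1 - x / 8) ^+ 2 / 4 - 8^-1) by field.
suff : 0 <= x ^+ 2 * ((1 - x / 8) ^+ 2 / 4 - 8^-1) by lra.
apply: mulr_ge0; first exact: sqr_ge0.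
nra.
Qed.

(** With [t = 1] this is a second-order bound on [ln] near [1]; a smaller [t]
    extends it to all [x > -1], because [x - ln (1 + x)] is convex and vanishes
    at [0]. *)
Lemma ln_1D_le t x : 0 < t <= 1 -> -1 < x -> `|t * x| <= 2^-1 ->
  ln (1 + x) <= x - t * x ^+ 2 / 8.
Proof.
move=> /andP[t0 t1] x1 tx.
have h1 := expR_ge_1D tx.
have t01 : 0 <= t <= 1 by rewrite (ltW t0).
have h2 := expR_convex_le1 (ln (1 + x)) t01.
have x0 : 0 < 1 + x by lra.
rewrite lnK ?posrE // in h2.
have h3 : expR (t * ln (1 + x)) <= expR (t * (x - t * x ^+ 2 / 8)).
  apply: (le_trans h2).
  have -> : t * (x - t * x ^+ 2 / 8) = t * x - (t * x) ^+ 2 / 8 by ring.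
  apply: le_trans h1; lra.
by move: h3; rewrite ler_expR ler_pM2l.
Qed.

End ScalarLog.

Section SymmetricMatrices.
Variable R : realType.

Lemma trace_gram_gt0 n (x : 'cV[R]_n) : x != 0 -> 0 < \tr (x^T *m x).
Proof.
by rewrite -sqr_frobenius -frobenius_eq0 => x0; rewrite exprn_even_gt0.
Qed.

Lemma eigen_quad_form n (A : 'M[R]_n) (x : 'cV[R]_n) a : A *m x = a *: x ->
  \tr (x^T *m A *m x) = a * \tr (x^T *m x).
Proof. by move=> h; rewrite -mulmxA h -scalemxAr mxtraceZ. Qed.

(** With vanishing trace the first-order terms of the eigenvalue bounds cancel:
    the logarithm of the determinant is quadratic in the matrix, which is what
    makes a chaos without diagonal subgaussian. *)
Lemma det_1B_ge n (A : 'M[R]_n) : A^T = A -> \tr A = 0 ->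
  (forall x : 'cV[R]_n, `|\tr (x^T *m A *m x)| <= 4^-1 * \tr (x^T *m x)) ->
  expR (- \tr (A *m A)) <= \det (1%:M - A).
Proof.
move=> symA tr0 hA; have [d [detE trE trE2 eig _]] := symmetric_spectrum symA.
have := detE (-1); rewrite scaleN1r => ->.
have d4 i : `|d i| <= 4^-1.
  have [x x0 /eigen_quad_form xE] := eig i; have := hA x.
  have xp := trace_gram_gt0 x0.
  by rewrite xE normrM [`|\tr _|]gtr0_norm // ler_pM2r.
have -> : - \tr (A *m A) = \sum_i (- d i - d i ^+ 2).
  by rewrite big_split /= !sumrN -trE tr0 trE2; ring.
rewrite expR_sum; apply: ler_prod => i _; rewrite expR_ge0 /= mulN1r.
exact: expR_le_1B.
Qed.

Lemma logdet_1D_le n (E : 'M[R]_n) (t : R) : E^T = E -> 0 < t <= 1 ->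
  (forall x : 'cV[R]_n, x != 0 -> 0 < \tr (x^T *m (1%:M + E) *m x)) ->
  (forall x : 'cV[R]_n, t * `|\tr (x^T *m E *m x)| <= 2^-1 * \tr (x^T *m x)) ->
  0 < \det (1%:M + E) /\ ln (\det (1%:M + E)) <= \tr E - t * \tr (E *m E) / 8.
Proof.
move=> symE /[dup] /andP[t0 t1] t01 pos bnd.
have [d [detE trE trE2 eig _]] := symmetric_spectrum symE.
have := detE 1; rewrite scale1r => ->.
have d1 i : -1 < d i.
  have [x x0 xE] := eig i; have xp := trace_gram_gt0 x0.
  have := pos x x0; rewrite mulmxDr mulmx1 mulmxDl mxtraceD (eigen_quad_form xE).
  have -> : \tr (x^T *m x) + d i * \tr (x^T *m x) = (1 + d i) * \tr (x^T *m x) by ring.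
  by rewrite pmulr_lgt0 //; lra.
have dt i : `|t * d i| <= 2^-1.
  have [x x0 xE] := eig i; have xp := trace_gram_gt0 x0.
  have := bnd x; rewrite (eigen_quad_form xE) normrM [`|\tr _|]gtr0_norm // mulrA ler_pM2r //.
  by rewrite normrM [`|t|]gtr0_norm.
have pos1 i : 0 < 1 + 1 * d i by have := d1 i; lra.
split; first by apply: prodr_gt0.
have -> : \prod_i (1 + 1 * d i) = expR (\sum_i ln (1 + 1 * d i)).
  by rewrite expR_sum; apply: eq_bigr => i _; rewrite lnK // posrE.
rewrite expRK.
have -> : \tr E - t * \tr (E *m E) / 8 = \sum_i (d i - t * d i ^+ 2 / 8).
  rewrite big_split /= sumrN -trE trE2; congr (_ - _).
  by rewrite -mulr_suml -mulr_sumr.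
by apply: ler_sum => i _; rewrite mul1r; apply: ln_1D_le.
Qed.

Lemma posdef_trace n (A : 'M[R]_n) (x : 'cV[R]_n) : posdef A -> x != 0 ->
  0 < \tr (x^T *m A *m x).
Proof. by move=> [_ h] x0; rewrite trace_mx11; exact: h. Qed.

Lemma posdef_unit n (A : 'M[R]_n) : posdef A -> A \in unitmx.
Proof.
move=> Apd; rewrite -row_free_unit; apply/row_freeP; apply: contrapT => h.
have : ~~ row_free A by apply/negP => /row_freeP.
rewrite -kermx_eq0 => /rowV0Pn[v vker v0].
have vA : v *m A = 0 by apply/sub_kermxP.
have := posdef_trace Apd (x := v^T); rewrite trmx_eq0 v0 trmxK vA mul0mx mxtrace0 ltxx.
by move=> /(_ isT).
Qed.

Lemma posdef_inv n (A : 'M[R]_n) : posdef A -> posdef (invmx A).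
Proof.
move=> /[dup] /posdef_unit uA Apd; have symA : A^T = A by case: Apd.
split; first by rewrite trmx_inv symA.
move=> x x0; have := Apd.2 (invmx A *m x).
rewrite trmx_mul trmx_inv symA !mulmxA mulmxKV //.
apply; apply: contra x0 => /eqP h.
by rewrite -[x](mulKVmx uA) h mulmx0.
Qed.

(** For a positive definite matrix the operator norm is the largest eigenvalue:
    [A ^ 2] averages the squares of the eigenvalues. *)
Lemma posdef_opnorm n (A : 'M[R]_n) : (0 < n)%N -> posdef A ->
  [/\ 0 < opnorm A, eigenvalue A (opnorm A) & forall a, eigenvalue A a -> 0 < a <= opnorm A].
Proof.
move=> n0 Apd; have symA : A^T = A by case: Apd.
have [d [_ _ _ eig quad]] := symmetric_spectrum symA.
have eig_le a : eigenvalue A a -> 0 < a <= opnorm A.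
  move=> /eigenvalueP[v vA v0]; have v0' : v^T != 0 by rewrite trmx_eq0.
  have vE : A *m v^T = a *: v^T by rewrite -{1}symA -trmx_mul vA linearZ.
  have xp := trace_gram_gt0 v0'.
  have := posdef_trace Apd v0'; rewrite (eigen_quad_form vE) pmulr_lgt0 // => a0.
  rewrite a0 /=; have := opnorm_mulmx A v^T; rewrite vE frobeniusZ gtr0_norm //.
  by rewrite ler_pM2r // lt_neqAle frobenius_ge0 eq_sym frobenius_eq0 v0'.
have eig_d i : eigenvalue A (d i).
  have [x x0 xE] := eig i; apply/eigenvalueP; exists x^T; last by rewrite trmx_eq0.
  by rewrite -{1}symA -trmx_mul xE linearZ.
pose i0 := [arg max_(i > Ordinal n0) d i]%O.
have i0P i : d i <= d i0.
  by rewrite /i0; case: Order.TotalTheory.arg_maxP => // j _ h; exact: h.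
have d_gt0 i : 0 < d i by case/andP: (eig_le _ (eig_d i)).
have opE : opnorm A = d i0.
  apply/le_anti; rewrite andbC; case/andP: (eig_le _ (eig_d i0)) => _ -> /=.
  apply: opnorm_le => [|x]; first exact: ltW.
  apply: frobenius_le; first exact: ltW.
  have [y [y0 xE AE]] := quad x.
  rewrite trmx_mul symA -!mulmxA [A *m (A *m x)]mulmxA mulmxA AE xE mulr_sumr.
  apply: ler_sum => i _; rewrite ler_wpM2r // ler_sqr ?nnegrE //; exact: ltW.
by split=> //; rewrite opE.
Qed.

(** Inversion exchanges the two ends of the spectrum. *)
Lemma kappa_inv n (A : 'M[R]_n) : (0 < n)%N -> posdef A ->
  kappa (invmx A) = opnorm (invmx A) * opnorm A.
Proof.
move=> n0 Apd; have uA := posdef_unit Apd.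
have [a0 eA leA] := posdef_opnorm n0 Apd.
have [b0 eB leB] := posdef_opnorm n0 (posdef_inv Apd).
have eig_inv (B : 'M[R]_n) a : posdef B -> eigenvalue B a -> eigenvalue (invmx B) a^-1.
  move=> Bpd eBa; have [_ _ /(_ _ eBa) /andP[a_gt0 _]] := posdef_opnorm n0 Bpd.
  move: eBa => /eigenvalueP[v vB v0]; apply/eigenvalueP; exists v => //.
  rewrite -[in RHS](mulmxK (posdef_unit Bpd) v) vB -scalemxAl scalerA mulVf ?scale1r //.
  by rewrite gt_eqF.
have phi_maxE : phi_max (invmx A) = opnorm (invmx A).
  apply/le_anti/andP; split.
    by apply: ge_sup; [exists (opnorm (invmx A))|move=> a /leB /andP[]].
  by apply: ub_le_sup => //; exists (opnorm (invmx A)) => a /leB /andP[].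
have phi_minE : phi_min (invmx A) = (opnorm A)^-1.
  have lbnd : lbound [set a | eigenvalue (invmx A) a] (opnorm A)^-1.
    move=> a /= ea; have /andP[a_gt0 _] := leB _ ea.
    have := eig_inv _ _ (posdef_inv Apd) ea; rewrite invmxK => /leA /andP[_].
    by rewrite invf_ple ?posrE.
  apply/le_anti/andP; split.
    by apply: ge_inf; [exists (opnorm A)^-1|exact: eig_inv].
  by apply: lb_le_inf => //; exists (opnorm A)^-1; exact: eig_inv.
by rewrite /kappa phi_maxE phi_minE invrK.
Qed.

End SymmetricMatrices.

(** * Independence as invariance under resampling *)
Section Resampling.
Context (R : realType) (d : measure_display) (T : measurableType d)
  (P : probability T R) (d' : measure_display) (U : measurableType d') (N : nat).
Local Open Scope ereal_scope.

Definition set_tnth (t : N.-tuple U) (j : 'I_N) (u : U) : N.-tuple U :=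
  [tuple if i == j then u else tnth t i | i < N].

Definition box (B : 'I_N -> set U) : set (N.-tuple U) :=
  [set t | forall i, B i (tnth t i)].

Lemma measurable_box (B : 'I_N -> set U) :
  (forall i, measurable (B i)) -> measurable (box B).
Proof.
move=> mB; have -> : box B = \bigcap_(i in [set: 'I_N]) ((fun t => tnth t i) @^-1` B i).
  by apply/seteqP; split=> [t Bt i _|t Bt i]; [exact: Bt|exact: (Bt i I)].
apply: fin_bigcap_measurable; first exact: finite_finset.
move=> i _; rewrite -[X in measurable X]setTI.
by apply: (measurable_tnth i).
Qed.

Lemma sub_sigma_boxes (A : set (N.-tuple U)) :
  measurable A -> <<s [set box B | B in [set B | forall i, measurable (B i)]] >> A.
Proof.
apply: smallest_sub; first exact: smallest_sigma_algebra.
apply: (big_ind (fun S => S `<=` _)) => //.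
  by move=> S1 S2 h1 h2; rewrite subUset.
move=> i _ _ [C mC <-]; rewrite setTI; apply: sub_gen_smallest.
exists (fun k => if k == i then C else setT) => /=.
  by move=> k; case: ifP.
apply/seteqP; split=> [t /(_ i)|t Ct k]; first by rewrite /= eqxx.
by case: eqP => // ->.
Qed.

(** Boxes are stable under intersection and generate the product sigma-algebra. *)
Lemma measure_boxes_eq (m1 m2 : {measure set (N.-tuple U) -> \bar R}) :
  m1 setT < +oo ->
  (forall B, (forall i, measurable (B i)) -> m1 (box B) = m2 (box B)) ->
  forall A, measurable A -> m1 A = m2 A.
Proof.
move=> m1fin m12 A mA.
have boxT : box (fun=> setT) = setT :> set (N.-tuple U).
  by apply/seteqP; split.
apply: (@g_sigma_algebra_measure_unique _ R _
  [set box B | B in [set B | forall i, measurable (B i)]] _ (fun=> setT)).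
- by move=> _ [B mB <-]; exact: measurable_box.
- by move=> _; exists (fun=> setT).
- by rewrite bigcup_const.
- move=> _ _ [B mB <-] [C mC <-].
  exists (fun i => B i `&` C i); first by move=> i; apply: measurableI.
  by apply/seteqP; split=> [t h|t [h1 h2] i]; split=> // i; case: (h i).
- by move=> _ [B mB <-]; exact: m12.
- by move=> _.
- exact: sub_sigma_boxes.
Qed.

Variable Y : T -> N.-tuple U.
Hypothesis mY : measurable_fun setT Y.
Hypothesis iY : independent P (fun i w => tnth (Y w) i).

Let measurable_tnthY j : measurable_fun setT (fun w => tnth (Y w) j).
Proof. exact: (measurableT_comp (measurable_tnth j) mY). Qed.

Let resampled (j : 'I_N) (w : T * T) : N.-tuple U :=
  set_tnth (Y w.1) j (tnth (Y w.2) j).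

Let measurable_resampled j : measurable_fun setT (resampled j).
Proof.
apply/measurable_fun_tnthP => i.
have [->|ij] := eqVneq i j.
  rewrite (_ : _ \o _ = (fun w => tnth (Y w) j) \o snd); last first.
    by apply/funext => w /=; rewrite tnth_mktuple eqxx.
  exact: measurableT_comp.
rewrite (_ : _ \o _ = (fun w => tnth (Y w) i) \o fst); last first.
  by apply/funext => w /=; rewrite tnth_mktuple (negbTE ij).
exact: measurableT_comp.
Qed.

Lemma prob_box (B : 'I_N -> set U) : (forall i, measurable (B i)) ->
  P (Y @^-1` box B) = \prod_i P ((fun w => tnth (Y w) i) @^-1` B i).
Proof.
move=> mB; have := iY (J := [set: 'I_N]%SET) (B := B) (fun i _ => mB i).
rewrite (_ : \bigcap_(i in _) _ = Y @^-1` box B); last first.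
  apply/seteqP; split=> w /= h i; last by move=> _; exact: h.
  by apply: h => /=; rewrite inE.
by move=> ->; apply: eq_bigl => i; rewrite inE.
Qed.

(** If the $j$-th entry is replaced by that of an independent copy, the joint
    law does not change: on boxes both laws are the product of the marginals.
    With Tonelli this is the only consequence of independence that is used. *)
Lemma resample (F : N.-tuple U -> \bar R) (j : 'I_N) :
  measurable_fun setT F -> (forall t, 0 <= F t) ->
  \int[P]_w F (Y w) = \int[P]_w \int[P]_w' F (set_tnth (Y w) j (tnth (Y w') j)).
Proof.
move=> mF F0.
have mFr := measurableT_comp mF (measurable_resampled j).
transitivity (\int[P \x P]_z F (resampled j z)); last first.
  exact: (fubini_tonelli1 _ mFr (fun z => F0 _)).
have E1 := ge0_integral_pushforward mY P measurableT mF (fun t _ => F0 t).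
have E2 := ge0_integral_pushforward (measurable_resampled j) (P \x P)
  measurableT mF (fun t _ => F0 t).
rewrite !preimage_setT in E1 E2.
rewrite -[LHS]E1 -[RHS]E2; apply: eq_measure_integral => A mA _.
apply: measure_boxes_eq => //.
  by rewrite /= /pushforward preimage_setT probability_setT ltry.
move=> B mB; rewrite /= /pushforward prob_box //.
pose B' i := if i == j then setT else B i.
have mB' i : measurable (B' i) by rewrite /B'; case: ifP.
have -> : resampled j @^-1` box B =
    (Y @^-1` box B') `*` ((fun w => tnth (Y w) j) @^-1` B j).
  apply/seteqP; split=> [[w w'] /= h|[w w'] /= [h1 h2] i].
    split=> [i|]; last by have := h j; rewrite tnth_mktuple eqxx.
    by rewrite /B'; case: ifPn => // ij; have := h i; rewrite tnth_mktuple (negbTE ij).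
  rewrite tnth_mktuple; case: ifPn => [/eqP -> //|ij].
  by have := h1 i; rewrite /B' (negbTE ij).
rewrite product_measure1E; last 2 first.
- rewrite -[X in measurable X]setTI; apply: mY => //; exact: measurable_box.
- by rewrite -[X in measurable X]setTI; apply: measurable_tnthY.
transitivity ((\prod_i P ((fun w => tnth (Y w) i) @^-1` B' i)) *
  P ((fun w => tnth (Y w) j) @^-1` B j)); last first.
  by congr (_ * _); exact/esym/prob_box.
rewrite (bigD1 j) //= [X in _ = X * _](bigD1 j) //= /B' eqxx.
rewrite preimage_setT probability_setT mul1e muleC; congr (_ * _).
by apply: eq_bigr => i /negbTE ->.
Qed.

Lemma resample_le (F G : N.-tuple U -> \bar R) (j : 'I_N) :
  measurable_fun setT F -> (forall t, 0 <= F t) -> measurable_fun setT G ->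
  (forall t, \int[P]_w' F (set_tnth t j (tnth (Y w') j)) <= G t) ->
  \int[P]_w F (Y w) <= \int[P]_w G (Y w).
Proof.
move=> mF F0 mG FG; rewrite (resample j mF F0); apply: ge0_le_integral => //.
- by move=> w _; apply: integral_ge0 => w' _; exact: F0.
- have mFr := measurableT_comp mF (measurable_resampled j).
  exact: (measurable_fun_fubini_tonelli_F (m2 := P) _ mFr (fun z => F0 _)).
- exact: measurableT_comp mG mY.
Qed.

(** Stated as an inequality between non-negative integrals, the product rule for
    expectations needs no integrability: one factor is resampled at a time. *)
Lemma integral_prod_le (g : 'I_N -> U -> R) (c : 'I_N -> R) :
  (forall i, measurable_fun setT (g i)) -> (forall i u, (0 <= g i u)%R) ->
  (forall i, \int[P]_w (g i (tnth (Y w) i))%:E <= (c i)%:E) ->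
  \int[P]_w (\prod_i g i (tnth (Y w) i))%:E <= (\prod_i c i)%:E.
Proof.
move=> mg g0 gc.
have c0 i : (0 <= c i)%R.
  rewrite -lee_fin; apply: le_trans (gc i); apply: integral_ge0 => w _.
  by rewrite lee_fin.
pose G k (z : N.-tuple U) : R := (\prod_(i < N | (i < k)%N) g i (tnth z i))%R.
have G0 k z : (0 <= G k z)%R by apply: prodr_ge0.
have mG k : measurable_fun setT (G k).
  rewrite (_ : G k = fun z => \prod_(i < N) if (i < k)%N then g i (tnth z i) else 1)%R;
    last by apply/funext => z; rewrite /G big_mkcond.
  apply: measurable_prod => i _; case: (i < k)%N => //.
  exact: (measurableT_comp (mg i) (measurable_tnth i)).
suff H k : (k <= N)%N ->
    \int[P]_w (G k (Y w))%:E <= (\prod_(i < N | (i < k)%N) c i)%:E.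
  have full (F : 'I_N -> R) : (\prod_(i < N | (i < N)%N) F i = \prod_i F i)%R.
    by apply: eq_bigl => i; rewrite ltn_ord.
  have := H N (leqnn N); rewrite full.
  by under eq_integral do rewrite /G full.
elim: k => [_|k IH kN].
  rewrite big_pred0 // (eq_integral (fun=> 1)); last first.
    by move=> w _; rewrite /G big_pred0.
  by rewrite -[leRHS]mule1 -(probability_setT P) integral_cst.
pose j := Ordinal kN.
have split_big (F : 'I_N -> R) : (\prod_(i < N | (i < k.+1)%N) F i =
    F j * \prod_(i < N | (i < k)%N) F i)%R.
  rewrite (bigD1 j) //=; congr (_ * _)%R; apply: eq_bigl => i.
  by rewrite -val_eqE /= ltnS andbC -ltn_neqAle.
apply: (@le_trans _ _ (\int[P]_w (c j * G k (Y w))%:E)).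
  apply: (@resample_le (fun z => (G k.+1 z)%:E) (fun z => (c j * G k z)%:E) j).
  - by apply/measurable_EFinP.
  - by move=> z; rewrite lee_fin.
  - by apply/measurable_EFinP; exact: measurable_funM.
  - move=> z; rewrite (eq_integral (fun w => (G k z)%:E * (g j (tnth (Y w) j))%:E)); last first.
      move=> w _; rewrite -EFinM /G split_big tnth_mktuple eqxx mulrC; congr ((_ * _)%:E).
      apply: eq_bigr => i ik; rewrite tnth_mktuple; case: eqP => // ij.
      by move: ik; rewrite ij /= ltnn.
    rewrite ge0_integralZl_EFin //; last 2 first.
    + by move=> w _; rewrite lee_fin.
    + apply/measurable_EFinP; exact: (measurableT_comp (mg j) (measurable_tnthY j)).
    by rewrite [(c j * _)%R]mulrC EFinM lee_wpmul2l ?lee_fin.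
under eq_integral do rewrite EFinM.
rewrite ge0_integralZl_EFin //; last 2 first.
- by move=> w _; rewrite lee_fin.
- by apply/measurable_EFinP; exact: (measurableT_comp (mG k) mY).
by rewrite split_big EFinM lee_wpmul2l ?lee_fin // IH // ltnW.
Qed.

End Resampling.

(** * Concentration of quadratic forms *)
Section QuadraticForm.
Context (R : realType) (N : nat).
Implicit Types (M : 'M[R]_N) (z : N.-tuple R).

Definition col_of z : 'cV[R]_N := \col_i tnth z i.

Definition qform M z : R := \sum_i \sum_j M i j * (tnth z i * tnth z j).

Lemma qformE M z : qform M z = \tr ((col_of z)^T *m M *m col_of z).
Proof.
rewrite /qform exchange_big trace_mx11 mxE; apply: eq_bigr => j _.
rewrite mxE mulr_suml; apply: eq_bigr => i _; rewrite !mxE; ring.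
Qed.

Lemma measurable_qform M : measurable_fun setT (qform M).
Proof.
apply: measurable_sum => i; apply: measurable_sum => j.
by apply: measurable_funM => //; apply: measurable_funM; exact: measurable_tnth.
Qed.

(** Elimination of the variable [j] from the quadratic form of [M]: the Schur
    complement of the entry [(j, j)] of [1 - t M], subtracted from [1] and
    divided by [t]. *)
Definition eliminate (t : R) (j : 'I_N) M : 'M[R]_N :=
  \matrix_(i, l) if (i == j) || (l == j) then 0
                 else M i l + t / (1 - t * M j j) * (M i j * M j l).

Section Eliminate.
Variables (t : R) (j : 'I_N) (M : 'M[R]_N).
Hypothesis symM : M^T = M.
Hypothesis tM : 1 - t * M j j != 0.

Let symE i l : M i l = M l i.
Proof. by rewrite -[in LHS]symM mxE. Qed.

Lemma eliminate_sym : (eliminate t j M)^T = eliminate t j M.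
Proof.
apply/matrixP => i l; rewrite !mxE orbC; case: ifP => // _.
by rewrite (symE l i) (symE l j) (symE j i); congr (_ + _ * _); rewrite mulrC.
Qed.

Let m : 'cV[R]_N := \col_i if i == j then 0 else M i j.
Let s : R := t / (1 - t * M j j).

(** The Schur complement as a congruence by a unitriangular matrix. Elimination
    in place, inside matrices of a fixed size, avoids casts between dimensions;
    the condition on the rows above [j] keeps that matrix triangular. *)
Lemma det_eliminate : (forall i : 'I_N, (i < j)%N -> M i j = 0) ->
  \det (1%:M - t *: M) = (1 - t * M j j) * \det (1%:M - t *: eliminate t j M).
Proof.
move=> Mj.
pose U : 'M[R]_N := 1%:M - s *: (m *m delta_mx 0 j).
pose D : 'M[R]_N := diag_mx (\row_i if i == j then 1 - t * M j j else 1).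
have UE i l : U i l = (i == l)%:R - s * (m i 0 * (l == j)%:R).
  by rewrite !mxE big_ord1 !mxE /= eq_sym.
have detU : \det U = 1.
  rewrite det_trig.
    rewrite big1 // => i _; rewrite UE eqxx mxE.
    by case: eqP => _; rewrite ?mul0r ?mulr0 subr0.
  apply/is_trig_mxP => i l il; rewrite UE mxE.
  have -> : (i == l) = false by apply/negbTE; rewrite neq_ltn il.
  case: (eqVneq l j) => [lj|_]; last by rewrite mulr0 mulr0 subr0.
  case: eqP => [_|_]; first by rewrite mul0r mulr0 subr0.
  by rewrite Mj -?lj // mul0r mulr0 subr0.
have detD : \det D = 1 - t * M j j.
  rewrite det_diag (bigD1 j) //= mxE eqxx big1 ?mulr1 // => i /negbTE ij.
  by rewrite mxE ij.
have [X XD XE] : exists2 X, X = (1%:M - t *: eliminate t j M) *m D &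
    forall i l, X i l = ((i == l)%:R - t * eliminate t j M i l) *
      (if l == j then 1 - t * M j j else 1).
  by eexists => // i l; rewrite /D mul_mx_diag !mxE.
have UX : U *m X = X - s *: (m *m row j X).
  by rewrite mulmxBl mul1mx -scalemxAl -mulmxA -rowE.
have YU (Y : 'M[R]_N) : Y *m U^T = Y - s *: (col j Y *m m^T).
  rewrite linearB linearZ /= trmx1 mulmxBr mulmx1 -scalemxAr trmx_mul trmx_delta.
  by rewrite mulmxA -colE.
have key : 1%:M - t *: M = U *m X *m U^T.
  rewrite YU UX; apply/matrixP => i l; rewrite !mxE !big_ord1 !mxE !big_ord1.
  rewrite !mxE !XE !mxE !eqxx /= ?orbT ?mulr0 ?subr0 /s.
  case: (eqVneq i j) => [->|ij]; case: (eqVneq l j) => [->|lj] /=;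
    rewrite ?eqxx ?(negbTE ij) ?(negbTE lj) ?orbT ?(eq_sym j) ?(negbTE ij) ?(negbTE lj) /= ?(symE j l).
  - by ring.
  - by field.
  - by field.
  - by field.
have -> : \det (1%:M - t *: M) = \det U * (\det (1%:M - t *: eliminate t j M) * \det D) * \det U^T.
  by rewrite key XD !det_mulmx.
by rewrite det_tr detU detD; ring.
Qed.

(** The quadratic form as a polynomial in the variable [j]; the constant term is
    arranged so that the completed square shows the eliminated matrix. *)
Lemma qform_set (z : N.-tuple R) (u : R) :
  qform M (set_tnth z j u) =
  M j j * u ^+ 2 + 2 * (\sum_(i | i != j) M i j * tnth z i) * u +
  (qform (eliminate t j M) z - s * (\sum_(i | i != j) M i j * tnth z i) ^+ 2).
Proof.
set a := \sum_(i | i != j) _.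
have aE : \sum_(l | l != j) M j l * tnth z l = a.
  by apply: eq_bigr => i _; rewrite (symE j).
have elimE : qform (eliminate t j M) z =
    \sum_(i | i != j) \sum_(l | l != j) M i l * (tnth z i * tnth z l) + s * a ^+ 2.
  rewrite /qform (bigD1 j) //= big1 ?add0r; last first.
    by move=> l _; rewrite mxE eqxx mul0r.
  transitivity (\sum_(i | i != j) \sum_(l | l != j)
     (M i l + s * (M i j * M j l)) * (tnth z i * tnth z l)).
    apply: eq_bigr => i ij; rewrite (bigD1 j) //= mxE eqxx orbT mul0r add0r.
    by apply: eq_bigr => l lj; rewrite mxE (negbTE ij) (negbTE lj).
  rewrite expr2 -{2}aE mulr_suml mulr_sumr -big_split /=; apply: eq_bigr => i ij.
  rewrite mulr_sumr mulr_sumr -big_split /=; apply: eq_bigr => l lj; ring.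
rewrite elimE /qform (bigD1 j) //= (bigD1 j) //= !tnth_mktuple eqxx.
have -> : \sum_(i < N | i != j) M j i * (u * tnth (set_tnth z j u) i) = a * u.
  rewrite -aE mulr_suml; apply: eq_bigr => i ij.
  by rewrite tnth_mktuple (negbTE ij); ring.
have -> : \sum_(i < N | i != j) \sum_(l < N) M i l *
    (tnth (set_tnth z j u) i * tnth (set_tnth z j u) l) =
    a * u + \sum_(i | i != j) \sum_(l | l != j) M i l * (tnth z i * tnth z l).
  rewrite /a mulr_suml -big_split /=; apply: eq_bigr => i ij.
  rewrite (bigD1 j) //= !tnth_mktuple eqxx (negbTE ij); congr (_ + _); first by ring.
  by apply: eq_bigr => l lj; rewrite tnth_mktuple (negbTE lj).
ring.
Qed.

End Eliminate.

(** The matrix [1 - t M] is positive definite, as a statement about tuples. *)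
Definition below (t : R) M : Prop :=
  forall z, (exists i, tnth z i != 0) -> t * qform M z < \sum_i tnth z i ^+ 2.

Lemma below_diag t M j : below t M -> t * M j j < 1.
Proof.
move=> bM; pose z : N.-tuple R := [tuple (i == j)%:R | i < N].
have := bM z; rewrite (bigD1 j) //= tnth_mktuple eqxx expr1n big1 ?addr0.
  rewrite /qform (bigD1 j) //= (bigD1 j) //= !tnth_mktuple eqxx !mulr1.
  rewrite big1 ?addr0 => [|i /negbTE ij]; last by rewrite tnth_mktuple ij !mulr0.
  rewrite big1 ?addr0; last first.
    by move=> i /negbTE ij; apply: big1 => l _; rewrite tnth_mktuple ij mul0r mulr0.
  by apply; exists j; rewrite tnth_mktuple eqxx oner_neq0.
by move=> i /negbTE ij; rewrite tnth_mktuple ij expr0n.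
Qed.

(** The Schur complement of a positive definite matrix is positive definite: its
    form at [z] is the minimum over the variable [j] of the original one, and the
    minimiser is [u]. *)
Lemma below_eliminate t j M : M^T = M -> below t M -> below t (eliminate t j M).
Proof.
move=> symM bM z z0.
have tM : 0 < 1 - t * M j j by have := below_diag j bM; lra.
set a := \sum_(i | i != j) M i j * tnth z i.
pose u := t * a / (1 - t * M j j).
have qE := qform_set t j symM z u; rewrite -/a in qE.
have sumE : \sum_i tnth (set_tnth z j u) i ^+ 2 = u ^+ 2 + \sum_(i | i != j) tnth z i ^+ 2.
  rewrite (bigD1 j) //= tnth_mktuple eqxx; congr (_ + _).
  by apply: eq_bigr => i ij; rewrite tnth_mktuple (negbTE ij).
rewrite (bigD1 j) //=.
have gap : tnth z j ^+ 2 + \sum_(i < N | i != j) tnth z i ^+ 2 - t * qform (eliminate t j M) z =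
   tnth z j ^+ 2 + (\sum_i tnth (set_tnth z j u) i ^+ 2 - t * qform M (set_tnth z j u)).
  by rewrite sumE qE /u; field; rewrite gt_eqF.
rewrite -subr_gt0 gap.
have [zj|zj] := eqVneq (tnth z j) 0; last first.
  have p : 0 < tnth z j ^+ 2 by rewrite exprn_even_gt0.
  have : 0 <= \sum_i tnth (set_tnth z j u) i ^+ 2 - t * qform M (set_tnth z j u).
    case: (pselect (exists i, tnth (set_tnth z j u) i != 0)) => [h|h].
      by have := bM _ h; lra.
    have h0 i : tnth (set_tnth z j u) i = 0.
      by apply: contrapT => h'; apply: h; exists i; apply/eqP.
    rewrite big1 => [|i _]; last by rewrite h0 expr0n.
    rewrite /qform big1 ?mulr0 ?subr0 // => i _.
    by apply: big1 => l _; rewrite h0 mul0r mulr0.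
  lra.
have : exists i, tnth (set_tnth z j u) i != 0.
  have [i zi] := z0; exists i; rewrite tnth_mktuple; case: (eqVneq i j) => // ij.
  by move: zi; rewrite ij zj eqxx.
by move=> /bM; have := sqr_ge0 (tnth z j); lra.
Qed.

End QuadraticForm.

Section Chaos.
Context (R : realType) (d : measure_display) (T : measurableType d)
  (P : probability T R) (N : nat) (Y : T -> N.-tuple R) (K : R).
Hypothesis mY : measurable_fun setT Y.
Hypothesis iY : independent P (fun i w => tnth (Y w) i).
Hypothesis K0 : 0 < K.
Hypothesis Y1 : forall i, (\int[P]_w (tnth (Y w) i)%:E = 0)%E.
Hypothesis Y2 : forall i, (\int[P]_w (tnth (Y w) i ^+ 2)%:E = 1)%E.
Hypothesis YK : forall i, (\int[P]_w (expR (tnth (Y w) i ^+ 2 / K ^+ 2))%:E <= 2%:E)%E.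

Local Notation t := (8 * lin_var K).

Let mYi i : measurable_fun setT (fun w => tnth (Y w) i).
Proof. exact: (measurableT_comp (measurable_tnth i) mY). Qed.

Let mexpq M : measurable_fun setT (fun z : N.-tuple R => (expR (qform M z))%:E).
Proof. by apply/measurable_EFinP/measurableT_comp => //; exact: measurable_qform. Qed.

(** One variable is integrated out at a time. The exponent is then a quadratic
    polynomial in this variable, and the bound on its exponential moment is
    again the exponential of a quadratic form in the others, whose matrix is the
    one that Gaussian integration would produce. The product of the pivots is
    the determinant. *)
Lemma mgf_qform_det (M : 'M[R]_N) : M^T = M -> (forall i, 0 <= M i i) ->
  below t M ->
  0 < \det (1%:M - t *: M) /\
  (\int[P]_w (expR (qform M (Y w)))%:E <=
   (expR (- ln (\det (1%:M - t *: M)) / 2))%:E)%E.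
Proof.
have v0 : 0 <= lin_var K by apply: le_trans (lin_var_ge K); rewrite sqr_ge0.
suff H n (k := (N - n)%N) (A : 'M[R]_N) : (n <= N)%N -> A^T = A ->
    (forall i, 0 <= A i i) -> below t A ->
    (forall i l : 'I_N, (i < k)%N -> A i l = 0) ->
    0 < \det (1%:M - t *: A) /\
    (\int[P]_w (expR (qform A (Y w)))%:E <=
     (expR (- ln (\det (1%:M - t *: A)) / 2))%:E)%E.
  move=> symM M0 bM; apply: (H N) => // i l.
  by rewrite subnn.
elim: n @k A => [|n IH] k A nN symA A0 bA Ak.
  have -> : A = 0.
    by apply/matrixP => i l; rewrite mxE Ak // /k subn0.
  rewrite scaler0 subr0 det1 ln1 oppr0 mul0r expR0; split=> //.
  rewrite (eq_integral (fun=> 1%:E)) ?integral_EFin_cst // => w _.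
  rewrite /qform big1 ?expR0 // => i _; apply: big1 => l _; by rewrite mxE mul0r.
have kN : (k < N)%N by rewrite /k; lia.
pose j := Ordinal kN.
have tb := below_diag j bA; set b := A j j in tb.
have b0 : 0 <= b by exact: A0.
have pos1 : 0 < 1 - t * b by lra.
have tM : 1 - t * A j j != 0 by rewrite gt_eqF.
have t0 : 0 <= t by rewrite mulr_ge0.
have ts : t <= t / (1 - t * b).
  rewrite ler_pdivlMr // -[leRHS]mulr1 ler_wpM2l //.
  have : 0 <= t * b by rewrite mulr_ge0.
  lra.
have [] := IH (eliminate t j A).
- by lia.
- exact: eliminate_sym.
- move=> i; rewrite mxE; case: ifP => // _; rewrite addr_ge0 //.
  have -> : A j i = A i j by rewrite -[in LHS]symA mxE.
  rewrite mulr_ge0 -?expr2 ?sqr_ge0 // divr_ge0 ?mulr_ge0 //; exact: ltW.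
- exact: below_eliminate.
- move=> i l ik; rewrite mxE.
  case: (eqVneq i j) => //= ij; case: ifP => // _.
  have ik' : (i < k)%N.
    by move: ij; rewrite -val_eqE /= /k; move: ik; lia.
  by rewrite (Ak i l) // (Ak i j) // mul0r mulr0 addr0.
set A' := eliminate t j A => det' int'.
have detE : \det (1%:M - t *: A) = (1 - t * b) * \det (1%:M - t *: A').
  apply: det_eliminate => // i ij; exact: Ak.
rewrite detE; split; first exact: mulr_gt0.
apply: (@le_trans _ _ (\int[P]_w (expR (b * K ^+ 2) * expR (qform A' (Y w)))%:E)%E).
  apply: (@resample_le _ _ _ P _ _ N Y mY iY (fun z => (expR (qform A z))%:E)
    (fun z => (expR (b * K ^+ 2) * expR (qform A' z))%:E) j).
  - exact: mexpq.
  - by move=> z; rewrite lee_fin expR_ge0.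
  - apply/measurable_EFinP; apply: measurable_funM => //.
    by apply: measurableT_comp => //; exact: measurable_qform.
  - move=> z; under eq_integral do rewrite (qform_set t) // -/A' -/b.
    set a := \sum_(i | i != j) _; set c := _ - _ * a ^+ 2.
    rewrite (eq_integral (fun w => ((expR c)%:E *
        (expR (2 * a * tnth (Y w) j + b * tnth (Y w) j ^+ 2))%:E)%E)); last first.
      by move=> w _; rewrite -EFinM -expRD; congr (expR _)%:E; ring.
    rewrite ge0_integralZl_EFin //; last first.
      apply/measurable_EFinP; apply: measurableT_comp => //.
      by apply: measurable_funD; apply: measurable_funM => //; apply: measurable_funX.
    have bK : 2 * b * K ^+ 2 <= 1.
      apply: le_trans (ltW tb); have := lin_var_ge K.
      have : 0 <= lin_var K * b by rewrite mulr_ge0.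
      move=> h1 h2; have : b * K ^+ 2 <= b * lin_var K by rewrite ler_wpM2l.
      lra.
    apply: (@le_trans _ _ ((expR c)%:E * (expR (2 * lin_var K * (2 * a) ^+ 2 + b * K ^+ 2))%:E)%E).
      apply: lee_wpmul2l; first by rewrite lee_fin expR_ge0.
      exact: mgf_lin_sqr.
    rewrite -EFinM lee_fin -!expRD ler_expR /c.
    have := ler_wpM2r (sqr_ge0 a) ts.
    have -> : 2 * lin_var K * (2 * a) ^+ 2 = t * a ^+ 2 by ring.
    lra.
under eq_integral do rewrite EFinM.
rewrite ge0_integralZl_EFin //; last exact: measurableT_comp (mexpq A') mY.
apply: (@le_trans _ _ ((expR (b * K ^+ 2))%:E * (expR (- ln (\det (1%:M - t *: A')) / 2))%:E)%E).
  by apply: lee_wpmul2l => //; rewrite lee_fin expR_ge0.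
rewrite -EFinM lee_fin -expRD ler_expR lnM ?posrE //.
have h1 : ln (1 - t * b) <= - (t * b).
  by have := ln_sublinear pos1; have := le_ln1Dx (x := - (t * b)); lra.
have h2 : b * K ^+ 2 <= b * lin_var K by rewrite ler_wpM2l // lin_var_ge.
have h3 : 0 <= b * lin_var K by rewrite mulr_ge0.
lra.
Qed.

(** The off-diagonal chaos is subgaussian with variance proxy of the order of the
    squared Frobenius norm, because [tr M = 0] in [det_1B_ge]. *)
Lemma mgf_offdiag_qform (M : 'M[R]_N) : M^T = M -> (forall i, M i i = 0) ->
  (forall x : 'cV[R]_N, `|\tr (x^T *m (t *: M) *m x)| <= 4^-1 * \tr (x^T *m x)) ->
  (\int[P]_w (expR (qform M (Y w)))%:E <=
   (expR (t ^+ 2 * frobenius M ^+ 2 / 2))%:E)%E.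
Proof.
move=> symM M0 bM.
have belowM : below t M.
  move=> z [i zi]; have x0 : col_of z != 0.
    by apply: contra zi => /eqP /colP /(_ i); rewrite !mxE => ->.
  have := bM (col_of z); have := trace_gram_gt0 x0.
  have -> : \tr ((col_of z)^T *m (t *: M) *m col_of z) = t * qform M z.
    by rewrite qformE -scalemxAr -scalemxAl mxtraceZ.
  have -> : \tr ((col_of z)^T *m col_of z) = \sum_i tnth z i ^+ 2.
    by rewrite trace_gramE; apply: eq_bigr => l _; rewrite big_ord1 mxE.
  by rewrite ler_norml => h /andP[_]; lra.
have M0' i : 0 <= M i i by rewrite M0.
have [det0 /le_trans] := mgf_qform_det symM M0' belowM; apply.
rewrite lee_fin ler_expR ler_pdivrMr // mulfVK // lerNl.
rewrite -(ler_expR) lnK ?posrE //.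
have -> : t ^+ 2 * frobenius M ^+ 2 = \tr ((t *: M) *m (t *: M)).
  by rewrite sqr_frobenius symM -scalemxAl -scalemxAr !mxtraceZ; ring.
apply: det_1B_ge => //.
- by rewrite linearZ /= symM.
- by rewrite mxtraceZ /mxtrace big1 ?mulr0.
Qed.

Lemma mgf_diag_qform (a : 'I_N -> R) : (forall i, 2 * `|a i| * K ^+ 2 <= 1) ->
  (\int[P]_w (expR (\sum_i a i * (tnth (Y w) i ^+ 2 - 1)))%:E <=
   (expR (sqr_var K * \sum_i a i ^+ 2))%:E)%E.
Proof.
move=> aK.
have := @integral_prod_le _ _ _ P _ _ N Y mY iY
  (fun i u => expR (a i * (u ^+ 2 - 1))) (fun i => expR (sqr_var K * a i ^+ 2)).
rewrite mulr_sumr expR_sum => h; under eq_integral do rewrite expR_sum.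
apply: h => [i|i u|i]; first 2 last.
- exact: mgf_centered_sqr.
- apply: measurableT_comp => //; apply: measurable_funM => //.
  by apply: measurable_funB => //; exact: measurable_funX.
- exact: expR_ge0.
Qed.

End Chaos.

Section Markov.
Context (R : realType) (d : measure_display) (T : measurableType d)
  (P : probability T R).

Lemma measurable_superlevel (f : T -> R) (u : R) : measurable_fun setT f ->
  measurable [set w | u <= f w].
Proof.
move=> mf; have := mf measurableT `[u, +oo[%classic (measurable_itv _); rewrite setTI.
by congr measurable; apply/seteqP; split=> w /=; rewrite in_itv /= andbT.
Qed.

Lemma exp_markov (f : T -> R) (l u b : R) : 0 <= l ->
  measurable_fun setT f ->
  (\int[P]_w (expR (l * f w))%:E <= (expR b)%:E)%E ->
  (P [set w | (u <= f w)%R] <= (expR (b - l * u))%:E)%E.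
Proof.
move=> l0 mf hb.
have mA := measurable_superlevel u mf.
have -> : P [set w | u <= f w] = (\int[P]_w (\1_[set w | (u <= f w)%R] w)%:E)%E.
  by rewrite integral_indic // setIT.
apply: (@le_trans _ _ (\int[P]_w ((expR (- (l * u)))%:E * (expR (l * f w))%:E))%E).
  apply: ge0_le_integral => //.
  - exact/measurable_EFinP/measurable_indic.
  - apply: measurable_funeM; apply/measurable_EFinP; apply: measurableT_comp => //.
    exact: measurable_funM.
  - move=> w _; rewrite -EFinM lee_fin -expRD indicE.
    have [|_] := boolP (w \in _); last exact: expR_ge0.
    rewrite inE /= => uf; rewrite -expR0 ler_expR addrC subr_ge0.
    exact: ler_wpM2l.
rewrite ge0_integralZl_EFin //; last first.
  by apply/measurable_EFinP; apply: measurableT_comp => //; exact: measurable_funM.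
rewrite addrC expRD EFinM; apply: lee_wpmul2l => //.
Qed.

End Markov.

Section OneSampleMoments.
Context (R : realType) (d : measure_display) (T : measurableType d)
  (P : probability T R) (N : nat) (Y : T -> N.-tuple R).
Hypothesis mY : measurable_fun setT Y.
Hypothesis iY : independent P (fun i w => tnth (Y w) i).
Hypothesis Y1 : forall i, (\int[P]_w (tnth (Y w) i)%:E = 0)%E.
Hypothesis Y2 : forall i, (\int[P]_w (tnth (Y w) i ^+ 2)%R%:E = 1)%E.

Let sq i : T -> R := fun w => tnth (Y w) i ^+ 2.
Let pr i j : T -> R := fun w => tnth (Y w) i * tnth (Y w) j.

Let mYi i : measurable_fun setT (fun w => tnth (Y w) i).
Proof. exact: (measurableT_comp (measurable_tnth i) mY). Qed.

Let iY2 i : P.-integrable setT (EFin \o (sq i)).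
Proof. exact: integrable_sqr. Qed.

Lemma integrable_coord_mul (a b : 'I_N) :
  P.-integrable setT (EFin \o (pr a b)).
Proof.
apply: (@le_integrable _ _ _ _ _ measurableT _
  (fun w => (EFin \o (sq a)) w + (EFin \o (sq b)) w)%E).
- by apply/measurable_EFinP; exact: measurable_funM.
- move=> w _ /=; rewrite lee_fin [leRHS]ger0_norm ?addr_ge0 ?sqr_ge0 //.
  rewrite /sq /pr; set x := tnth (Y w) a; set y := tnth (Y w) b.
  have := sqr_ge0 (`|x| - `|y|); rewrite normrM sqrrB !sqr_norm_real.
  have := mulr_ge0 (normr_ge0 x) (normr_ge0 y); lra.
- exact: integrableD.
Qed.

(** Decorrelation from resampling alone: for distinct coordinates the second
    moment of the sum is [2] after resampling one of them, and expanding the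
    square leaves no room for a mixed moment. *)
Lemma integral_coord_mul (a b : 'I_N) :
  (\int[P]_w (tnth (Y w) a * tnth (Y w) b)%:E = (a == b)%:R%:E)%E.
Proof.
case: (eqVneq a b) => [->|ab].
  by rewrite -[RHS](Y2 b); apply: eq_integral => w _; rewrite expr2.
have h : (\int[P]_w ((tnth (Y w) a + tnth (Y w) b) ^+ 2)%:E = 2%:E)%E.
  rewrite (resample mY iY (F := fun z => ((tnth z a + tnth z b) ^+ 2)%:E) a); last 2 first.
  - apply/measurable_EFinP; apply: measurable_funX; apply: measurable_funD; exact: measurable_tnth.
  - by move=> z; rewrite lee_fin sqr_ge0.
  rewrite (eq_integral (fun w => 1%:E + (EFin \o (sq b)) w)%E).
    rewrite integralD //=; last exact: finite_measure_integrable_cst.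
    by rewrite integral_EFin_cst Y2 -EFinD.
  move=> w _; rewrite (eq_integral (fun w' =>
     (EFin \o (sq a)) w' +
     ((EFin \o (fun w' => (2 * tnth (Y w) b) * tnth (Y w') a)%R) w' + (tnth (Y w) b ^+ 2)%R%:E))%E); last first.
    move=> w' _; rewrite !tnth_mktuple eqxx [b == a]eq_sym (negbTE ab) /= -!EFinD /sq; congr EFin.
    by ring.
  have il := integrable_lin (mYi a) (Y2 a) (2 * tnth (Y w) b).
  have ic : P.-integrable setT (fun=> (tnth (Y w) b ^+ 2)%:E).
    exact: finite_measure_integrable_cst.
  rewrite integralD //; last exact: integrableD.
  by rewrite integralD // /= Y2 integral_lin // add0e integral_EFin_cst.
have : (\int[P]_w ((tnth (Y w) a + tnth (Y w) b) ^+ 2)%:E =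
   1 + (1 + 2%:E * \int[P]_w (tnth (Y w) a * tnth (Y w) b)%:E))%E.
  have i2 := integrableZl measurableT 2 (integrable_coord_mul a b).
  have e1 := integralD measurableT (iY2 a) (integrableD measurableT (iY2 b) i2).
  have e2 := integralD measurableT (iY2 b) i2.
  have e3 := integralZl measurableT (integrable_coord_mul a b) 2.
  rewrite e2 e3 in e1.
  transitivity (1 + (1 + 2%:E * \int[P]_x (EFin \o pr a b) x))%E; last by [].
  rewrite -{1}(Y2 a) -(Y2 b) -[RHS]e1.
  apply: eq_integral => w _; rewrite /= -!EFinM -!EFinD /sq /pr; congr EFin; ring.
rewrite h; have := integrable_fin_num measurableT (integrable_coord_mul a b).
case: (\int[P]_w _)%E => // r _; rewrite -EFinM -!EFinD => -[hr].
by rewrite /=; congr EFin; lra.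
Qed.

Lemma integrable_qform (A : 'M[R]_N) :
  P.-integrable setT (EFin \o (fun w => qform A (Y w))).
Proof.
rewrite (_ : _ \o _ = (fun w => \sum_(i <- index_enum 'I_N) \sum_(j <- index_enum 'I_N)
   ((A i j)%:E * (EFin \o (pr i j)) w))%E); last first.
  apply/funext => w /=; rewrite /qform -sumEFin; apply: eq_bigr => i _.
  by rewrite -sumEFin; apply: eq_bigr => j _; rewrite EFinM.
apply: integrable_sum => // i _; apply: integrable_sum => // j _.
exact: (integrableZl measurableT _ (integrable_coord_mul i j)).
Qed.

Lemma integral_qform (A : 'M[R]_N) : (\int[P]_w (qform A (Y w))%:E = (\tr A)%:E)%E.
Proof.
rewrite (eq_integral (fun w => \sum_(i <- index_enum 'I_N) \sum_(j <- index_enum 'I_N)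
   ((A i j)%:E * (EFin \o (pr i j)) w))%E); last first.
  move=> w _ /=; rewrite /qform -sumEFin; apply: eq_bigr => i _.
  by rewrite -sumEFin; apply: eq_bigr => j _; rewrite EFinM.
have i1 i j : P.-integrable setT
   (fun w => ((A i j)%:E * (EFin \o (pr i j)) w)%E).
  exact: (integrableZl measurableT _ (integrable_coord_mul i j)).
rewrite integral_sum //; last by move=> i; apply: integrable_sum => //.
rewrite /mxtrace -sumEFin; apply: eq_bigr => i _.
rewrite integral_sum // (bigD1 i) //= big1 ?adde0.
  by rewrite integralZl ?integral_coord_mul ?eqxx ?mule1 //; exact: integrable_coord_mul.
move=> j /negbTE ji.
rewrite integralZl ?integral_coord_mul 1?eq_sym ?ji ?mule0 //.
exact: integrable_coord_mul.
Qed.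

End OneSampleMoments.

Section HansonWright.
Context (R : realType) (d : measure_display) (T : measurableType d)
  (P : probability T R) (N n : nat) (Z : 'I_n -> T -> N.-tuple R) (K : R).
Hypothesis mZ : forall i, measurable_fun setT (Z i).
Hypothesis iZ : independent P Z.
Hypothesis iZc : forall i, independent P (fun j w => tnth (Z i w) j).
Hypothesis K0 : 0 < K.
Hypothesis Z1 : forall i j, (\int[P]_w (tnth (Z i w) j)%:E = 0)%E.
Hypothesis Z2 : forall i j, (\int[P]_w (tnth (Z i w) j ^+ 2)%:E = 1)%E.
Hypothesis ZK : forall i j, (\int[P]_w (expR (tnth (Z i w) j ^+ 2 / K ^+ 2))%:E <= 2%:E)%E.

(** The samples are themselves the independent coordinates of a tuple, so the
    product rule for coordinates applies to them. *)
Lemma integral_exp_sum_le (g : N.-tuple R -> R) (q : R) :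
  measurable_fun setT g ->
  (forall i, (\int[P]_w (expR (g (Z i w)))%:E <= (expR q)%:E)%E) ->
  (\int[P]_w (expR (\sum_i g (Z i w)))%:E <= (expR (n%:R * q))%:E)%E.
Proof.
move=> mg hg; pose Y w : n.-tuple (N.-tuple R) := [tuple Z i w | i < n].
have YE i w : tnth (Y w) i = Z i w by rewrite tnth_mktuple.
have mY : measurable_fun setT Y.
  apply/measurable_fun_tnthP => i; rewrite (_ : _ \o _ = Z i) //.
  by apply/funext => w /=; rewrite YE.
have iY : independent P (fun i w => tnth (Y w) i).
  rewrite (_ : (fun i w => tnth (Y w) i) = Z) //.
  by apply/funext => i; apply/funext => w; exact: YE.
have := integral_prod_le mY iY (g := fun i u => expR (g u)) (c := fun=> expR q).
rewrite -expR_sum sumr_const card_ord mulr_natl => h.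
rewrite (eq_integral (fun w => (\prod_i expR (g (tnth (Y w) i)))%:E)); last first.
  move=> w _; rewrite expR_sum; congr EFin; apply: eq_bigr => i _; by rewrite YE.
apply: h => [i|i u|i]; first 2 last.
- by under eq_integral do rewrite YE; exact: hg.
- exact: measurableT_comp.
- exact: expR_ge0.
Qed.

(** The range of the Chernoff parameter, relative to the norm of the matrix. The
    factor [64] collects the [8] of the chaos bound, a factor [2] for the norm of
    the off-diagonal part and the radius [4^-1] in [det_1B_ge]. *)
Definition hw_radius : R := (64 * lin_var K)^-1.
Definition hw_var : R := (8 * lin_var K) ^+ 2 / 2 + sqr_var K.

Lemma lin_var_gt0 : 0 < lin_var K.
Proof. by apply: lt_le_trans (lin_var_ge K); rewrite exprn_gt0. Qed.

Lemma sqr_var_ge0 : 0 <= sqr_var K.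
Proof. by rewrite mulr_ge0 ?expR_ge0 // mulr_ge0 // exprn_even_ge0. Qed.

Lemma hw_radius_gt0 : 0 < hw_radius.
Proof. by rewrite invr_gt0 mulr_gt0 // lin_var_gt0. Qed.

Lemma hw_var_gt0 : 0 < hw_var.
Proof.
by rewrite ltr_pwDl ?sqr_var_ge0 // divr_gt0 // exprn_gt0 // mulr_gt0 // lin_var_gt0.
Qed.

Definition qdev (A : 'M[R]_N) (w : T) : R := \sum_i (qform A (Z i w) - \tr A).

Lemma measurable_qdev A : measurable_fun setT (qdev A).
Proof.
apply: measurable_sum => i; apply: measurable_funB => //.
exact: measurableT_comp (measurable_qform A) (mZ i).
Qed.

Definition offdiag (A : 'M[R]_N) : 'M[R]_N := \matrix_(i, j) if i == j then 0 else A i j.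

Lemma diag_entry_le (A : 'M[R]_N) b :
  (forall x : 'cV[R]_N, `|\tr (x^T *m A *m x)| <= b * \tr (x^T *m x)) ->
  forall i, `|A i i| <= b.
Proof.
move=> bA i; have := bA (delta_mx i 0).
rewrite trmx_delta -rowE -colE trace_mx11 !mxE.
suff -> : \tr (delta_mx 0 i *m delta_mx i 0 : 'M[R]_1) = 1 by rewrite mulr1.
by rewrite mul_delta_mx trace_mx11 mxE eqxx.
Qed.

Lemma qform_split (A : 'M[R]_N) z :
  qform A z - \tr A = qform (offdiag A) z + \sum_i A i i * (tnth z i ^+ 2 - 1).
Proof.
rewrite /qform /mxtrace -sumrB -big_split /=; apply: eq_bigr => i _.
rewrite (bigD1 i) //= [in RHS](bigD1 i) //= mxE eqxx mul0r add0r.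
rewrite (eq_bigr (fun j => offdiag A i j * (tnth z i * tnth z j))); first by ring.
by move=> j /negbTE ji; rewrite mxE eq_sym ji.
Qed.

(** Hanson-Wright inequality in the form of a Chernoff bound: [A] is split into
    its diagonal, for which independence of the coordinates suffices, and its
    off-diagonal part, which is the chaos handled by [mgf_offdiag_qform]. *)
Lemma hanson_wright (A : 'M[R]_N) (b F l u : R) : A^T = A ->
  (forall x : 'cV[R]_N, `|\tr (x^T *m A *m x)| <= b * \tr (x^T *m x)) ->
  frobenius A ^+ 2 <= F -> 0 <= l -> l * b <= hw_radius ->
  (P [set w | (2 * u <= qdev A w)%R] <=
   (2 * expR (n%:R * (hw_var * l ^+ 2 * F) - l * u))%:E)%E.
Proof.
move=> symA bA FA l0 lb.
have v0 := lin_var_gt0.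
have lb' : 64 * lin_var K * (l * b) <= 1.
  by rewrite -ler_pdivlMl ?mulr_gt0 // mulr1.
have dA := diag_entry_le bA.
have frobE : frobenius A ^+ 2 = frobenius (offdiag A) ^+ 2 + \sum_i A i i ^+ 2.
  rewrite !sqr_frobenius !trace_gramE -big_split /=; apply: eq_bigr => i _.
  rewrite (bigD1 i) //= [in RHS](bigD1 i) //= mxE eqxx expr0n add0r addrC; congr (_ + _).
  by apply: eq_bigr => j /negbTE ji; rewrite mxE eq_sym ji.
have off0 : 0 <= frobenius (offdiag A) ^+ 2 by exact: sqr_ge0.
have diag0 : 0 <= \sum_i A i i ^+ 2 by apply: sumr_ge0 => i _; exact: sqr_ge0.
have q1 : (8 * lin_var K) ^+ 2 / 2 <= hw_var by rewrite lerDl sqr_var_ge0.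
have q2 : sqr_var K <= hw_var by rewrite lerDr divr_ge0 ?sqr_ge0.
have off_quad (x : 'cV[R]_N) :
    `|\tr (x^T *m offdiag A *m x)| <= 2 * b * \tr (x^T *m x).
  have -> : \tr (x^T *m offdiag A *m x) = \tr (x^T *m A *m x) - \sum_i A i i * x i 0 ^+ 2.
    have -> : offdiag A = A - diag_mx (\row_i A i i).
      by apply/matrixP => i j; rewrite !mxE; case: eqP => [->|_]; rewrite ?subrr ?subr0.
    rewrite mulmxBr mulmxBl raddfB /=; congr (_ - _).
    rewrite trace_mx11 mxE; apply: eq_bigr => i _; rewrite mul_mx_diag !mxE; ring.
  apply: le_trans (ler_normB _ _) _.
  have h : `|\sum_i A i i * x i 0 ^+ 2| <= b * \tr (x^T *m x).
    apply: le_trans (ler_norm_sum _ _ _) _.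
    rewrite trace_gramE mulr_sumr; apply: ler_sum => i _.
    rewrite big_ord1 normrM [X in _ * X]ger0_norm ?sqr_ge0 //.
    by rewrite ler_wpM2r ?sqr_ge0.
  have := bA x; lra.
pose f1 w := \sum_i qform (offdiag A) (Z i w).
pose f2 w := \sum_i \sum_j A j j * (tnth (Z i w) j ^+ 2 - 1).
have mf1 : measurable_fun setT f1.
  apply: measurable_sum => i; exact: measurableT_comp (measurable_qform _) (mZ i).
have mf2 : measurable_fun setT f2.
  apply: measurable_sum => i; apply: measurable_sum => j; apply: measurable_funM => //.
  apply: measurable_funB => //; apply: measurable_funX.
  exact: (measurableT_comp (measurable_tnth j) (mZ i)).
have sub : [set w | 2 * u <= qdev A w] `<=` [set w | u <= f1 w] `|` [set w | u <= f2 w].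
  move=> w /=; have -> : qdev A w = f1 w + f2 w.
    by rewrite /qdev -big_split /=; apply: eq_bigr => i _; exact: qform_split.
  by move=> h; case: (lerP u (f1 w)) => h'; [left|right; lra].
have mset (f : T -> R) c : measurable_fun setT f -> measurable [set w | c <= f w].
  exact: measurable_superlevel.
apply: (@le_trans _ _ (P ([set w | u <= f1 w] `|` [set w | u <= f2 w]))).
  apply: le_measure => //; rewrite inE; last by apply: measurableU; exact: mset.
  by apply: mset; exact: measurable_qdev.
apply: le_trans (measureU2 _ _ _) _; [exact: mset|exact: mset|].
have l2F : 0 <= l ^+ 2 * F.
  by rewrite mulr_ge0 ?sqr_ge0 // (le_trans _ FA) // sqr_ge0.
have h1 : (P [set w | (u <= f1 w)%R] <= (expR (n%:R * (hw_var * l ^+ 2 * F) - l * u))%:E)%E.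
  apply: exp_markov => //.
  pose A1 := l *: offdiag A.
  have A1E w : l * f1 w = \sum_i qform A1 (Z i w).
    rewrite mulr_sumr; apply: eq_bigr => i _; rewrite mulr_sumr; apply: eq_bigr => j _.
    rewrite mulr_sumr; apply: eq_bigr => k _; rewrite !mxE; ring.
  under eq_integral do rewrite A1E.
  apply: integral_exp_sum_le; first exact: measurable_qform.
  move=> i; apply: le_trans (mgf_offdiag_qform (K := K) (mZ i) (iZc i) K0 (Z1 i) (Z2 i) (ZK i) _ _ _) _.
  - by apply/matrixP => j k; rewrite !mxE eq_sym; case: ifP => // _; rewrite -[in LHS]symA mxE.
  - by move=> j; rewrite !mxE eqxx mulr0.
  - move=> x; rewrite scalerA -scalemxAr -scalemxAl mxtraceZ normrM ger0_norm; last first.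
      by rewrite !mulr_ge0 // ltW.
    have := off_quad x; have := trace_gram_ge0 x.
    set q := \tr _; set r := `|_|; move=> q0 rq.
    have : 8 * lin_var K * l * r <= 8 * lin_var K * l * (2 * b * q).
      by rewrite ler_wpM2l // !mulr_ge0 // ltW.
    have : (64 * lin_var K * (l * b)) * q <= 1 * q by rewrite ler_wpM2r.
    lra.
  - rewrite lee_fin ler_expR frobeniusZ [(`|l| * _) ^+ 2]exprMn sqr_norm_real.
    have -> : (8 * lin_var K) ^+ 2 * (l ^+ 2 * frobenius (offdiag A) ^+ 2) / 2 =
      ((8 * lin_var K) ^+ 2 / 2) * (l ^+ 2 * frobenius (offdiag A) ^+ 2) by field.
    rewrite -[leRHS]mulrA; set o := frobenius _ ^+ 2.
    apply: (@le_trans _ _ (hw_var * (l ^+ 2 * o))).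
      by apply: ler_wpM2r => //; apply: mulr_ge0 => //; exact: sqr_ge0.
    apply: ler_wpM2l; first exact: ltW hw_var_gt0.
    by apply: ler_wpM2l; [exact: sqr_ge0|rewrite /o; lra].
have h2 : (P [set w | (u <= f2 w)%R] <= (expR (n%:R * (hw_var * l ^+ 2 * F) - l * u))%:E)%E.
  apply: exp_markov => //.
  pose g (z : N.-tuple R) := \sum_j (l * A j j) * (tnth z j ^+ 2 - 1).
  have gE w : l * f2 w = \sum_i g (Z i w).
    rewrite mulr_sumr; apply: eq_bigr => i _; rewrite mulr_sumr; apply: eq_bigr => j _; ring.
  under eq_integral do rewrite gE.
  apply: integral_exp_sum_le.
    apply: measurable_sum => j; apply: measurable_funM => //.
    by apply: measurable_funB => //; apply: measurable_funX; exact: measurable_tnth.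
  have aK j : 2 * `|l * A j j| * K ^+ 2 <= 1.
    rewrite normrM ger0_norm //.
    have h : l * `|A j j| <= l * b by rewrite ler_wpM2l.
    have k2 := lin_var_ge K.
    have lA : 0 <= l * `|A j j| by rewrite mulr_ge0.
    have : (l * `|A j j|) * K ^+ 2 <= (l * b) * lin_var K by apply: ler_pM => //; exact: sqr_ge0.
    have : 0 <= (l * b) * lin_var K by rewrite mulr_ge0 // ?(ltW v0) // (le_trans lA).
    lra.
  move=> i; have h := mgf_diag_qform (mZ i) (iZc i) K0 (Z2 i) (ZK i) aK.
  rewrite /g; apply: (le_trans h).
  rewrite lee_fin ler_expR -[leRHS]mulrA.
  rewrite (eq_bigr (fun j => l ^+ 2 * A j j ^+ 2)) => [|j _]; last by rewrite exprMn.
  rewrite -mulr_sumr; set o := \sum_i _.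
  apply: (@le_trans _ _ (hw_var * (l ^+ 2 * o))).
    by apply: ler_wpM2r => //; apply: mulr_ge0 => //; exact: sqr_ge0.
  apply: ler_wpM2l; first exact: ltW hw_var_gt0.
  by apply: ler_wpM2l; [exact: sqr_ge0|rewrite /o; lra].
apply: le_trans (leeD h1 h2) _.
by rewrite -EFinD lee_fin; lra.
Qed.

End HansonWright.

(** * Kronecker sums *)
Section MultiIndex.
Variables (L : nat) (d : 'I_L -> nat).
Notation p := (dimp d).
Implicit Types x y : mindex d.

Lemma mindex_of_inj : injective (@mindex_of L d).
Proof.
by move=> a b ab; apply: val_inj; rewrite -[LHS](mindex_ofE a) ab mindex_ofE.
Qed.

Lemma card_mindex : #|mindex d| = p.
Proof.
rewrite /mindex card_dep_ffun /dimp foldrE big_map enumT.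
by apply: eq_bigr => k _; rewrite card_ord.
Qed.

Lemma mindex_of_bij : bijective (@mindex_of L d).
Proof. by apply: inj_card_bij; [exact: mindex_of_inj|rewrite card_mindex card_ord]. Qed.

Lemma mindex_ex x : exists a, mindex_of a == x.
Proof. by have [g _ gK] := mindex_of_bij; exists (g x); rewrite gK. Qed.

(** The inverse of [mindex_of]; matrix entries are handled by multi-indices from
    now on. *)
Definition flat x : 'I_p := xchoose (mindex_ex x).

Lemma flatK : cancel flat (@mindex_of L d).
Proof. by move=> x; apply/eqP/(xchooseP (mindex_ex x)). Qed.

Lemma mindex_ofK : cancel (@mindex_of L d) flat.
Proof. by move=> a; apply: mindex_of_inj; rewrite flatK. Qed.

Lemma sum_mindex (R : nmodType) (F : mindex d -> R) :
  \sum_(a < p) F (mindex_of a) = \sum_x F x.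
Proof. by rewrite [RHS](reindex _ (onW_bij _ mindex_of_bij)). Qed.

Lemma sum_flat (R : nmodType) (F : 'I_p -> R) : \sum_a F a = \sum_x F (flat x).
Proof. by rewrite -sum_mindex; apply: eq_bigr => a _; rewrite mindex_ofK. Qed.

Variable k : 'I_L.
Implicit Types (i j : 'I_(d k)).

Lemma upd_same x j : mindex_upd x j k = j.
Proof. by rewrite ffunE eqtype.dfwith_in. Qed.

Lemma upd_other x j l : l != k -> mindex_upd x j l = x l.
Proof. by move=> lk; rewrite ffunE eqtype.dfwith_out // eq_sym. Qed.

Lemma upd_upd x i j : mindex_upd (mindex_upd x i) j = mindex_upd x j.
Proof.
apply/ffunP => l; have [->|lk] := eqVneq l k; first by rewrite !upd_same.
by rewrite !upd_other.
Qed.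

Lemma upd_id x : mindex_upd x (x k) = x.
Proof.
apply/ffunP => l; have [->|lk] := eqVneq l k; first by rewrite upd_same.
by rewrite upd_other.
Qed.

(** Exchanging the value of the coordinate [k] with a free index is an involution
    of the pairs of a multi-index and a value. *)
Lemma sum_upd_swap (R : nmodType) (G : mindex d -> mindex d -> R) :
  \sum_x \sum_(j < d k) G x (mindex_upd x j) =
  \sum_x \sum_(j < d k) G (mindex_upd x j) x.
Proof.
rewrite !pair_big /=.
pose h (u : mindex d * 'I_(d k)) := (mindex_upd u.1 u.2, u.1 k).
have hK : involutive h.
  by move=> [x j]; rewrite /h /= upd_upd upd_id upd_same.
rewrite (reindex_inj (inv_inj hK)) /=; apply: eq_bigr => -[x j] _ /=.
by rewrite upd_upd upd_id.
Qed.

(** The multi-indices that agree with [x] outside [k] are its updates at [k]. *)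
Lemma sum_fiber (R : nmodType) (G : mindex d -> R) x :
  \sum_(y : mindex d | y == mindex_upd x (y k)) G y = \sum_(j < d k) G (mindex_upd x j).
Proof.
rewrite (reindex_onto (fun j => mindex_upd x j) (fun y : mindex d => y k)); last first.
  by move=> y /eqP {2}->.
by apply: eq_bigl => j; rewrite upd_same !eqxx.
Qed.

(** A weight that ignores the coordinate [k] and a function of this coordinate
    alone are uncorrelated for the uniform measure on multi-indices. *)
Lemma sum_coord (R : pzRingType) (w : mindex d -> R) (f : 'I_(d k) -> R) :
  (forall x (j : 'I_(d k)), w (mindex_upd x j) = w x) ->
  (d k)%:R * (\sum_x w x * f (x k)) = (\sum_x w x) * \sum_j f j.
Proof.
move=> wk.
have := sum_upd_swap (fun x _ => w x * f (x k)).
under eq_bigr do rewrite sumr_const card_ord -mulr_natl.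
rewrite -mulr_sumr => ->; rewrite mulr_suml; apply: eq_bigr => x _.
by rewrite mulr_sumr; apply: eq_bigr => j _; rewrite wk upd_same.
Qed.

End MultiIndex.

Section Kronecker.
Variables (R : realType) (L : nat) (d : 'I_L -> nat).
Hypothesis d0 : forall k, (0 < d k)%N.
Notation p := (dimp d).
Notation m := (comp_dim d).
Implicit Types (x y : mindex d) (B : forall k, 'M[R]_(d k)).

Lemma dimp_gt0 : (0 < p)%N.
Proof. by rewrite /dimp prodn_gt0. Qed.

Lemma comp_dimE k : (m k * d k)%N = p.
Proof. by rewrite /comp_dim divnK // /dimp (bigD1 k) //= dvdn_mulr. Qed.

Lemma comp_dim_gt0 k : (0 < m k)%N.
Proof. by have := dimp_gt0; rewrite -(comp_dimE k) muln_gt0 => /andP[]. Qed.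

Lemma comp_dimR k : (m k)%:R = p%:R / (d k)%:R :> R.
Proof. by rewrite -(comp_dimE k) natrM mulfK // pnatr_eq0 -lt0n. Qed.

Lemma mmin_le k : (mmin d <= m k)%N.
Proof.
rewrite /mmin; elim: (index_enum _) (mem_index_enum k) => // i s IH.
rewrite inE big_cons => /predU1P[->|/IH]; first exact: geq_minl.
by move=> h; apply: leq_trans h; exact: geq_minr.
Qed.

Lemma mmin_gt0 : (0 < mmin d)%N.
Proof.
rewrite /mmin; elim: (index_enum _) => [|i s IH]; first by rewrite big_nil dimp_gt0.
by rewrite big_cons leq_min comp_dim_gt0.
Qed.

Lemma mmin_le_dimp : (mmin d <= p)%N.
Proof.
rewrite /mmin; elim: (index_enum _) => [|i s IH]; first by rewrite big_nil.
by rewrite big_cons; apply: leq_trans IH; exact: geq_minr.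
Qed.

Let dR k : (d k)%:R != 0 :> R.
Proof. by rewrite pnatr_eq0 -lt0n. Qed.

Lemma avg_coord k (w : mindex d -> R) (f : 'I_(d k) -> R) :
  (forall x j, w (mindex_upd (k := k) x j) = w x) ->
  \sum_(x : mindex d) w x * f (x k) = (\sum_x w x) * (\sum_j f j) / (d k)%:R.
Proof. by move=> wk; rewrite -(sum_coord _ wk) mulrC mulKf. Qed.

Lemma sum_coord1 k (f : 'I_(d k) -> R) : \sum_(x : mindex d) f (x k) = (m k)%:R * \sum_j f j.
Proof.
have := avg_coord f (w := fun=> 1) (fun _ _ => erefl).
under eq_bigr do rewrite mul1r; move=> ->.
by rewrite sumr_const card_mindex comp_dimR mulrAC.
Qed.

(** The entry at [(x, y)] of the Kronecker product of [C] in position [k] with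
    identity matrices in the other positions. *)
Definition kent k (C : 'M[R]_(d k)) x y : R :=
  if y == mindex_upd x (y k) then C (x k) (y k) else 0.

Lemma kron_sumE B a b :
  kron_sum B a b = \sum_k kent (B k) (mindex_of a) (mindex_of b).
Proof.
rewrite /kron_sum summxE; apply: eq_bigr => k _; rewrite mxE (bigD1 k) //= eqtype.dfwith_in.
set x := mindex_of a; set y := mindex_of b; rewrite /kent.
case: eqP => [yE|ny].
  rewrite big1 ?mulr1 // => l lk; rewrite eqtype.dfwith_out ?mxE 1?eq_sym //.
  have := congr1 (fun z : mindex d => z l) yE.
  by rewrite /= upd_other // => ->; rewrite eqxx.
apply/eqP; rewrite mulf_eq0; apply/orP; right.
have : ~~ [forall l, (l != k) ==> (x l == y l)].
  apply/negP => /forallP h; apply: ny; apply/ffunP => l.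
  have [->|lk] := eqVneq l k; first by rewrite upd_same.
  by rewrite upd_other //; have := h l; rewrite lk => /eqP.
rewrite negb_forall => /existsP[l]; rewrite negb_imply => /andP[lk xy].
rewrite prodf_seq_eq0; apply/hasP; exists l; first by rewrite mem_index_enum.
by rewrite lk /= eqtype.dfwith_out 1?eq_sym // mxE (negbTE xy).
Qed.

Lemma kron_sum_flat B x y : kron_sum B (flat x) (flat y) = \sum_k kent (B k) x y.
Proof. by rewrite kron_sumE !flatK. Qed.

(** Partial trace over all modes but [k], not normalised. *)
Definition ptrace (S : 'M[R]_p) k : 'M[R]_(d k) :=
  \matrix_(i, j) \sum_(x : mindex d | x k == i) S (flat x) (flat (mindex_upd x j)).

Lemma sum_kent k (C : 'M[R]_(d k)) x (F : mindex d -> R) :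
  \sum_y kent C x y * F y = \sum_j C (x k) j * F (mindex_upd x j).
Proof.
transitivity (\sum_(y : mindex d | y == mindex_upd x (y k)) C (x k) (y k) * F y).
  rewrite [RHS]big_mkcond; apply: eq_bigr => y _; rewrite /kent.
  by case: ifP; rewrite ?mul0r.
by rewrite sum_fiber; apply: eq_bigr => j _; rewrite upd_same.
Qed.

(** The partial traces are the adjoint of [kron_sum]. *)
Lemma trace_kron_sum (S : 'M[R]_p) B :
  \tr (S^T *m kron_sum B) = \sum_k \tr ((ptrace S k)^T *m B k).
Proof.
rewrite trace_mulE sum_flat.
under eq_bigr do rewrite sum_flat.
transitivity (\sum_x \sum_y \sum_k kent (B k) x y * S (flat x) (flat y)).
  apply: eq_bigr => x _; apply: eq_bigr => y _.
  by rewrite kron_sum_flat mulrC mulr_suml.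
transitivity (\sum_k \sum_(x : mindex d) \sum_(j < d k)
    B k (x k) j * S (flat x) (flat (mindex_upd x j))).
  rewrite [RHS]exchange_big; apply: eq_bigr => x _.
  by rewrite exchange_big; apply: eq_bigr => k _; exact: sum_kent.
apply: eq_bigr => k _; rewrite trace_mulE.
rewrite (partition_big (fun x : mindex d => x k) xpredT) //=; apply: eq_bigr => i _.
rewrite exchange_big; apply: eq_bigr => j _; rewrite mxE mulr_suml.
by apply: eq_bigr => x /eqP ->; rewrite mulrC.
Qed.

Definition mean_diag B k : R := \tr (B k) / (d k)%:R.
(** The coefficient of the identity in the orthogonal decomposition of a
    Kronecker sum into a scalar matrix and traceless components. *)
Definition mean_level B : R := \sum_k mean_diag B k.
Definition centred B k : 'M[R]_(d k) := B k - (mean_diag B k)%:M.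

Lemma trace_centred B k : \tr (centred B k) = 0.
Proof.
rewrite /centred raddfB /= mxtrace_scalar /mean_diag -[X in _ - X]mulr_natr mulfVK ?subrr //.
Qed.

(** The component of another mode survives the partial trace only through its
    trace, hence the centring. *)
Lemma ptrace_kron_sum B k :
  ptrace (kron_sum B) k = (m k)%:R *: (centred B k + (mean_level B)%:M).
Proof.
apply/matrixP => i j; rewrite !mxE.
under eq_bigr do rewrite kron_sum_flat.
rewrite exchange_big (bigD1 k) //=.
have kk : \sum_(x : mindex d | x k == i) kent (B k) x (mindex_upd x j) = (m k)%:R * B k i j.
  rewrite big_mkcond /=.
  under eq_bigr => x _ do rewrite /kent upd_same eqxx.
  rewrite (sum_coord1 (fun i' => if i' == i then B k i' j else 0)).
  by rewrite -big_mkcond big_pred1_eq.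
have kl l : l != k -> \sum_(x : mindex d | x k == i) kent (B l) x (mindex_upd x j) =
    (i == j)%:R * ((m k)%:R * mean_diag B l).
  move=> lk; have kl : k != l by rewrite eq_sym.
  transitivity (\sum_(x : mindex d | x k == i) (i == j)%:R * B l (x l) (x l)).
    apply: eq_bigr => x /eqP xk; rewrite /kent upd_other // upd_id.
    have -> : (mindex_upd x j == x) = (i == j).
      apply/eqP/eqP => [h|<-]; first by rewrite -xk -[in LHS]h upd_same.
      by rewrite -xk upd_id.
    by case: eqP; rewrite ?mul1r ?mul0r.
  rewrite -mulr_sumr; congr (_ * _).
  transitivity (\sum_(x : mindex d) (x k == i)%:R * B l (x l) (x l)).
    by rewrite big_mkcond; apply: eq_bigr => x _; case: ifP; rewrite ?mul1r ?mul0r.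
  rewrite (avg_coord (fun i => B l i i) (w := fun x : mindex d => (x k == i)%:R)); last first.
    by move=> x j'; rewrite upd_other.
  rewrite (sum_coord1 (fun i' => (i' == i)%:R)) -[LHS]mulrA; congr (_ * _).
    by rewrite (bigD1 i) //= eqxx big1 ?addr0 ?mulr1 // => i' /negbTE ->.
rewrite kk (eq_bigr _ kl) -mulr_sumr -mulr_sumr /mean_level [in RHS](bigD1 k) //=.
case: eqP => _; rewrite ?mulr1n ?mulr0n; ring.
Qed.

(** Pythagoras for the decomposition into the identity and the traceless
    components, obtained by applying the adjoint twice. *)
Lemma frobenius_kron_sum B :
  frobenius (kron_sum B) ^+ 2 =
  p%:R * mean_level B ^+ 2 + \sum_k (m k)%:R * frobenius (centred B k) ^+ 2.
Proof.
rewrite sqr_frobenius trace_kron_sum.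
under eq_bigr do rewrite ptrace_kron_sum.
have E k : \tr (((m k)%:R *: (centred B k + (mean_level B)%:M))^T *m B k) =
    (m k)%:R * frobenius (centred B k) ^+ 2 + p%:R * mean_level B * mean_diag B k.
  have -> : ((m k)%:R *: (centred B k + (mean_level B)%:M))^T =
      (m k)%:R *: ((centred B k)^T + (mean_level B)%:M).
    by apply/matrixP => i j; rewrite !mxE eq_sym.
  rewrite -scalemxAl mxtraceZ mulmxDl mxtraceD mul_scalar_mx mxtraceZ.
  have -> : \tr ((centred B k)^T *m B k) = frobenius (centred B k) ^+ 2.
    rewrite sqr_frobenius [X in _ = \tr (_ *m X)]/centred mulmxBr [RHS]raddfB /=.
    by rewrite mul_mx_scalar mxtraceZ mxtrace_tr trace_centred mulr0 subr0.
  rewrite mulrDr; congr (_ + _).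
  by rewrite comp_dimR /mean_diag; ring.
under eq_bigr do rewrite E.
by rewrite big_split /= addrC -mulr_sumr -/(mean_level B) -mulrA -expr2.
Qed.

End Kronecker.

Section KroneckerNorms.
Variables (R : realType) (L : nat) (d : 'I_L -> nat).
Hypothesis d0 : forall k, (0 < d k)%N.
Notation p := (dimp d).
Notation m := (comp_dim d).
Implicit Types (x y : mindex d) (B : forall k, 'M[R]_(d k)).

Let dR k : (d k)%:R != 0 :> R.
Proof. by rewrite pnatr_eq0 -lt0n. Qed.

Let mR k : 0 < (m k)%:R :> R.
Proof. by rewrite ltr0n comp_dim_gt0. Qed.

Let pR : 0 < p%:R :> R.
Proof. by rewrite ltr0n dimp_gt0. Qed.

Definition kronmx k (C : 'M[R]_(d k)) : 'M[R]_p :=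
  \matrix_(a, b) kent C (mindex_of a) (mindex_of b).

Lemma kron_sum_centred B :
  kron_sum B = (mean_level B)%:M + \sum_k kronmx (centred B k).
Proof.
apply/matrixP => a b; rewrite kron_sumE !mxE summxE /mean_level.
have -> : (\sum_k mean_diag B k) *+ (a == b) = \sum_k (mean_diag B k *+ (a == b)) :> R.
  by rewrite sumrMnl.
rewrite -big_split /=; apply: eq_bigr => k _; rewrite mxE /kent /centred !mxE.
rewrite -(inj_eq (@mindex_of_inj _ d)); set x := mindex_of a; set y := mindex_of b.
case: ifPn => [/eqP yE|ny].
  have -> : (x == y) = (x k == y k).
    by apply/eqP/eqP => [->//|xy]; rewrite yE -xy upd_id.
  by rewrite addrC subrK.
suff /negbTE -> : x != y by rewrite add0r.
by apply: contra ny => /eqP ->; rewrite upd_id.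
Qed.

(** On each fibre of mode [k] the matrix acts as [C]; the Frobenius norm of [C]
    serves as a cheap bound for its operator norm. *)
Lemma opnorm_kronmx k (C : 'M[R]_(d k)) : opnorm (kronmx C) <= frobenius C.
Proof.
apply: opnorm_le => [|v]; first exact: frobenius_ge0.
apply: frobenius_le; first exact: frobenius_ge0.
rewrite !trace_gramE [in leRHS]sum_flat sum_flat.
under eq_bigr do rewrite big_ord1.
under [in leRHS]eq_bigr do rewrite big_ord1.
pose V (x : mindex d) := \sum_(j < d k) v (flat (mindex_upd x j)) 0 ^+ 2.
have VE : \sum_x V x = (d k)%:R * \sum_x v (flat x) 0 ^+ 2.
  rewrite /V (sum_upd_swap k (fun _ y => v (flat y) 0 ^+ 2)) mulr_sumr.
  by apply: eq_bigr => x _; rewrite sumr_const card_ord mulr_natl.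
apply: (@le_trans _ _ (\sum_(x : mindex d) V x * (\sum_j C (x k) j ^+ 2))).
  apply: ler_sum => x _; rewrite mxE sum_flat.
  under eq_bigr do rewrite mxE !flatK.
  rewrite sum_kent mulrC.
  exact: (cauchy_schwarz (C (x k)) (fun j => v (flat (mindex_upd x j)) 0)).
rewrite (avg_coord d0 (fun i => \sum_j C i j ^+ 2)); last first.
  by move=> x j; apply: eq_bigr => j' _; rewrite upd_upd.
rewrite VE sqr_frobenius trace_gramE le_eqVlt; apply/orP; left; apply/eqP.
by field.
Qed.

Lemma opnorm_scalar n (a : R) : opnorm (a%:M : 'M[R]_n) <= `|a|.
Proof.
by apply: opnorm_le => // v; rewrite mul_scalar_mx frobeniusZ.
Qed.

(** The component of a Kronecker sum along the identity and its traceless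
    components are orthogonal, and each has an operator norm much smaller than
    its Frobenius norm, by the factors [sqrt p] and [sqrt (m k)]. *)
Lemma opnorm_kron_sum B :
  opnorm (kron_sum B) <=
  Num.sqrt (L.+1%:R / (mmin d)%:R) * frobenius (kron_sum B).
Proof.
have [L0|L0] := posnP L.
  have -> : kron_sum B = 0.
    rewrite /kron_sum big1 // => k _; have : (nat_of_ord k < 0)%N by rewrite -L0; exact: ltn_ord.
    by [].
  apply: opnorm_le => [|v]; first by rewrite mulr_ge0 ?sqrtr_ge0 ?frobenius_ge0.
  by rewrite mul0mx {1}/frobenius trmx0 mul0mx mxtrace0 sqrtr0 !mulr_ge0 ?sqrtr_ge0 ?frobenius_ge0.
set t := mean_level B; set c := fun k => frobenius (centred B k).
have h1 : opnorm (kron_sum B) <= `|t| + \sum_k c k.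
  rewrite kron_sum_centred; apply: le_trans (opnorm_triangle _ _) _.
  apply: lerD; first exact: opnorm_scalar.
  apply: le_trans (opnorm_sum _ _) _; apply: ler_sum => k _; exact: opnorm_kronmx.
apply: (le_trans h1).
have m0 : 0 < (mmin d)%:R :> R by rewrite ltr0n mmin_gt0.
have lR : 0 < L%:R :> R by rewrite ltr0n.
rewrite -ler_sqr ?nnegrE; last 2 first.
- by rewrite addr_ge0 // sumr_ge0 // => k _; exact: frobenius_ge0.
- by rewrite mulr_ge0 ?sqrtr_ge0 ?frobenius_ge0.
rewrite exprMn sqr_sqrtr; last by rewrite divr_ge0 // ltW.
rewrite frobenius_kron_sum // -/t.
have h2 : (\sum_k c k) ^+ 2 <= L%:R * \sum_k c k ^+ 2.
  have := cauchy_schwarz (fun _ : 'I_L => 1) c.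
  under eq_bigr do rewrite mul1r.
  by under [X in _ <= X * _]eq_bigr do rewrite expr1n; rewrite sumr_const card_ord.
have h3 : (mmin d)%:R * (t ^+ 2 + \sum_k c k ^+ 2) <=
    p%:R * t ^+ 2 + \sum_k (m k)%:R * c k ^+ 2.
  rewrite mulrDr; apply: lerD.
    by rewrite ler_wpM2r ?sqr_ge0 // ler_nat mmin_le_dimp.
  rewrite mulr_sumr; apply: ler_sum => k _.
  by rewrite ler_wpM2r ?sqr_ge0 // ler_nat mmin_le.
set Q := \sum_k c k ^+ 2 in h2 h3; set s := \sum_k c k in h2 *.
apply: (@le_trans _ _ (L.+1%:R * (t ^+ 2 + Q))); last first.
  rewrite -mulrA ler_wpM2l // ler_pdivlMl //.
rewrite -natr1 -(ler_pM2l lR) -sqr_norm_real.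
have := sqr_ge0 (L%:R * `|t| - s).
have : (L%:R + 1) * s ^+ 2 <= (L%:R + 1) * (L%:R * Q) by rewrite ler_wpM2l.
set l := L%:R; set a := `|t|; nra.
Qed.

Lemma trace_ptrace (S : 'M[R]_p) k : \tr (ptrace S k) = \tr S.
Proof.
rewrite /mxtrace sum_flat [RHS](partition_big (fun x : mindex d => x k) xpredT) //=.
apply: eq_bigr => i _; rewrite mxE; apply: eq_bigr => x /eqP <-.
by rewrite upd_id.
Qed.

Lemma trace_kron_sum_level B (k : 'I_L) : \tr (kron_sum B) = p%:R * mean_level B.
Proof.
rewrite -(trace_ptrace _ k) ptrace_kron_sum // mxtraceZ mxtraceD trace_centred //.
rewrite mxtrace_scalar add0r comp_dimR // -mulr_natr; field; exact: dR.
Qed.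

Lemma level_recentred (C : forall k, 'M[R]_(d k)) (t : R) : (0 < L)%N ->
  (forall k, \tr (C k) = 0) ->
  let B k := C k + (t / L%:R)%:M in
  mean_level B = t /\ forall k, centred B k = C k.
Proof.
move=> L0 C0 B; have lR : L%:R != 0 :> R by rewrite pnatr_eq0 -lt0n.
have mB k : mean_diag B k = t / L%:R.
  by rewrite /mean_diag mxtraceD C0 add0r mxtrace_scalar -[_ *+ d k]mulr_natr mulfK.
split=> [|k]; last by rewrite /centred mB addrK.
rewrite /mean_level (eq_bigr _ (fun k _ => mB k)) sumr_const card_ord -[LHS]mulr_natr.
by rewrite divfK.
Qed.

(** A linear choice of factors for a Kronecker sum, namely the one with equal mean
    diagonals. Being continuous, it shows that the Kronecker sums form a closed
    set, on which minimisers are sought. *)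
Definition factors (M : 'M[R]_p) k : 'M[R]_(d k) :=
  (m k)%:R^-1 *: ptrace M k - (\tr M / p%:R)%:M + (\tr M / p%:R / L%:R)%:M.

Lemma factorsK B : (0 < L)%N -> kron_sum (factors (kron_sum B)) = kron_sum B.
Proof.
move=> L0; pose k0 := Ordinal L0.
have fE k : factors (kron_sum B) k = centred B k + (mean_level B / L%:R)%:M.
  rewrite /factors (trace_kron_sum_level B k0) [p%:R * _]mulrC mulfK ?gt_eqF //.
  rewrite ptrace_kron_sum // scalerA mulVf ?gt_eqF // scale1r.
  by rewrite addrK.
have [h1 h2] := level_recentred (mean_level B) L0 (trace_centred d0 B).
have -> : factors (kron_sum B) = (fun k => centred B k + (mean_level B / L%:R)%:M).
  by apply: functional_extensionality_dep => k; exact: fE.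
rewrite [LHS]kron_sum_centred h1 [RHS]kron_sum_centred; congr (_ + _).
by apply: eq_bigr => k _; rewrite h2.
Qed.

(** The off-diagonal entries of a factor all appear in the Kronecker sum, [m k]
    times each; this makes the penalty a function of the sum. *)
Lemma l1_off_kron_sum B k :
  (m k)%:R * l1_off (B k) =
  \sum_(x : mindex d) \sum_(j < d k | j != x k)
    `|kron_sum B (flat x) (flat (mindex_upd x j))|.
Proof.
rewrite /l1_off -(sum_coord1 d0 (fun i => \sum_(j | j != i) `|B k i j|)).
apply: eq_bigr => x _; apply: eq_bigr => j jx; congr `|_|.
rewrite kron_sum_flat (bigD1 k) //= /kent upd_same eqxx big1 ?addr0 // => l lk.
rewrite upd_other // upd_id; case: eqP => // h.
by move: jx; rewrite -[j](upd_same x) h eqxx.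
Qed.

(** Index set of a Parseval frame for the diagonal Kronecker sums, with one vector
    for the identity and one for each diagonal entry of each factor. The frame is
    redundant, because the diagonals of the factors are not determined by the
    sum, but it keeps the coordinates independent of any choice of basis. *)
Definition diag_index := option {k : 'I_L & 'I_(d k)}.

Lemma sum_diag_index (F : diag_index -> R) :
  \sum_o F o = F None + \sum_k \sum_(i < d k) F (Some (Tagged (fun k => 'I_(d k)) i)).
Proof.
rewrite (bigD1 None) //=; congr (_ + _).
rewrite (sig_big_dep _ _ (fun (k : 'I_L) (i : 'I_(d k)) => F (Some (Tagged (fun k => 'I_(d k)) i)))) /=.
rewrite (reindex_omap Some id) /=; last by case.
apply: eq_big => [[k i]|[k i] _] //=; by rewrite ?eqxx.
Qed.

Lemma card_diag_index : #|{: diag_index}| = (\sum_k d k).+1.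
Proof.
rewrite card_option card_tagged sumnE big_map big_enum /=.
by congr _.+1; apply: eq_bigr => k _; rewrite card_ord.
Qed.

Definition diag_coord (h : diag_index -> R) k (i : 'I_(d k)) : R :=
  h (Some (Tagged (fun k => 'I_(d k)) i)).

(** The frame vectors combined with coefficients [h]: divided by [sqrt (m k)] they
    have norm at most one, and centring makes them orthogonal to the identity. *)
Definition diag_factors (h : diag_index -> R) k : 'M[R]_(d k) :=
  diag_mx (\row_i ((diag_coord h i - (\sum_(j < d k) diag_coord h j) / (d k)%:R) /
                   Num.sqrt (m k)%:R)) +
  (h None / Num.sqrt p%:R / L%:R)%:M.

Definition diag_gradient (S : 'M[R]_p) (o : diag_index) : R :=
  if o is Some (existT k i) then
    (ptrace S k i i - \tr S / (d k)%:R) / Num.sqrt (m k)%:R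
  else \tr S / Num.sqrt p%:R.

(** Centring the coordinates of one mode is a projection, which does not increase
    the norm. *)
Lemma frobenius_diag_factors h : (0 < L)%N ->
  frobenius (kron_sum (diag_factors h)) ^+ 2 <= \sum_o h o ^+ 2.
Proof.
move=> L0.
pose c k (i : 'I_(d k)) := diag_coord h i - (\sum_(j < d k) diag_coord h j) / (d k)%:R.
have c0 k : \sum_i c k i = 0.
  by rewrite sumrB sumr_const card_ord -[_ *+ d k]mulr_natr divfK ?subrr.
pose C k : 'M[R]_(d k) := diag_mx (\row_i (c k i / Num.sqrt (m k)%:R)).
have trC k : \tr (C k) = 0.
  rewrite mxtrace_diag (eq_bigr (fun i => c k i / Num.sqrt (m k)%:R)).
    by rewrite -mulr_suml c0 mul0r.
  by move=> i _; rewrite mxE.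
have [h1 h2] := level_recentred (h None / Num.sqrt p%:R) L0 trC.
rewrite frobenius_kron_sum // h1 sum_diag_index; apply: lerD.
  by rewrite expr_div_n sqr_sqrtr ?(ltW pR) // mulrC divfK ?(gt_eqF pR).
apply: ler_sum => k _; rewrite h2 sqr_frobenius tr_diag_mx mul_diag_mx.
have -> : \tr (\matrix_(i, j) ((\row_i0 (c k i0 / Num.sqrt (m k)%:R)) 0 i * C k i j)) =
   (m k)%:R^-1 * \sum_i c k i ^+ 2.
  rewrite mulr_sumr; apply: eq_bigr => i _; rewrite !mxE eqxx mulr1n.
  rewrite -[_ * _]expr2 expr_div_n sqr_sqrtr ?(ltW (mR k)) //; exact: mulrC.
rewrite mulVKf ?(gt_eqF (mR k)) //.
rewrite (eq_bigr (fun i => diag_coord h i ^+ 2 - 2 * ((\sum_(j < d k) diag_coord h j) / (d k)%:R) * diag_coord h i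
   + ((\sum_(j < d k) diag_coord h j) / (d k)%:R) ^+ 2)); last by move=> i _; rewrite /c; ring.
rewrite !big_split /= sumrN -mulr_sumr sumr_const card_ord.
set s := \sum_(j < d k) diag_coord h j.
have -> : 2 * (s / (d k)%:R) * s = 2 * (s ^+ 2 / (d k)%:R) by ring.
have -> : (s / (d k)%:R) ^+ 2 *+ d k = s ^+ 2 / (d k)%:R.
  by rewrite -[LHS]mulr_natr; field; exact: dR.
have : 0 <= s ^+ 2 / (d k)%:R by rewrite divr_ge0 ?sqr_ge0.
lra.
Qed.

Lemma trace_diag_factors (S : 'M[R]_p) h : (0 < L)%N ->
  \tr (S^T *m kron_sum (diag_factors h)) = \sum_o h o * diag_gradient S o.
Proof.
move=> L0; have lR : L%:R != 0 :> R by rewrite pnatr_eq0 -lt0n.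
rewrite trace_kron_sum // sum_diag_index /=.
have E k : \tr ((ptrace S k)^T *m diag_factors h k) =
   h None * (\tr S / Num.sqrt p%:R) / L%:R + \sum_(i < d k) diag_coord h i *
     ((ptrace S k i i - \tr S / (d k)%:R) / Num.sqrt (m k)%:R).
  rewrite mulmxDr mxtraceD mul_mx_scalar mxtraceZ mxtrace_tr trace_ptrace addrC.
  congr (_ + _); first by ring.
  rewrite trace_mulE -[\tr S](trace_ptrace _ k).
  rewrite (eq_bigr (fun i => ptrace S k i i * ((diag_coord h i - (\sum_(j < d k) diag_coord h j) / (d k)%:R) /
                   Num.sqrt (m k)%:R))); last first.
    have vE (v : 'rV[R]_(d k)) (i j : 'I_(d k)) : diag_mx v i j = v 0 i *+ (i == j).
      by rewrite mxE.
    move=> i _; rewrite (bigD1 i) //= vE eqxx mulr1n [X in _ + X]big1 ?addr0.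
      by congr (_ * _); rewrite mxE.
    by move=> j ji; rewrite vE eq_sym (negbTE ji) mulr0n mulr0.
  set sh := \sum_(j < d k) diag_coord h j; rewrite /mxtrace.
  set sS := \sum_i ptrace S k i i; set q := Num.sqrt _.
  transitivity ((\sum_i ptrace S k i i * diag_coord h i - sS * (sh / (d k)%:R)) / q).
    rewrite mulrBl /sS mulr_suml !mulr_suml -sumrB; apply: eq_bigr => i _; ring.
  transitivity ((\sum_i ptrace S k i i * diag_coord h i - (sS / (d k)%:R) * sh) / q).
    by congr (_ / _); ring.
  rewrite mulrBl /sh mulr_sumr !mulr_suml -sumrB; apply: eq_bigr => i _; ring.
rewrite (eq_bigr _ (fun k _ => E k)) big_split /= sumr_const card_ord -[X in X + _ = _]mulr_natr divfK //.
Qed.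

(** The frame coordinates of a Kronecker sum are bounded by its norm, so that by
    Cauchy-Schwarz the diagonal contribution is at most the norm of the gradient
    times the Frobenius norm; the off-diagonal entries are kept apart because
    there the penalty acts entry by entry. *)
Lemma trace_kron_sum_split (S : 'M[R]_p) B : (0 < L)%N ->
  exists h, \sum_o h o ^+ 2 <= frobenius (kron_sum B) ^+ 2 /\
  \tr (S^T *m kron_sum B) = \sum_o h o * diag_gradient S o +
    \sum_k \sum_i \sum_(j | j != i) ptrace S k i j * B k i j.
Proof.
move=> L0; have lR : L%:R != 0 :> R by rewrite pnatr_eq0 -lt0n.
pose h (o : diag_index) := if o is Some (existT k i)
  then Num.sqrt (m k)%:R * centred B k i i else Num.sqrt p%:R * mean_level B.
exists h; split.
  rewrite sum_diag_index /= frobenius_kron_sum //; apply: lerD.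
    by rewrite exprMn sqr_sqrtr.
  apply: ler_sum => k _; rewrite sqr_frobenius trace_gramE mulr_sumr.
  apply: ler_sum => i _; rewrite exprMn sqr_sqrtr // ler_wpM2l //.
  rewrite (bigD1 i) //= lerDl; apply: sumr_ge0 => j _; exact: sqr_ge0.
rewrite trace_kron_sum // sum_diag_index /=.
have sp : Num.sqrt p%:R != 0 :> R by rewrite gt_eqF // sqrtr_gt0.
have sm k : Num.sqrt (m k)%:R != 0 :> R by rewrite gt_eqF // sqrtr_gt0.
have E k : \tr ((ptrace S k)^T *m B k) = \sum_i \sum_(j | j != i) ptrace S k i j * B k i j +
   (\tr S * mean_diag B k + \sum_i Num.sqrt (m k)%:R * centred B k i i *
     ((ptrace S k i i - \tr S / (d k)%:R) / Num.sqrt (m k)%:R)).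
  rewrite trace_mulE.
  rewrite (eq_bigr (fun i => \sum_(j | j != i) ptrace S k i j * B k i j + ptrace S k i i * B k i i)).
    rewrite big_split /=; congr (_ + _).
    rewrite (eq_bigr (fun i => ptrace S k i i * mean_diag B k +
        ptrace S k i i * centred B k i i)); last first.
      by move=> i _; rewrite !mxE eqxx mulr1n; ring.
    rewrite big_split /= -mulr_suml -/(mxtrace (ptrace S k)) trace_ptrace; congr (_ + _).
    transitivity (\sum_i (ptrace S k i i * centred B k i i - \tr S / (d k)%:R * centred B k i i)).
      by rewrite sumrB -mulr_sumr -/(mxtrace (centred B k)) trace_centred // mulr0 subr0.
    by apply: eq_bigr => i _; field; rewrite dR sm.
  by move=> i _; rewrite (bigD1 i) //= addrC.
rewrite (eq_bigr _ (fun k _ => E k)) big_split /= addrC; congr (_ + _).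
rewrite big_split /= -mulr_sumr -/(mean_level B); congr (_ + _).
by field.
Qed.

End KroneckerNorms.

(** * Strong convexity of the log-determinant *)
Section Congruence.
Variables (R : realType) (n : nat).
Implicit Types A K M : 'M[R]_n.

Lemma trace_quad_cols q (A : 'M[R]_n) (M : 'M[R]_(n, q)) :
  \tr (M^T *m A *m M) = \sum_j \tr ((col j M)^T *m A *m col j M).
Proof.
apply: eq_bigr => j _; rewrite trace_mx11 !mxE; apply: eq_bigr => i _.
rewrite !mxE; congr (_ * _); apply: eq_bigr => l _; by rewrite !mxE.
Qed.

Lemma trace_quad_le q (A : 'M[R]_n) (M : 'M[R]_(n, q)) :
  \tr (M^T *m A *m M) <= opnorm A * \tr (M^T *m M).
Proof.
rewrite -[in leRHS](mulmx1 M^T) !trace_quad_cols mulr_sumr; apply: ler_sum => j _.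
rewrite mulmx1; apply: le_trans (quad_form_le _ _); exact: ler_norm.
Qed.

Lemma trace_gram_tr m (M : 'M[R]_(m, n)) : \tr (M *m M^T) = \tr (M^T *m M).
Proof. exact: mxtrace_mulC. Qed.

(** A symmetric square root [K] of [G] acts like a matrix of norm
    [sqrt (opnorm G)]; these bounds avoid computing the norm of [K]. *)
Lemma frobenius_congr K G M : K^T = K -> K *m K = G ->
  frobenius (K *m M *m K) <= opnorm G * frobenius M.
Proof.
move=> symK KG; apply: frobenius_le; first exact: opnorm_ge0.
have -> : \tr ((K *m M *m K)^T *m (K *m M *m K)) = \tr ((M *m K)^T *m G *m (M *m K)).
  by rewrite -KG !trmx_mul symK !mulmxA.
apply: le_trans (trace_quad_le _ _) _.
rewrite expr2 -mulrA ler_wpM2l ?opnorm_ge0 //.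
have -> : \tr ((M *m K)^T *m (M *m K)) = \tr (M^T^T *m G *m M^T).
  by rewrite -trace_gram_tr trmx_mul symK trmxK -KG !mulmxA.
by apply: le_trans (trace_quad_le _ _) _; rewrite trmxK trace_gram_tr.
Qed.

Lemma quad_form_congr K G M (x : 'cV[R]_n) : K^T = K -> K *m K = G ->
  `|\tr (x^T *m (K *m M *m K) *m x)| <= opnorm G * opnorm M * \tr (x^T *m x).
Proof.
move=> symK KG.
have -> : \tr (x^T *m (K *m M *m K) *m x) = \tr ((K *m x)^T *m M *m (K *m x)).
  by rewrite trmx_mul symK !mulmxA.
apply: le_trans (quad_form_le _ _) _.
rewrite [opnorm G * _]mulrC -mulrA ler_wpM2l ?opnorm_ge0 //.
have -> : \tr ((K *m x)^T *m (K *m x)) = \tr (x^T *m G *m x).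
  by rewrite trmx_mul symK -KG !mulmxA.
exact: trace_quad_le.
Qed.

(** [logdet_1D_le] contains the positivity of the determinant; the parameter [t]
    only has to be small enough for [A - 1] to fit its hypothesis. *)
Lemma posdef_det_gt0 A : posdef A -> 0 < \det A.
Proof.
move=> Apd; have symA : A^T = A by case: Apd.
pose t := (2 * (opnorm (A - 1%:M) + 1))^-1.
have o0 : 0 <= opnorm (A - 1%:M) by exact: opnorm_ge0.
have t0 : 0 < t by rewrite invr_gt0 mulr_gt0 // ltr_wpDl.
have t1 : t <= 1 by rewrite invf_le1; lra.
have := @logdet_1D_le R n (A - 1%:M) t.
rewrite [1%:M + _]addrC subrK => h; apply: (h _ _ _ _).1.
- by rewrite linearB /= symA trmx1.
- by rewrite t0.
- by move=> x x0; exact: posdef_trace.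
- move=> x; have q := quad_form_le (A - 1%:M) x; have p := trace_gram_ge0 x.
  apply: (@le_trans _ _ (t * (opnorm (A - 1%:M) * \tr (x^T *m x)))).
    by rewrite ler_wpM2l // ltW.
  rewrite mulrA ler_wpM2r // /t invfM -mulrA ler_piMr ?invr_ge0 //.
  by rewrite ler_pdivrMl; lra.
Qed.

End Congruence.

Section LogDet.
Variables (R : realType) (n : nat) (Omega H : 'M[R]_n).
Hypothesis Opd : posdef Omega.
Hypothesis Hsqrt : is_sqrtmx (invmx Omega) H.
Local Notation Sigma := (invmx Omega).

Let symH : H^T = H. Proof. by case: Hsqrt => -[]. Qed.
Let HH : H *m H = Sigma. Proof. by case: Hsqrt. Qed.

Lemma sqrt_unit : H \in unitmx.
Proof.
have : H *m H \in unitmx by rewrite HH unitmx_inv posdef_unit.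
by rewrite unitmx_mul andbb.
Qed.

Let K := invmx H.

Let symK : K^T = K. Proof. by rewrite /K trmx_inv symH. Qed.
Let KK : K *m K = Omega.
Proof.
rewrite /K -[RHS]invmxK -HH.
apply: (can_inj (mulKmx sqrt_unit)); rewrite mulKVmx ?sqrt_unit //.
apply: (can_inj (mulKmx sqrt_unit)); rewrite mulmxV ?sqrt_unit //.
by rewrite mulmxA mulmxV // unitmx_mul sqrt_unit.
Qed.

Let HKmul M : K *m (H *m M *m H) *m K = M.
Proof. by rewrite !mulmxA mulVmx ?sqrt_unit // mul1mx mulmxK ?sqrt_unit. Qed.

Let HOH : H *m Omega *m H = 1%:M.
Proof. by rewrite -KK !mulmxA mulmxV ?sqrt_unit // mul1mx mulVmx ?sqrt_unit. Qed.

Lemma gram_le_quad (x : 'cV[R]_n) :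
  \tr (x^T *m x) <= opnorm Sigma * \tr (x^T *m Omega *m x).
Proof.
have -> : \tr (x^T *m x) = \tr ((K *m x)^T *m Sigma *m (K *m x)).
  rewrite trmx_mul symK -HH !mulmxA /K.
  by rewrite mulmxKV ?sqrt_unit // mulmxK ?sqrt_unit.
apply: le_trans (trace_quad_le _ _) _.
by rewrite trmx_mul symK -KK !mulmxA.
Qed.

(** Relative to [Omega] the perturbation has norm at most
    [opnorm Sigma * opnorm Delta]. *)
Lemma posdef_perturb (Delta : 'M[R]_n) : Delta^T = Delta ->
  opnorm Sigma * opnorm Delta < 1 -> posdef (Omega + Delta).
Proof.
move=> symD small; split; first by rewrite linearD /= symD; case: Opd => ->.
move=> x x0; rewrite -trace_mx11 mulmxDr mulmxDl mxtraceD.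
have h1 := gram_le_quad x; have h2 := quad_form_le Delta x.
have xp := trace_gram_gt0 x0.
have s0 : 0 < opnorm Sigma.
  rewrite lt_neqAle opnorm_ge0 andbT eq_sym; apply/eqP => s0.
  by move: h1; rewrite s0 mul0r; lra.
move: h2; rewrite ler_norml => /andP[h2 _].
rewrite -(pmulr_rgt0 _ s0) mulrDr.
have : opnorm Sigma * (- (opnorm Delta * \tr (x^T *m x))) <=
   opnorm Sigma * \tr (x^T *m Delta *m x) by rewrite ler_pM2l.
have : (opnorm Sigma * opnorm Delta) * \tr (x^T *m x) < 1 * \tr (x^T *m x).
  by rewrite ltr_pM2r.
lra.
Qed.

(** The Bregman divergence of [- ln det] at [Omega] is at least quadratic. After
    congruence by [H] it is [tr E - ln det (1 + E)]; the parameter [t] trades the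
    quadratic constant for a larger range of [E], as in [ln_1D_le]. *)
Lemma logdet_gap (Delta : 'M[R]_n) (t : R) : Delta^T = Delta ->
  posdef (Omega + Delta) -> 0 < t <= 1 ->
  t * (opnorm Sigma * opnorm Delta) <= 2^-1 ->
  t / 8 * frobenius Delta ^+ 2 <=
  opnorm Omega ^+ 2 *
    (\tr (Sigma^T *m Delta) - (ln (\det (Omega + Delta)) - ln (\det Omega))).
Proof.
move=> symD ODpd t01 small; have t0 : 0 <= t by case/andP: t01 => /ltW.
pose E := H *m Delta *m H.
have symE : E^T = E by rewrite /E !trmx_mul symH symD !mulmxA.
have E1 : 1%:M + E = H *m (Omega + Delta) *m H.
  by rewrite mulmxDr mulmxDl HOH.
have posE (x : 'cV[R]_n) : x != 0 -> 0 < \tr (x^T *m (1%:M + E) *m x).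
  move=> x0; rewrite E1.
  have -> : \tr (x^T *m (H *m (Omega + Delta) *m H) *m x) =
    \tr ((H *m x)^T *m (Omega + Delta) *m (H *m x)) by rewrite trmx_mul symH !mulmxA.
  apply: posdef_trace => //; apply: contra x0 => /eqP Hx0.
  by rewrite -[x](mulKmx sqrt_unit) Hx0 mulmx0.
have bndE (x : 'cV[R]_n) : t * `|\tr (x^T *m E *m x)| <= 2^-1 * \tr (x^T *m x).
  apply: (@le_trans _ _ (t * (opnorm Sigma * opnorm Delta * \tr (x^T *m x)))).
    by rewrite ler_wpM2l //; exact: quad_form_congr.
  by rewrite mulrA ler_wpM2r ?trace_gram_ge0.
have [_ lnE] := logdet_1D_le symE t01 posE bndE.
have dO := posdef_det_gt0 Opd; have dOD := posdef_det_gt0 ODpd.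
have detE : \det (1%:M + E) = \det (Omega + Delta) / \det Omega.
  rewrite E1 !det_mulmx mulrAC -det_mulmx HH det_inv mulrC //.
have lnE' : ln (\det (1%:M + E)) = ln (\det (Omega + Delta)) - ln (\det Omega).
  by rewrite detE ln_div ?posrE.
have trE : \tr E = \tr (Sigma^T *m Delta).
  rewrite /E mxtrace_mulC mulmxA HH trmx_inv.
  by case: Opd => ->.
have frobE : \tr (E *m E) = frobenius E ^+ 2 by rewrite sqr_frobenius symE.
have frobD : frobenius Delta <= opnorm Omega * frobenius E.
  by rewrite -{1}(HKmul Delta); exact: frobenius_congr.
have frobD2 : frobenius Delta ^+ 2 <= opnorm Omega ^+ 2 * frobenius E ^+ 2.
  by rewrite -exprMn ler_sqr ?nnegrE ?mulr_ge0 ?opnorm_ge0 ?frobenius_ge0.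
rewrite -lnE' -trE.
apply: (@le_trans _ _ (t / 8 * (opnorm Omega ^+ 2 * frobenius E ^+ 2))).
  by rewrite ler_wpM2l // divr_ge0.
rewrite mulrCA ler_wpM2l ?sqr_ge0 //; rewrite frobE in lnE; lra.
Qed.

End LogDet.

(** * Continuity and compactness *)
Section Continuity.
Import numFieldNormedType.Exports.
Context (R : realType) (X : topologicalType) (v : X).
Implicit Types f g : X -> R.

(** Continuity at a point of real functions on an arbitrary space: determinants,
    traces and norms are built from entries by the closure rules below. *)
Definition cont_at f : Prop := f x @[x --> v] --> f v.

Lemma cont_cst (c : R) : cont_at (fun=> c).
Proof. exact: cvg_cst. Qed.

Lemma contD f g : cont_at f -> cont_at g -> cont_at (fun x => f x + g x).
Proof. exact: cvgD. Qed.

Lemma contN f : cont_at f -> cont_at (fun x => - f x).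
Proof. exact: cvgN. Qed.

Lemma contM f g : cont_at f -> cont_at g -> cont_at (fun x => f x * g x).
Proof. exact: cvgM. Qed.

Lemma contX f n : cont_at f -> cont_at (fun x => f x ^+ n).
Proof.
move=> cf; elim: n => [|n IH]; first exact: cont_cst.
have -> : (fun x => f x ^+ n.+1) = (fun x => f x * f x ^+ n).
  by apply/funext => x; rewrite exprS.
exact: contM.
Qed.

Lemma cont_abs f : cont_at f -> cont_at (fun x => `|f x|).
Proof. exact: cvg_norm. Qed.

Lemma cont_sum (I : Type) (r : seq I) (p : pred I) (F : I -> X -> R) :
  (forall i, cont_at (F i)) -> cont_at (fun x => \sum_(i <- r | p i) F i x).
Proof.
move=> cF; elim: r => [|i r IH].
  by under eq_fun do rewrite big_nil; exact: cont_cst.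
under eq_fun do rewrite big_cons; case: (p i) => //; exact: contD.
Qed.

Lemma cont_prod (I : Type) (r : seq I) (p : pred I) (F : I -> X -> R) :
  (forall i, cont_at (F i)) -> cont_at (fun x => \prod_(i <- r | p i) F i x).
Proof.
move=> cF; elim: r => [|i r IH].
  by under eq_fun do rewrite big_nil; exact: cont_cst.
under eq_fun do rewrite big_cons; case: (p i) => //; exact: contM.
Qed.

Lemma cont_det n (M : X -> 'M[R]_n) : (forall i j, cont_at (fun x => M x i j)) ->
  cont_at (fun x => \det (M x)).
Proof.
move=> cM; apply: cont_sum => s; apply: contM; first exact: cont_cst.
by apply: cont_prod => i.
Qed.

Lemma cont_trace_mul m n (A : 'M[R]_(m, n)) (M : X -> 'M[R]_(m, n)) :
  (forall i j, cont_at (fun x => M x i j)) -> cont_at (fun x => \tr (A^T *m M x)).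
Proof.
move=> cM; under eq_fun do rewrite trace_mulE.
by apply: cont_sum => i; apply: cont_sum => j; apply: contM => //; exact: cont_cst.
Qed.

Lemma cont_ln f : 0 < f v -> cont_at f -> cont_at (fun x => ln (f x)).
Proof. move=> f0 cf; exact: (@continuous_comp _ _ _ f (@ln R) v cf (continuous_ln f0)). Qed.

End Continuity.

Section Compact.
Import numFieldNormedType.Exports.
Context (R : realType) (n : nat).

Lemma cont_coord (v : 'rV[R]_n) i : cont_at v (fun x : 'rV[R]_n => x 0 i).
Proof. exact: (@coord_continuous R 1 n 0 i). Qed.

(** The extreme value theorem on the compact set cut out by a closed condition in
    a Euclidean ball. Continuity of [F] is asked for there only, because the
    log-determinant is continuous only where the determinant is positive. *)
Lemma min_on_ball (q F : 'rV[R]_n -> R) (r : R) :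
  0 <= r -> q 0 <= 0 -> (forall v, cont_at v q) ->
  let C := [set v | q v <= 0 /\ \sum_i v 0 i ^+ 2 <= r ^+ 2] in
  (forall v, C v -> cont_at v F) ->
  exists2 v, C v & forall u, C u -> F v <= F u.
Proof.
move=> r0 q0 cq C cF.
have C0 : C !=set0.
  exists 0; split => //; rewrite big1 ?sqr_ge0 // => i _; by rewrite mxE expr0n.
have closed_sub (g : 'rV[R]_n -> R) c : (forall v, cont_at v g) -> closed [set v | g v <= c].
  move=> cg; apply: (@preimage_closed _ _ g [set x | x <= c]); last exact: closed_le.
  by move=> v _; exact: cg.
have Ccompact : compact C.
  apply: (@subclosed_compact _ _ [set v : 'rV[R]_n | forall i, `[- r, r]%classic (v 0 i)]).
  - apply: closedI; first exact: closed_sub.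
    apply: closed_sub => v; apply: cont_sum => i; apply: contX; exact: cont_coord.
  - exact: (@rV_compact _ n (fun=> `[- r, r]%classic) (fun=> @segment_compact _ _ _)).
  - move=> v [_ hv] i; rewrite /= in_itv /= -ler_norml.
    rewrite -ler_sqr ?nnegrE // sqr_norm_real; apply: le_trans hv.
    by rewrite (bigD1 i) //= lerDl; apply: sumr_ge0 => j _; exact: sqr_ge0.
have cC : {within C, continuous F}.
  by apply: continuous_in_subspaceT => v; rewrite inE => /cF.
have [c cC' cmin] := compact_EVT_min C0 Ccompact cC.
by exists c => [|u Cu]; [rewrite inE in cC'|apply: cmin; rewrite inE].
Qed.

End Compact.

(** * Deterministic error bound for the estimator *)
Section Objective.
Import numFieldNormedType.Exports.
Variables (R : realType) (L : nat) (d : 'I_L -> nat).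
Hypothesis d0 : forall k, (0 < d k)%N.
Notation p := (dimp d).
Notation m := (comp_dim d).
Implicit Types (B : forall k, 'M[R]_(d k)).

Lemma kentB k (C D : 'M[R]_(d k)) x y : kent (C - D) x y = kent C x y - kent D x y.
Proof. by rewrite /kent; case: ifP; rewrite ?mxE ?subr0. Qed.

Lemma kron_sumB B C : kron_sum (fun k => B k - C k) = kron_sum B - kron_sum C.
Proof.
apply/matrixP => a b; rewrite !mxE !kron_sumE -sumrB.
by apply: eq_bigr => k _; exact: kentB.
Qed.

(** The penalised likelihood as a function of the matrix alone, defined and
    continuous without reference to factors. *)
Definition objective (S : 'M[R]_p) (rho : 'I_L -> R) (M : 'M[R]_p) : R :=
  - ln (\det M) + \tr (S^T *m M) +
  \sum_k rho k * \sum_(x : mindex d) \sum_(j < d k | j != x k)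
    `|M (flat x) (flat (mindex_upd x j))|.

Lemma objectiveE S rho B : teralasso_obj S rho B = objective S rho (kron_sum B).
Proof.
rewrite /teralasso_obj /objective; congr (_ + _); apply: eq_bigr => k _.
by rewrite -l1_off_kron_sum // mulrA [rho k * _]mulrC.
Qed.

Lemma cont_objective (X : topologicalType) (v : X) (M : X -> 'M[R]_p) S rho :
  (forall i j, cont_at v (fun x => M x i j)) -> 0 < \det (M v) ->
  cont_at v (fun x => objective S rho (M x)).
Proof.
move=> cM dM; apply: contD; first apply: contD.
- by apply: contN; apply: cont_ln => //; exact: cont_det.
- exact: cont_trace_mul.
- apply: cont_sum => k; apply: contM; first exact: cont_cst.
  by apply: cont_sum => x; apply: cont_sum => j; exact: cont_abs.
Qed.

Lemma cont_kron_factors (X : topologicalType) (v : X) (M : X -> 'M[R]_p) a b :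
  (forall i j, cont_at v (fun x => M x i j)) ->
  cont_at v (fun x => kron_sum (factors (M x)) a b).
Proof.
move=> cM; under eq_fun do rewrite kron_sumE.
have ctr : cont_at v (fun x => \tr (M x)) by apply: cont_sum => i.
apply: cont_sum => k; rewrite /kent; case: (mindex_of b == _); last exact: cont_cst.
set i := mindex_of a k; set j := mindex_of b k.
have -> : (fun x => factors (M x) k i j) = (fun x =>
   (m k)%:R^-1 * \sum_(y : mindex d | y k == i) M x (flat y) (flat (mindex_upd y j)) -
   \tr (M x) * (p%:R^-1 * (i == j)%:R) +
   \tr (M x) * (p%:R^-1 * L%:R^-1 * (i == j)%:R)).
  apply/funext => x; rewrite !mxE; case: eqP => _; rewrite ?mulr1n ?mulr0n; ring.
apply: contD; first apply: contD.
- by apply: contM; [exact: cont_cst|apply: cont_sum].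
- by apply: contN; apply: contM => //; exact: cont_cst.
- by apply: contM => //; exact: cont_cst.
Qed.

End Objective.

Section Estimation.
Import numFieldNormedType.Exports.
Variables (R : realType) (L : nat) (d : 'I_L -> nat).
Hypothesis d0 : forall k, (0 < d k)%N.
Hypothesis L0 : (0 < L)%N.
Notation p := (dimp d).
Notation m := (comp_dim d).
Variables (Psi : forall k, 'M[R]_(d k)) (H : 'M[R]_p).
Local Notation Omega0 := (kron_sum Psi).
Local Notation Sigma0 := (invmx Omega0).
Hypothesis Opd : posdef Omega0.
Hypothesis Hsqrt : is_sqrtmx Sigma0 H.
Variables (S : 'M[R]_p) (rho delta : 'I_L -> R) (gamma rbar : R).
Hypothesis delta_ge0 : forall k, 0 <= delta k.
Hypothesis delta_rho : forall k, delta k <= rho k.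
Hypothesis gamma0 : 0 <= gamma.
Hypothesis rbar0 : 0 <= rbar.
Hypothesis rho_rbar : forall k, (m k)%:R * rho k ^+ 2 <= rbar ^+ 2.
(* The two stochastic inputs: entrywise control off the diagonal, and control of
   the gradient along the diagonal Kronecker sums. *)
Hypothesis off_error : forall k i j, i != j ->
  `|ptrace (S - Sigma0) k i j| <= (m k)%:R * delta k.
Hypothesis diag_error : \sum_o diag_gradient (S - Sigma0) o ^+ 2 <= gamma ^+ 2.
Implicit Types (B : forall k, 'M[R]_(d k)).

Local Notation sbar := (\sum_k offdiag_card (Psi k))%N.
Local Notation cost := (gamma + 2 * rbar * Num.sqrt sbar%:R).

Let mR k : 0 < (m k)%:R :> R.
Proof. by rewrite ltr0n comp_dim_gt0. Qed.

Let on_support k (B : forall k, 'M[R]_(d k)) : R :=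
  \sum_i \sum_(j | (j != i) && (Psi k i j != 0)) `|B k i j|.

Let on_support_le k B :
  on_support k B ^+ 2 <= (offdiag_card (Psi k))%:R * frobenius (centred B k) ^+ 2.
Proof.
pose I := ('I_(d k) * 'I_(d k))%type.
pose f (ij : I) : R := ((ij.1 != ij.2) && (Psi k ij.1 ij.2 != 0))%:R.
pose g (ij : I) : R := if ij.1 != ij.2 then `|B k ij.1 ij.2| else 0.
have -> : on_support k B = \sum_ij f ij * g ij.
  rewrite /on_support -(pair_bigA _ (fun i j => f (i, j) * g (i, j))) /=.
  apply: eq_bigr => i _; rewrite big_mkcond /=; apply: eq_bigr => j _.
  rewrite /f /g /= eq_sym; case: (i != j) => /=; last by rewrite mulr0.
  by case: (_ != 0); rewrite ?mul1r ?mul0r.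
apply: (le_trans (cauchy_schwarz f g)); apply: ler_pM.
- by apply: sumr_ge0 => ij _; exact: sqr_ge0.
- by apply: sumr_ge0 => ij _; exact: sqr_ge0.
- rewrite /offdiag_card -sum1_card natr_sum [leRHS]big_mkcond /=.
  apply: ler_sum => ij _; rewrite inE /f; case: (_ && _); by rewrite ?expr1n ?expr0n.
- rewrite sqr_frobenius trace_gramE -(pair_bigA _ (fun i j => g (i, j) ^+ 2)) /=.
  apply: ler_sum => i _; apply: ler_sum => j _; rewrite /g /=.
  case: ifP => [ij|_]; last by rewrite expr0n sqr_ge0.
  by rewrite sqr_norm_real !mxE (negbTE ij) mulr0n subr0.
Qed.

(** Cauchy-Schwarz, first over the support in each mode and then over the modes. *)
Let sum_on_support B :
  \sum_k (m k)%:R * rho k * on_support k B <=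
  rbar * Num.sqrt sbar%:R * frobenius (kron_sum B).
Proof.
pose u k : R := Num.sqrt (offdiag_card (Psi k))%:R.
pose w k : R := Num.sqrt (m k)%:R * frobenius (centred B k).
have u0 k : 0 <= u k by exact: sqrtr_ge0.
have w0 k : 0 <= w k by rewrite mulr_ge0 ?sqrtr_ge0 ?frobenius_ge0.
have sup0 k : 0 <= on_support k B by apply: sumr_ge0 => i _; apply: sumr_ge0.
have rho0 k : 0 <= rho k by exact: le_trans (delta_ge0 k) (delta_rho k).
have step k : (m k)%:R * rho k * on_support k B <= rbar * (u k * w k).
  have h1 : Num.sqrt (m k)%:R * rho k <= rbar.
    rewrite -ler_sqr ?nnegrE ?mulr_ge0 ?sqrtr_ge0 // exprMn sqr_sqrtr //.
  have h2 : on_support k B <= u k * frobenius (centred B k).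
    rewrite -ler_sqr ?nnegrE ?mulr_ge0 ?frobenius_ge0 // exprMn sqr_sqrtr //.
  have -> : rbar * (u k * w k) =
      rbar * (Num.sqrt (m k)%:R * (u k * frobenius (centred B k))) by rewrite /w; ring.
  have -> : (m k)%:R * rho k * on_support k B =
      (Num.sqrt (m k)%:R * rho k) * (Num.sqrt (m k)%:R * on_support k B).
    by rewrite -{1}(@sqr_sqrtr _ (m k)%:R) //; ring.
  by apply: ler_pM => //; rewrite ?mulr_ge0 ?sqrtr_ge0 // ler_wpM2l ?sqrtr_ge0.
apply: (@le_trans _ _ (rbar * \sum_k u k * w k)).
  by rewrite mulr_sumr; apply: ler_sum => k _.
rewrite -mulrA ler_wpM2l // -ler_sqr ?nnegrE; last 2 first.
- by apply: sumr_ge0 => k _; rewrite mulr_ge0.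
- by rewrite mulr_ge0 ?sqrtr_ge0 ?frobenius_ge0.
apply: (le_trans (cauchy_schwarz u w)); rewrite exprMn sqr_sqrtr //.
have -> : \sum_k u k ^+ 2 = sbar%:R.
  by rewrite natr_sum; apply: eq_bigr => k _; rewrite sqr_sqrtr.
apply: ler_wpM2l => //; rewrite frobenius_kron_sum //; apply: ler_wpDl.
  by apply: mulr_ge0 => //; exact: sqr_ge0.
by apply: ler_sum => k _; rewrite exprMn sqr_sqrtr.
Qed.

(** Off the diagonal the penalty dominates the sampling error outside the support
    of [Psi]; what remains on the support and on the diagonal is linear in the
    Frobenius error, while [logdet_gap] is quadratic. *)
Lemma objective_gap B t : posdef (kron_sum B) -> 0 < t <= 1 ->
  t * (opnorm Sigma0 * opnorm (kron_sum B - Omega0)) <= 2^-1 ->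
  t / 8 * frobenius (kron_sum B - Omega0) ^+ 2 <=
  opnorm Omega0 ^+ 2 * (teralasso_obj S rho B - teralasso_obj S rho Psi +
                        cost * frobenius (kron_sum B - Omega0)).
Proof.
move=> Bpd t01 small; set Delta := kron_sum B - Omega0.
pose D k := B k - Psi k.
have DeltaE : Delta = kron_sum D by rewrite kron_sumB.
have symD : Delta^T = Delta.
  by rewrite linearB /=; case: Bpd => -> _; case: Opd => ->.
have ODE : Omega0 + Delta = kron_sum B by rewrite addrC subrK.
have gap := @logdet_gap R p Omega0 H Opd Hsqrt Delta t symD.
rewrite ODE in gap; have {}gap := gap Bpd t01 small.
apply: (le_trans gap); rewrite ler_wpM2l ?sqr_ge0 //.
have [h [hD]] := trace_kron_sum_split d0 (S - Sigma0) D L0.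
rewrite -DeltaE in hD *; set G := \sum_o h o * _ => trE.
have Glow : - (gamma * frobenius Delta) <= G.
  have : `|G| <= gamma * frobenius Delta.
    rewrite -ler_sqr ?nnegrE ?mulr_ge0 ?frobenius_ge0 // sqr_norm_real exprMn.
    apply: (le_trans (cauchy_schwarz _ _)); rewrite mulrC; apply: ler_pM => //.
    + by apply: sumr_ge0 => o _; exact: sqr_ge0.
    + by apply: sumr_ge0 => o _; exact: sqr_ge0.
  by rewrite ler_norml => /andP[].
have supp := sum_on_support D; rewrite -DeltaE in supp.
have off : - (2 * \sum_k (m k)%:R * rho k * on_support k D) <=
   \sum_k \sum_i \sum_(j | j != i) ptrace (S - Sigma0) k i j * D k i j +
   (\sum_k (m k)%:R * rho k * l1_off (B k) - \sum_k (m k)%:R * rho k * l1_off (Psi k)).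
  rewrite -sumrB -big_split /= mulr_sumr -sumrN; apply: ler_sum => k _.
  have rho0 : 0 <= rho k by exact: le_trans (delta_ge0 k) (delta_rho k).
  rewrite /on_support /l1_off mulrA mulr_sumr -mulrBr -sumrB mulr_sumr -sumrN -big_split /=.
  apply: ler_sum => i _; rewrite -sumrB [X in _ <= _ + X]mulr_sumr -big_split /= mulr_sumr -sumrN.
  rewrite big_mkcond [leRHS]big_mkcond /=; apply: ler_sum => j _.
  case: (eqVneq j i) => [//|ji] /=.
  have pt : - ((m k)%:R * rho k * `|D k i j|) <= ptrace (S - Sigma0) k i j * D k i j.
    have : `|ptrace (S - Sigma0) k i j * D k i j| <= (m k)%:R * rho k * `|D k i j|.
      rewrite normrM ler_wpM2r //; apply: (@le_trans _ _ ((m k)%:R * delta k)).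
        by apply: off_error; rewrite eq_sym.
      by rewrite ler_wpM2l.
    by rewrite ler_norml => /andP[].
  have DE : D k i j = B k i j - Psi k i j by rewrite !mxE.
  case: eqP => [P0|_] /=.
    by move: pt; rewrite P0 normr0 subr0 DE P0 subr0; lra.
  have tri : `|Psi k i j| - `|B k i j| <= `|D k i j|.
    by rewrite DE distrC; exact: lerB_dist.
  have : (m k)%:R * rho k * (`|Psi k i j| - `|B k i j|) <= (m k)%:R * rho k * `|D k i j|.
    by rewrite ler_wpM2l // mulr_ge0.
  lra.
have trS : \tr (S^T *m kron_sum B) - \tr (S^T *m Omega0) =
    \tr ((S - Sigma0)^T *m Delta) + \tr (Sigma0^T *m Delta).
  by rewrite -mxtraceD -mulmxDl -linearD /= subrK -raddfB /= -mulmxBr.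
rewrite /teralasso_obj; move: trE trS; lra.
Qed.

Variable r : R.
Hypothesis r0 : 0 < r.
Hypothesis r_large : 8 * opnorm Omega0 ^+ 2 * cost < r.
Hypothesis r_small : opnorm Sigma0 * (Num.sqrt (L.+1%:R / (mmin d)%:R) * r) <= 2^-1.

(** Outside the ball of radius [r] the quadratic gap, damped by [t = r / D] so
    that it still applies, beats the linear cost. This replaces the usual
    convexity argument along the segment from [Omega0]. *)
Lemma objective_outside B : posdef (kron_sum B) ->
  r <= frobenius (kron_sum B - Omega0) ->
  teralasso_obj S rho Psi < teralasso_obj S rho B.
Proof.
move=> Bpd rD; set D := frobenius _ in rD.
have D0 : 0 < D by exact: lt_le_trans rD.
have t01 : 0 < r / D <= 1 by rewrite divr_gt0 //= ler_pdivrMr // mul1r.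
have := objective_gap Bpd t01; rewrite -/D => gap.
rewrite ltNge; apply/negP => le_obj.
have {}gap : r / D / 8 * D ^+ 2 <= opnorm Omega0 ^+ 2 *
    (teralasso_obj S rho B - teralasso_obj S rho Psi + cost * D).
  apply: gap; apply: le_trans r_small.
  have opD := opnorm_kron_sum d0 (fun k => B k - Psi k).
  rewrite kron_sumB -/D in opD.
  rewrite mulrCA ler_wpM2l ?opnorm_ge0 // mulrAC ler_pdivrMr //.
  rewrite mulrC -mulrA [r * D]mulrC mulrA ler_wpM2r //; exact: ltW.
have E : r / D / 8 * D ^+ 2 = (r / 8) * D by field; rewrite gt_eqF.
rewrite E in gap.
have : opnorm Omega0 ^+ 2 * (teralasso_obj S rho B - teralasso_obj S rho Psi + cost * D)
   <= opnorm Omega0 ^+ 2 * (cost * D).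
  by rewrite ler_wpM2l ?sqr_ge0 //; lra.
move=> /(le_trans gap); rewrite mulrA ler_pM2r //. by move: r_large => + h; lra.
Qed.

(** A minimiser outside the ball would have a larger objective than [Omega0]. *)
Lemma teralasso_close Omega_hat : teralasso S rho Omega_hat ->
  frobenius (Omega_hat - Omega0) < r.
Proof.
move=> [B [Bpd Bmin] <-]; rewrite ltNge; apply/negP => /(objective_outside Bpd).
by rewrite ltNge Bmin.
Qed.

(** The objective has a minimum on the compact ball of radius [r], intersected
    with the closed set of symmetric Kronecker sums and shifted to [Omega0]; all
    matrices there are positive definite by [r_small]. Outside the ball the
    objective exceeds its value at the centre, so this minimum is global. *)
Lemma teralasso_nonempty : teralasso S rho !=set0.
Proof.
pose M (v : 'rV[R]_(p * p)) : 'M[R]_p := vec_mx v.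
have ME v i j : M v i j = v 0 (mxvec_index i j) by rewrite mxE.
have cM v i j : cont_at v (fun u => M u i j).
  by under eq_fun do rewrite ME; exact: cont_coord.
pose K v := kron_sum (factors (M v)).
(* [q v <= 0] says that [M v] is a symmetric Kronecker sum. *)
pose q v := \sum_i \sum_j ((K v i j - M v i j) ^+ 2 + (M v j i - M v i j) ^+ 2).
have q_eq0 v : q v <= 0 -> K v = M v /\ (M v)^T = M v.
  move=> qv.
  have s0 i j : 0 <= (K v i j - M v i j) ^+ 2 + (M v j i - M v i j) ^+ 2.
    by rewrite addr_ge0 ?sqr_ge0.
  have q0 : q v = 0.
    by apply/le_anti; rewrite qv; apply: sumr_ge0 => i _; apply: sumr_ge0.
  have qij i j : (K v i j - M v i j) ^+ 2 + (M v j i - M v i j) ^+ 2 = 0.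
    have /psumr_eq0P h := q0.
    have /psumr_eq0P h' := h (fun i _ => sumr_ge0 _ (fun j _ => s0 i j)) i isT.
    exact: (h' (fun j _ => s0 i j) j isT).
  have both i j : K v i j = M v i j /\ M v j i = M v i j.
    have /eqP := qij i j; rewrite paddr_eq0 ?sqr_ge0 // !sqrf_eq0 !subr_eq0.
    by case/andP => /eqP -> /eqP ->.
  split; apply/matrixP => i j; first by case: (both i j).
  by rewrite mxE; case: (both i j).
have q_of (N : 'M[R]_p) : kron_sum (factors N) = N -> N^T = N -> q (mxvec N) <= 0.
  move=> KN symN; rewrite /q big1 // => i _; rewrite big1 // => j _.
  rewrite /K /M mxvecK KN subrr -{1}symN mxE subrr expr0n addr0 //.
have frobE v : frobenius (M v) ^+ 2 = \sum_i v 0 i ^+ 2.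
  rewrite sqr_frobenius trace_gramE pair_bigA /=.
  rewrite [RHS](reindex _ (curry_mxvec_bij _ _)) /=.
  by apply: eq_bigr => -[i j] _ /=; rewrite ME.
pose F v := objective S rho (Omega0 + M v).
have pd v : q v <= 0 -> frobenius (M v) <= r -> posdef (Omega0 + M v).
  move=> /q_eq0[KM symM] Mr; apply: (posdef_perturb Opd Hsqrt) => //.
  apply: le_lt_trans (_ : 2^-1 < 1); last by rewrite invf_lt1 // ltr1n.
  apply: le_trans r_small; rewrite ler_wpM2l ?opnorm_ge0 //.
  rewrite -KM; apply: le_trans (opnorm_kron_sum d0 _) _.
  by rewrite ler_wpM2l ?sqrtr_ge0 // -/(K v) KM.
have frob_le (v : 'rV[R]_(p * p)) : \sum_i v 0 i ^+ 2 <= r ^+ 2 -> frobenius (M v) <= r.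
  by rewrite -frobE ler_sqr // nnegrE ?frobenius_ge0 // ltW.
have cq v : cont_at v q.
  have cK i j : cont_at v (fun u => K u i j) by apply: cont_kron_factors.
  apply: cont_sum => i; apply: cont_sum => j; apply: contD; apply: contX;
    by apply: contD => //; apply: contN.
have q0 : q 0 <= 0.
  have K0 : kron_sum (factors (0 : 'M[R]_p)) = 0.
    have E : kron_sum (fun k => Psi k - Psi k) = 0 by rewrite kron_sumB subrr.
    by rewrite -E factorsK.
  by rewrite -(linear0 mxvec); apply: q_of => //; rewrite trmx0.
have cF (v : 'rV[R]_(p * p)) : q v <= 0 /\ \sum_i v 0 i ^+ 2 <= r ^+ 2 -> cont_at v F.
  move=> [qv /frob_le vr]; apply: cont_objective; last exact/posdef_det_gt0/pd.
  move=> i j; under eq_fun do rewrite mxE.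
  by apply: contD => //; exact: cont_cst.
have [v [qv /frob_le vr] vmin] := min_on_ball (ltW r0) q0 cq cF.
have [KM symM] := q_eq0 _ qv.
have hatE : kron_sum (fun k => Psi k - (Psi k - Psi k - factors (M v) k)) = Omega0 + M v.
  by rewrite !kron_sumB -/(K v) KM subrr sub0r opprK.
exists (Omega0 + M v).
(* The factors of [Omega0 + M v], written with differences only. *)
exists (fun k => Psi k - (Psi k - Psi k - factors (M v) k)); last exact: hatE.
split=> [|B' B'pd]; first by rewrite hatE; exact: pd.
rewrite !objectiveE // hatE.
have [h|h] := lerP (frobenius (kron_sum B' - Omega0)) r.
  pose N := kron_sum B' - Omega0.
  have NE : N = kron_sum (fun k => B' k - Psi k) by rewrite kron_sumB.
  have NK : Omega0 + N = kron_sum B' by rewrite addrC subrK.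
  have := vmin (mxvec N); rewrite /F /M mxvecK NK => hh; apply: hh.
  split.
    apply: q_of; first by rewrite NE factorsK.
    by rewrite linearB /=; case: B'pd => -> _; case: Opd => ->.
  by rewrite -frobE /M mxvecK ler_sqr // nnegrE ?frobenius_ge0 // ltW.
have := objective_outside B'pd (ltW h); rewrite !objectiveE // => /ltW; apply: le_trans.
have := vmin 0; rewrite /F /M linear0 addr0 => h0; apply: h0; split => //.
by rewrite big1 ?sqr_ge0 // => i _; rewrite mxE expr0n.
Qed.

End Estimation.

(** * Probabilities bounded below *)
Section UnionBound.
Context (R : realType) (disp : measure_display) (T : measurableType disp)
  (P : probability T R).

Lemma prob_ge_sub (q : R) (A B : set T) : A `<=` B -> prob_ge P q A -> prob_ge P q B.
Proof. by move=> AB [E [mE EA qE]]; exists E; split=> //; exact: subset_trans EA AB. Qed.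

Lemma prob_ge_le (q q' : R) (A : set T) : q' <= q -> prob_ge P q A -> prob_ge P q' A.
Proof.
by move=> qq [E [mE EA qE]]; exists E; split=> //; apply: le_trans qE; rewrite lee_fin.
Qed.

Lemma prob_ge_trivial (q : R) (A : set T) : q <= 0 -> prob_ge P q A.
Proof. by move=> q0; exists set0; split=> //; rewrite measure0 lee_fin. Qed.

Lemma prob_ge_setC (e : R) (B : set T) : measurable B -> (P B <= e%:E)%E ->
  prob_ge P (1 - e) (~` B).
Proof.
move=> mB Be; exists (~` B); split=> //; first exact: measurableC.
by rewrite probability_setC // EFinB leeB.
Qed.

Lemma prob_ge_setI (e e' : R) (A B : set T) :
  prob_ge P (1 - e) A -> prob_ge P (1 - e') B -> prob_ge P (1 - (e + e')) (A `&` B).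
Proof.
move=> [E [mE EA qE]] [F [mF FB qF]]; exists (E `&` F); split.
- exact: measurableI.
- by move=> w [Ew Fw]; split; [exact: EA|exact: FB].
have mEC : measurable (~` E) by exact: measurableC.
have mFC : measurable (~` F) by exact: measurableC.
have h : (P (~` (E `&` F)) <= P (~` E) + P (~` F))%E by rewrite setCI; exact: measureU2.
move: h qE qF; rewrite !probability_setC //; last exact: measurableI.
have pE := fin_num_measure P E mE; have pF := fin_num_measure P F mF.
have pI := fin_num_measure P _ (measurableI E F mE mF).
rewrite -(fineK pE) -(fineK pF) -(fineK pI) -!EFinB -EFinD !lee_fin; lra.
Qed.

Lemma measure_bigU_le (I : finType) (B : I -> set T) :
  (forall i, measurable (B i)) ->
  (P (\big[setU/set0]_i B i) <= \sum_i P (B i))%E.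
Proof.
move=> mB; have mU (s : seq I) : measurable (\big[setU/set0]_(i <- s) B i).
  by apply: bigsetU_measurable.
elim: (index_enum I) => [|i s IH]; first by rewrite !big_nil measure0.
rewrite !big_cons; apply: le_trans (measureU2 P (mB i) (mU s)) _.
by rewrite leeD2l.
Qed.

Lemma prob_ge_forall (I : finType) (B : I -> set T) (e : I -> R) :
  (forall i, measurable (B i)) -> (forall i, (P (B i) <= (e i)%:E)%E) ->
  prob_ge P (1 - \sum_i e i) [set w | forall i, ~ B i w].
Proof.
move=> mB Be.
apply: (@prob_ge_sub _ (~` (\big[setU/set0]_i B i))).
  move=> w nw i Bi; apply: nw; rewrite -bigcup_seq; exists i => //=.
  by rewrite mem_index_enum.
apply: prob_ge_setC; first by apply: bigsetU_measurable.
apply: le_trans (measure_bigU_le mB) _; rewrite -sumEFin; exact: lee_sum.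
Qed.

End UnionBound.

(** * Errors of the sample covariance as quadratic forms *)
Section PsiTwo.
Context (R : realType) (disp : measure_display) (T : measurableType disp)
  (P : probability T R).

(** The infimum in the norm need not be attained, hence the factor [2]. *)
Lemma psi2_moment (Y : T -> R) (c : R) : 0 < c -> measurable_fun setT Y ->
  (psi2_norm P Y <= c%:E)%E ->
  (\int[P]_w (expR (Y w ^+ 2 / (2 * c) ^+ 2))%:E <= 2%:E)%E.
Proof.
move=> c0 mY hY.
have : (psi2_norm P Y < (2 * c)%:E)%E by apply: le_lt_trans hY _; rewrite lte_fin; lra.
move=> /ereal_inf_lt[_ [t [t0 tE] <-]]; rewrite lte_fin => tc.
rewrite unlock in tE; apply: le_trans tE.
have mexp s : measurable_fun setT (fun w => (expR (Y w ^+ 2 / s ^+ 2))%:E).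
  apply/measurable_EFinP; apply: measurableT_comp => //.
  by apply: measurable_funM => //; exact: measurable_funX.
apply: ge0_le_integral => //; try exact: mexp.
- move=> w _; rewrite lee_fin ler_expR ler_wpM2l ?sqr_ge0 //.
  rewrite lef_pV2 ?posrE ?exprn_gt0 //; last lra.
  by rewrite ler_sqr ?nnegrE; lra.
Qed.

End PsiTwo.

Section Model.
Context (R : realType) (disp : measure_display) (T : measurableType disp)
  (P : probability T R) (L : nat) (d : 'I_L -> nat) (n : nat).
Notation p := (dimp d).
Notation m := (comp_dim d).
Variables (C0 : R) (Psi : forall k, 'M[R]_(d k))
  (Z : 'I_n -> {RV P >-> p.-tuple R}) (X : 'I_n -> T -> tensor R d).
Hypothesis C00 : 0 < C0.
Hypothesis d0 : forall k, (0 < d k)%N.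
Hypothesis n0 : (0 < n)%N.
Hypothesis model : kron_sum_model C0 Psi Z X.
Local Notation Sigma0 := (invmx (kron_sum Psi)).
Local Notation Sn w := (sample_cov (X ^~ w)).

Lemma model_measurable i : measurable_fun setT (Z i).
Proof. exact: measurable_funPT. Qed.

Lemma model_coords i : independent P (fun j w => tnth (Z i w) j).
Proof. by case: model => _ _ _ h _; case: (h i). Qed.

Lemma model_samples : independent P (fun i w => Z i w).
Proof. by case: model => _ _ _ _ []. Qed.

Lemma model_mean i j : (\int[P]_w (tnth (Z i w) j)%:E = 0)%E.
Proof.
by case: model => _ _ _ h _; case: (h i) => _ /(_ j)[]; rewrite unlock.
Qed.

Lemma model_var i j : (\int[P]_w (tnth (Z i w) j ^+ 2)%:E = 1)%E.
Proof.
by case: model => _ _ _ h _; case: (h i) => _ /(_ j)[_]; rewrite unlock.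
Qed.

Lemma model_psi2 i j :
  (\int[P]_w (expR (tnth (Z i w) j ^+ 2 / (2 * C0) ^+ 2))%:E <= 2%:E)%E.
Proof.
case: model => _ _ _ h _; case: (h i) => _ /(_ j)[_ _]; apply: psi2_moment => //.
exact: (measurableT_comp (measurable_tnth j) (model_measurable i)).
Qed.

Lemma model_posdef : posdef (kron_sum Psi).
Proof. by case: model. Qed.

Lemma model_sqrt : exists2 H, is_sqrtmx Sigma0 H &
  forall i w, vec (X i w) = H *m col_of (Z i w).
Proof. by case: model. Qed.

Variable H : 'M[R]_p.
Hypothesis Hsqrt : is_sqrtmx Sigma0 H.
Hypothesis Xvec : forall i w, vec (X i w) = H *m col_of (Z i w).

Let symH : H^T = H. Proof. by case: Hsqrt => -[]. Qed.
Let HH : H *m H = Sigma0. Proof. by case: Hsqrt. Qed.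
Let nR : n%:R != 0 :> R. Proof. by rewrite pnatr_eq0 -lt0n. Qed.
Let mR k : (m k)%:R != 0 :> R.
Proof. by rewrite pnatr_eq0 -lt0n comp_dim_gt0. Qed.

Lemma sample_cov_sym w : (Sn w)^T = Sn w.
Proof.
rewrite /sample_cov linearZ /=; congr (_ *: _); rewrite raddf_sum /=.
by apply: eq_bigr => i _; rewrite trmx_mul trmxK.
Qed.

Lemma trace_sample_cov w (M : 'M[R]_p) :
  \tr ((Sn w)^T *m M) = n%:R^-1 * \sum_i qform (H *m M *m H) (Z i w).
Proof.
rewrite sample_cov_sym -scalemxAl mxtraceZ; congr (_ * _).
rewrite mulmx_suml raddf_sum /=; apply: eq_bigr => i _.
by rewrite -mulmxA mxtrace_mulC qformE Xvec trmx_mul symH !mulmxA.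
Qed.

Lemma trace_sigma (M : 'M[R]_p) : \tr (Sigma0^T *m M) = \tr (H *m M *m H).
Proof.
rewrite [RHS]mxtrace_mulC mulmxA HH trmx_inv.
by case: model_posdef => ->.
Qed.

Lemma trace_error w (M : 'M[R]_p) :
  \tr ((Sn w - Sigma0)^T *m M) = n%:R^-1 * qdev Z (H *m M *m H) w.
Proof.
rewrite linearB /= mulmxBl raddfB /= trace_sample_cov trace_sigma /qdev.
rewrite sumrB mulrBr; congr (_ - _).
by rewrite sumr_const card_ord -[\tr _ *+ n]mulr_natl mulKf.
Qed.

Lemma trace_kronmx_delta (S : 'M[R]_p) k i j :
  \tr (S^T *m kronmx (delta_mx i j : 'M[R]_(d k))) = ptrace S k i j.
Proof.
rewrite trace_mulE sum_flat mxE [RHS]big_mkcond /=; apply: eq_bigr => x _.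
rewrite sum_flat.
rewrite (eq_bigr (fun y => kent (delta_mx i j) x y * S (flat x) (flat y))); last first.
  by move=> y _; rewrite mxE !flatK mulrC.
rewrite sum_kent (bigD1 j) //= !mxE eqxx andbT big1 ?addr0; last first.
  by move=> l /negbTE lj; rewrite mxE lj andbF mul0r.
by case: (x k == i); rewrite ?mul1r ?mul0r.
Qed.

Lemma frobenius_kronmx k (C : 'M[R]_(d k)) :
  frobenius (kronmx C) ^+ 2 = (m k)%:R * frobenius C ^+ 2.
Proof.
rewrite !sqr_frobenius !trace_gramE sum_flat -(sum_coord1 d0 (fun i => \sum_j C i j ^+ 2)).
apply: eq_bigr => x _; rewrite sum_flat.
rewrite (eq_bigr (fun y => kent C x y * kent C x y)); last first.
  by move=> y _; rewrite mxE !flatK expr2.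
rewrite (sum_kent C x (kent C x)); apply: eq_bigr => j _.
by rewrite /kent upd_same eqxx expr2.
Qed.

(** The mode covariances are normalised partial traces of the sample covariance,
    so both kinds of error are linear functionals of the same matrix. *)
Lemma mode_cov_ptrace k w : mode_cov k (X ^~ w) = (m k)%:R^-1 *: ptrace (Sn w) k.
Proof.
apply/matrixP => i j; rewrite !mxE summxE.
have vecE i' x : vec (X i' w) (flat x) 0 = X i' w x by rewrite mxE flatK.
have -> : \sum_(x : mindex d | x k == i) Sn w (flat x) (flat (mindex_upd x j)) =
   n%:R^-1 * \sum_i' mode_gram k (X i' w) i j.
  rewrite mulr_sumr.
  under eq_bigr do rewrite mxE summxE mulr_sumr.
  rewrite exchange_big; apply: eq_bigr => i' _; rewrite mxE mulr_sumr.
  by apply: eq_bigr => x _; rewrite mxE big_ord1 [_^T _ _]mxE !vecE.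
by rewrite mulrA invfM [n%:R^-1 * _]mulrC.
Qed.

Lemma expect_mode_cov k i j :
  'E_P[fun w => mode_cov k (X ^~ w) i j]%E = ((m k)%:R^-1 * ptrace Sigma0 k i j)%:E.
Proof.
set A := H *m kronmx (delta_mx i j : 'M[R]_(d k)) *m H.
have E w : mode_cov k (X ^~ w) i j = (m k)%:R^-1 * n%:R^-1 * \sum_i' qform A (Z i' w).
  by rewrite mode_cov_ptrace mxE -trace_kronmx_delta trace_sample_cov mulrA.
rewrite unlock.
rewrite (eq_integral (fun w => ((m k)%:R^-1 * n%:R^-1)%:E *
   (\sum_(i' <- index_enum 'I_n) (EFin \o (fun w => qform A (Z i' w))) w))%E); last first.
  by move=> w _; rewrite E EFinM -sumEFin.
have iq i' : P.-integrable setT (EFin \o (fun w => qform A (Z i' w))).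
  exact: integrable_qform (model_measurable i') (model_var i') A.
rewrite integralZl //; last by apply: integrable_sum.
rewrite integral_sum //.
rewrite (eq_bigr (fun=> (\tr A)%:E)); last first.
  move=> i' _; exact: integral_qform (model_measurable i') (model_coords i')
    (model_mean i') (model_var i') A.
rewrite sumEFin -EFinM sumr_const card_ord -[\tr _ *+ n]mulr_natl; congr EFin.
rewrite mulrA mulfVK // -trace_kronmx_delta trace_sigma //.
Qed.

Lemma mode_cov_error k i j w :
  `|mode_cov k (X ^~ w) i j - fine 'E_P[fun w' => mode_cov k (X ^~ w') i j]%E| =
  (m k)%:R^-1 * `|ptrace (Sn w - Sigma0) k i j|.
Proof.
rewrite expect_mode_cov /= mode_cov_ptrace mxE -mulrBr normrM ger0_norm ?invr_ge0 //.
by rewrite -!trace_kronmx_delta linearB /= mulmxBl raddfB.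
Qed.

(** The functional is a quadratic form in the noise with matrix [H M H], whose
    norms are those of [M] up to the factor [opnorm Sigma0]. Symmetrising the
    matrix changes neither the form nor the trace, and does not increase the
    norms. *)
Lemma functional_tail (M : 'M[R]_p) (b F l u : R) :
  opnorm M <= b -> frobenius M ^+ 2 <= F -> 0 <= l ->
  l * (opnorm Sigma0 * b) <= hw_radius (2 * C0) ->
  (P [set w | (2 * u <= qdev Z (H *m M *m H) w)%R] <=
   (2 * expR (n%:R * (hw_var (2 * C0) * l ^+ 2 * (opnorm Sigma0 ^+ 2 * F)) - l * u))%:E)%E.
Proof.
move=> Mb MF l0 lb; set A := H *m M *m H.
have sym_entry (N : 'M[R]_p) i j : (2^-1 *: (N + N^T)) i j = 2^-1 * (N i j + N j i).
  by rewrite !mxE.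
pose As : 'M[R]_p := 2^-1 *: (A + A^T).
have quadE (x : 'cV[R]_p) : \tr (x^T *m As *m x) = \tr (x^T *m A *m x).
  rewrite /As -scalemxAr -scalemxAl mxtraceZ mulmxDr mulmxDl mxtraceD.
  have -> : \tr (x^T *m A^T *m x) = \tr (x^T *m A *m x).
    by rewrite -[LHS]mxtrace_tr !trmx_mul !trmxK mulmxA.
  lra.
have qs z : qform As z = qform A z by rewrite !qformE quadE.
have ts : \tr As = \tr A.
  by rewrite /As mxtraceZ mxtraceD mxtrace_tr; lra.
have -> : [set w | 2 * u <= qdev Z A w] = [set w | 2 * u <= qdev Z As w].
  by apply/seteqP; split=> w /=; rewrite /qdev ts; under [X in _ <= X -> _]eq_bigr do rewrite ?qs;
     under [X in _ -> _ <= X]eq_bigr do rewrite ?qs.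
have K0 : 0 < 2 * C0 by rewrite mulr_gt0.
apply: (@hanson_wright R disp T P p n (fun i => Z i) (2 * C0) model_measurable model_samples
   model_coords K0 model_mean model_var model_psi2 As (opnorm Sigma0 * b)) => //.
- by rewrite /As linearZ /= linearD /= trmxK addrC.
- move=> x; rewrite quadE; apply: le_trans (quad_form_congr M x symH HH) _.
  by rewrite ler_wpM2r ?trace_gram_ge0 // ler_wpM2l ?opnorm_ge0.
- apply: (@le_trans _ _ (frobenius A ^+ 2)).
    rewrite !sqr_frobenius !trace_gramE.
    apply: (@le_trans _ _ (\sum_i \sum_j (2^-1 * A i j ^+ 2 + 2^-1 * A j i ^+ 2))).
      apply: ler_sum => i _; apply: ler_sum => j _; rewrite sym_entry.
      have := sqr_ge0 (A i j - A j i); rewrite sqrrB; lra.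
    have half (f : 'I_p -> 'I_p -> R) :
        \sum_i \sum_j 2^-1 * f i j = 2^-1 * \sum_i \sum_j f i j.
      by rewrite mulr_sumr; apply: eq_bigr => i _; rewrite mulr_sumr.
    under eq_bigr do rewrite big_split /=.
    rewrite big_split /= [X in _ + X]exchange_big /= !(half (fun i j => A i j ^+ 2)); lra.
  apply: (@le_trans _ _ ((opnorm Sigma0 * frobenius M) ^+ 2)).
    by rewrite ler_sqr ?nnegrE ?mulr_ge0 ?frobenius_ge0 ?opnorm_ge0 //; exact: frobenius_congr.
  by rewrite exprMn ler_wpM2l ?sqr_ge0.
Qed.

Lemma measurable_functional (M : 'M[R]_p) u :
  measurable [set w | (2 * u <= qdev Z (H *m M *m H) w)%R].
Proof. by apply: measurable_superlevel; exact: (measurable_qdev model_measurable). Qed.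

End Model.

(** * Off-diagonal errors of the mode covariances *)
Section Dominating.
Variable R : realType.

Lemma ln_nat_ge0 (p : nat) : (0 < p)%N -> 0 <= ln p%:R :> R.
Proof. by move=> p0; apply: ln_ge0; rewrite ler1n. Qed.

Lemma frobenius_delta n (i j : 'I_n) : frobenius (delta_mx i j : 'M[R]_n) = 1.
Proof.
apply/eqP; rewrite -sqrp_eq1 ?frobenius_ge0 // sqr_frobenius trmx_delta mul_delta_mx.
rewrite /mxtrace (bigD1 j) //= mxE !eqxx big1 ?addr0 // => k /negbTE kj.
by rewrite mxE kj.
Qed.

(** Each off-diagonal entry of a mode covariance is a quadratic form in the
    noise; with [log p <= m k] the subgaussian regime of the concentration bound
    is enough, and a large constant pays for the union over all entries. *)
Lemma dominating_exists (C0 : R) : 0 < C0 -> exists2 c1 : R, 0 < c1 & dominating C0 c1.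
Proof.
move=> C00; have K0 : 0 < 2 * C0 by rewrite mulr_gt0.
set th := hw_radius (2 * C0); have th0 : 0 < th by exact: hw_radius_gt0.
set q := hw_var (2 * C0); have q0 : 0 < q by exact: hw_var_gt0.
(* The Chernoff exponent is then [- 5 ln p]: [4] for the entries, signs and
   constants in the union bound, [1] for the remaining probability. *)
pose c1 := 2 * (5 + q * th ^+ 2) / th.
have c10 : 0 < c1.
  by rewrite divr_gt0 // mulr_gt0 // addr_gt0 // mulr_gt0 // exprn_gt0.
exists c1 => //; exists 1 => // L d n disp T P Psi Z X delta L2 d0 n1 model lpm hdelta.
have p0 : (0 < dimp d)%N by exact: dimp_gt0.
have [p1|p2] := leqP (dimp d) 1.
  apply: prob_ge_trivial; rewrite mul1r.
  have -> : dimp d = 1%N by apply/eqP; rewrite eqn_leq p1.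
  have : 2 <= L%:R :> R by rewrite ler_nat.
  by rewrite ln1 oppr0 expR0 mulr1; lra.
have [H Hsqrt Xvec] := model_sqrt model.
have Opd := model_posdef model.
have [s0 _ _] := posdef_opnorm p0 (posdef_inv Opd).
set s := opnorm (invmx (kron_sum Psi)) in s0.
set lp := ln (dimp d)%:R in lpm *.
have lp0 : 0 <= lp by exact: ln_nat_ge0.
have nR : 0 < n%:R :> R by rewrite ltr0n.
have mR k : 0 < (comp_dim d k)%:R :> R by rewrite ltr0n comp_dim_gt0.
have nm0 k : 0 < n%:R * (comp_dim d k)%:R :> R by rewrite mulr_gt0.
pose a k := Num.sqrt (lp / (n%:R * (comp_dim d k)%:R)).
have a0 k : 0 <= a k by exact: sqrtr_ge0.
have a2 k : a k ^+ 2 = lp / (n%:R * (comp_dim d k)%:R).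
  by rewrite sqr_sqrtr // divr_ge0 // ltW.
have a1 k : a k <= 1.
  rewrite -ler_sqr ?nnegrE // expr1n a2 ler_pdivrMr // mul1r.
  apply: (le_trans lpm); apply: (@le_trans _ _ (comp_dim d k)%:R).
    by rewrite ler_nat mmin_le.
  by rewrite ler_peMl ?ler1n // ltW.
pose N k i j := kronmx (delta_mx i j : 'M[R]_(d k)).
pose u k : R := n%:R * (comp_dim d k)%:R * (c1 * (s * a k)) / 2.
have tail k i j (sg : bool) : (P [set w | (2 * u k <= qdev (fun i => Z i)
      (H *m ((-1) ^+ sg *: N k i j) *m H) w)%R] <= (2 * expR (- (5 * lp)))%:E)%E.
  have opN : opnorm ((-1) ^+ sg *: N k i j) <= 1.
    apply: opnorm_le => // x; rewrite mul1r -scalemxAl frobeniusZ normrX normrN1 expr1n mul1r.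
    apply: (le_trans (opnorm_mulmx _ _)); rewrite ler_piMl ?frobenius_ge0 //.
    by apply: (le_trans (opnorm_kronmx d0 _)); rewrite frobenius_delta.
  have frN : frobenius ((-1) ^+ sg *: N k i j) ^+ 2 <= (comp_dim d k)%:R.
    rewrite frobeniusZ normrX normrN1 expr1n mul1r frobenius_kronmx //.
    by rewrite frobenius_delta expr1n mulr1.
  have l0 : 0 <= th * a k / s by rewrite divr_ge0 ?mulr_ge0 // ltW.
  have lb : th * a k / s * (s * 1) <= th.
    by rewrite mulr1 divfK ?gt_eqF // ler_piMr // ltW.
  have := functional_tail C00 model Hsqrt (u k) opN frN l0 lb.
  move=> /le_trans; apply; rewrite lee_fin ler_pM2l // ler_expR -/s -/q.
  have -> : n%:R * (q * (th * a k / s) ^+ 2 * (s ^+ 2 * (comp_dim d k)%:R)) =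
      q * th ^+ 2 * (a k ^+ 2 * (n%:R * (comp_dim d k)%:R)).
    by field; rewrite gt_eqF.
  have -> : th * a k / s * u k =
      th * c1 / 2 * (a k ^+ 2 * (n%:R * (comp_dim d k)%:R)).
    by rewrite /u; field; rewrite gt_eqF.
  rewrite a2 divfK ?gt_eqF //.
  have -> : th * c1 / 2 = 5 + q * th ^+ 2 by rewrite /c1; field; rewrite gt_eqF.
  rewrite -/lp; lra.
pose I := {k : 'I_L & ('I_(d k) * 'I_(d k) * bool)%type}.
pose bad (o : I) := [set w | (2 * u (tag o) <= qdev (fun i => Z i)
  (H *m ((-1) ^+ (tagged o).2 *: N (tag o) (tagged o).1.1 (tagged o).1.2) *m H) w)%R].
have mbad o : measurable (bad o) by exact: measurable_functional.
have Pbad o : (P (bad o) <= (2 * expR (- (5 * lp)))%:E)%E by exact: tail.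
have := prob_ge_forall mbad Pbad.
have cardI : \sum_(o : I) 2 * expR (- (5 * lp)) <= L%:R * expR (- (1 * lp)).
  rewrite sumr_const card_tagged sumnE big_map big_enum /=.
  rewrite -[leLHS]mulr_natl natr_sum mulr_suml.
  apply: (@le_trans _ _ (\sum_(k < L) expR (- (1 * lp)))); last first.
    by rewrite sumr_const card_ord mulr_natl.
  apply: ler_sum => k _; rewrite !card_prod card_ord card_bool.
  have dp : (d k)%:R <= (dimp d)%:R :> R.
    by rewrite ler_nat -(comp_dimE d k) leq_pmull // comp_dim_gt0.
  have pE : (dimp d)%:R = expR lp by rewrite lnK // posrE ltr0n.
  have h4 : 4 <= expR lp * expR lp.
    rewrite -pE -natrM -[4]/(2 * 2)%:R ler_nat; exact: leq_mul.
  have h1 : (d k * d k * 2)%:R * (2 * expR (- (5 * lp))) =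
     ((d k)%:R * (d k)%:R) * 4 * expR (- (5 * lp)) by rewrite !natrM; ring.
  rewrite h1.
  have -> : expR (- (1 * lp)) = (expR lp * expR lp) * (expR lp * expR lp) * expR (- (5 * lp)).
    by rewrite -!expRD; congr expR; ring.
  rewrite ler_wpM2r ?expR_ge0 //; apply: ler_pM => //.
  by rewrite -pE; apply: ler_pM.
move=> h; apply: prob_ge_le (prob_ge_sub _ h); first by rewrite lerD2l lerN2.
move=> w good k i j ij.
have key (sg : bool) : qdev (fun i => Z i) (H *m ((-1) ^+ sg *: N k i j) *m H) w < 2 * u k.
  have := good (Tagged (fun k => ('I_(d k) * 'I_(d k) * bool)%type) (i, j, sg)).
  by rewrite /bad /= => /negP; rewrite -ltNge.
have E := mode_cov_error n1 model Hsqrt Xvec i j w.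
rewrite E ler_pdivrMl //.
have F (sg : bool) : \tr ((sample_cov (X ^~ w) - invmx (kron_sum Psi))^T *m ((-1) ^+ sg *: N k i j)) =
    (-1) ^+ sg * ptrace (sample_cov (X ^~ w) - invmx (kron_sum Psi)) k i j.
  by rewrite -scalemxAr mxtraceZ trace_kronmx_delta.
have G (sg : bool) : (-1) ^+ sg * ptrace (sample_cov (X ^~ w) - invmx (kron_sum Psi)) k i j <=
    (comp_dim d k)%:R * delta k.
  rewrite -F (trace_error n1 model Hsqrt Xvec) ler_pdivrMl //.
  apply: (@le_trans _ _ (2 * u k)); first exact: ltW.
  have -> : 2 * u k = n%:R * ((comp_dim d k)%:R * (c1 * (s * a k))) by rewrite /u; field.
  by rewrite ler_wpM2l ?(ltW nR) // ler_wpM2l ?(ltW (mR k)) //; exact: hdelta.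
rewrite ler_norml; apply/andP; split.
  by have := G true; rewrite expr1 mulN1r; lra.
by have := G false; rewrite expr0 mul1r.
Qed.

End Dominating.

(** * Diagonal errors by rounding to a lattice *)
Section Lattice.
Variables (R : realType) (I : finType).
Hypothesis I0 : (0 < #|I|)%N.
Notation D := #|I|.

(** A finite type of integer vectors, as signs and moduli. The modulus [2 * #|I|]
    is the largest one that occurs below the weight used in the rounding. *)
Definition lattice := {ffun I -> bool * 'I_(2 * D).+1}.

Definition lcoord (h : lattice) (o : I) : R := (-1) ^+ (h o).1 * (nat_of_ord (h o).2)%:R.

Definition lweight (h : lattice) : nat := (\sum_o (h o).2)%N.

Let DR : 0 < D%:R :> R. Proof. by rewrite ltr0n. Qed.

(** Rounding [2 sqrt D g / |g|] towards zero costs at most [1] per coordinate,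
    hence at most half of the inner product with [g]. *)
Lemma lattice_rounding (g : I -> R) : exists h : lattice,
  [/\ (lweight h <= 2 * D)%N, \sum_o lcoord h o ^+ 2 <= 4 * D%:R &
      Num.sqrt D%:R * Num.sqrt (\sum_o g o ^+ 2) <= \sum_o lcoord h o * g o].
Proof.
set G := Num.sqrt (\sum_o g o ^+ 2); have G0 : 0 <= G by exact: sqrtr_ge0.
have G2 : G ^+ 2 = \sum_o g o ^+ 2.
  by rewrite sqr_sqrtr ?sumr_ge0 // => o _; exact: sqr_ge0.
set s := Num.sqrt D%:R; have s0 : 0 < s by rewrite sqrtr_gt0.
have s2 : s ^+ 2 = D%:R by rewrite sqr_sqrtr // ltW.
have s_le : s <= D%:R.
  by rewrite -s2 expr2 ler_peMl ?(ltW s0) // -sqrtr1 ler_wsqrtr // ler1n.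
have [G00|Gn0] := eqVneq G 0.
  exists [ffun=> (false, ord0)]; rewrite /lweight /lcoord; split.
  - by rewrite big1 // => o _; rewrite ffunE.
  - by rewrite big1 ?mulr_ge0 // => o _; rewrite ffunE /= mulr0 expr0n.
  - by rewrite G00 mulr0 big1 // => o _; rewrite ffunE /= mulr0 mul0r.
have Gp : 0 < G by rewrite lt_neqAle eq_sym Gn0.
(* The vector to be rounded has norm [2 sqrt D] and the direction of [g]. *)
pose y o := 2 * s * `|g o| / G.
have y0 o : 0 <= y o by rewrite divr_ge0 ?mulr_ge0 // ltW.
have gG o : `|g o| <= G.
  rewrite -ler_sqr ?nnegrE // sqr_norm_real G2 (bigD1 o) //= lerDl.
  by apply: sumr_ge0 => o' _; exact: sqr_ge0.
pose k o := Num.truncn (y o).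
have k_le o : (k o)%:R <= y o by rewrite /k truncn_le.
have k_gt o : y o - 1 <= (k o)%:R.
  by have := truncnS_gt (y o); rewrite -/(k o) -natr1; lra.
have kD o : (k o < (2 * D).+1)%N.
  rewrite ltnS -(ler_nat R); apply: (le_trans (k_le o)).
  rewrite /y ler_pdivrMr // natrM -mulrA; apply: (@le_trans _ _ (2 * (D%:R * G))).
    by rewrite ler_pM2l //; apply: ler_pM => //; exact: ltW.
  by rewrite mulrA.
exists [ffun o => (g o < 0, Ordinal (kD o))].
set h := finfun _.
have hE o : lcoord h o = (-1) ^+ (g o < 0)%R * (k o)%:R by rewrite /lcoord /h ffunE.
have sumabs : \sum_o `|g o| <= s * G.
  rewrite -ler_sqr ?nnegrE ?mulr_ge0 ?sumr_ge0 ?(ltW s0) // exprMn s2 G2.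
  have := cauchy_schwarz (fun _ : I => 1) (fun o => `|g o|).
  under eq_bigr do rewrite mul1r.
  under [X in _ <= X * _]eq_bigr do rewrite expr1n.
  rewrite sumr_const; under [X in _ <= _ * X]eq_bigr do rewrite sqr_norm_real.
  by [].
have sumy : \sum_o y o <= 2 * D%:R.
  rewrite /y -!mulr_suml -mulr_sumr ler_pdivrMr // -mulrA -s2 -mulrA ler_pM2l //.
  by rewrite expr2 -mulrA ler_pM2l.
split.
- rewrite -(ler_nat R) natrM natr_sum; apply: le_trans sumy; apply: ler_sum => o _.
  by rewrite /h ffunE /=; exact: k_le.
- apply: (@le_trans _ _ (\sum_o y o ^+ 2)).
    apply: ler_sum => o _; rewrite hE exprMn sqrr_sign mul1r.
    by rewrite ler_sqr ?nnegrE.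
  rewrite (eq_bigr (fun o => (2 * s / G) ^+ 2 * g o ^+ 2)); last first.
    by move=> o _; rewrite -(sqr_norm_real (g o)) /y; ring.
  rewrite -mulr_sumr -G2 -s2 le_eqVlt; apply/orP; left; apply/eqP.
  by field.
- rewrite (eq_bigr (fun o => (k o)%:R * `|g o|)); last first.
    move=> o _; rewrite hE; case: (ltrP (g o) 0) => g0.
      by rewrite ltr0_norm // expr1; ring.
    by rewrite ger0_norm // expr0 mul1r.
  apply: (@le_trans _ _ (\sum_o (y o - 1) * `|g o|)); last first.
    by apply: ler_sum => o _; rewrite ler_wpM2r.
  have -> : \sum_o (y o - 1) * `|g o| = 2 * s * G - \sum_o `|g o|.
    rewrite (eq_bigr (fun o => 2 * s / G * g o ^+ 2 - `|g o|)); last first.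
      by move=> o _; rewrite -(sqr_norm_real (g o)) /y; ring.
    rewrite sumrB -mulr_sumr -G2; congr (_ - _); by field.
  lra.
Qed.

Lemma geometric_half_le (n : nat) : \sum_(k < n) (2^-1 : R) ^+ k <= 2.
Proof.
suff -> : \sum_(k < n) (2^-1 : R) ^+ k = 2 - 2 * 2^-1 ^+ n.
  by rewrite gerBl mulr_ge0 // exprn_ge0.
elim: n => [|n IH]; first by rewrite big_ord0 expr0; lra.
rewrite big_ord_recr /= IH exprS; lra.
Qed.

(** Each vector of weight at most [2 D] contributes at least one to the sum of
    [4 ^ (D - weight / 2)], which factors over the coordinates into a product of
    geometric series bounded by [4]. *)
Lemma card_lattice_le :
  #|[set h : lattice | (lweight h <= 2 * D)%N]%SET|%:R <= 16 ^+ D :> R.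
Proof.
(* The weight of a coordinate; the factor [2] for the sign and the geometric
   series give a total of at most [4]. *)
pose F (u : bool * 'I_(2 * D).+1) : R := 2^-1 ^+ u.2.
have F0 u : 0 <= F u by rewrite exprn_ge0.
apply: (@le_trans _ _ (\sum_(h : lattice) 4 ^+ D * \prod_o F (h o))).
  rewrite -sum1_card natr_sum [leLHS]big_mkcond /=; apply: ler_sum => h _.
  rewrite inE; case: ifP => [hw|_]; last first.
    by rewrite mulr_ge0 ?exprn_ge0 // prodr_ge0.
  rewrite /F prodrXr -/(lweight h) -[4]/(2 * 2)%:R.
  have -> : (2 * 2)%:R ^+ D = 2 ^+ (2 * D) :> R by rewrite exprM expr2 natrM.
  by rewrite exprVn ler_pdivlMr ?exprn_gt0 // mul1r ler_weXn2l // ler1n.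
rewrite -mulr_sumr -(bigA_distr_bigA (fun (_ : I) u => F u)) /=.
rewrite prodr_const -exprMn; apply: lerXn2r; rewrite ?nnegrE //.
  by rewrite mulr_ge0 // sumr_ge0.
have -> : \sum_u F u = 2 * \sum_(k < (2 * D).+1) 2^-1 ^+ k.
  rewrite -(pair_bigA _ (fun (b : bool) (k : 'I_(2 * D).+1) => F (b, k))) /=.
  by rewrite big_bool /F /=; ring.
have := geometric_half_le (2 * D).+1; lra.
Qed.

End Lattice.

Section DiagonalError.
Variables (R : realType) (L : nat) (d : 'I_L -> nat) (n : nat).
Hypothesis d0 : forall k, (0 < d k)%N.
Hypothesis L0 : (0 < L)%N.
Hypothesis n1 : (1 <= n)%N.
Notation m := (comp_dim d).
Local Notation p := (dimp d).
Local Notation D := (\sum_k d k).+1.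

(** Since [log x <= x], the frame is large enough for a failure probability
    exponential in its size to be polynomial in [1 / p]. *)
Lemma ln_dimp_le : ln p%:R <= D%:R :> R.
Proof.
have p0 : 0 < p%:R :> R by rewrite ltr0n dimp_gt0.
rewrite -[leRHS]expRK ler_ln ?posrE ?expR_gt0 //.
apply: (@le_trans _ _ (expR (\sum_k d k)%:R)); last by rewrite ler_expR ler_nat.
rewrite natr_sum expR_sum /dimp natr_prod.
apply: ler_prod => k _; rewrite ler0n /=.
by have := expR_ge1Dx ((d k)%:R : R); lra.
Qed.

Variables (disp : measure_display) (T : measurableType disp) (P : probability T R).
Variables (C0 : R) (Psi : forall k, 'M[R]_(d k)).
Variables (Z : 'I_n -> {RV P >-> p.-tuple R}) (X : 'I_n -> T -> tensor R d).
Hypothesis C00 : 0 < C0.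
Hypothesis model : kron_sum_model C0 Psi Z X.
Local Notation Sigma0 := (invmx (kron_sum Psi)).

(** Chosen so that the Chernoff exponent in [diag_gradient_tail] equals
    [- 17 D], where [D] is the number of frame coordinates. *)
Definition diag_const : R :=
  (4 * hw_var (2 * C0) * (hw_radius (2 * C0) / 3) ^+ 2 + 17) / (hw_radius (2 * C0) / 3).

Lemma diag_const_gt0 : 0 < diag_const.
Proof.
have K0 : 0 < 2 * C0 by rewrite mulr_gt0.
have th0 := hw_radius_gt0 K0; have q0 := hw_var_gt0 K0.
by rewrite divr_gt0 ?divr_gt0 // addr_gt0 // mulr_gt0 ?mulr_gt0 // exprn_gt0 // divr_gt0.
Qed.

(** A union bound over lattice directions: each fails with probability at most
    [2 exp (- 17 D)] and there are at most [16 ^ D] of them. Testing against the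
    rounding of the gradient itself then bounds its norm. The hypothesis on the
    sample size keeps the Chernoff parameter in the admissible range, since a
    Kronecker sum has a small operator norm for its Frobenius norm. *)
Lemma diag_gradient_tail : (L.+1 * D <= 2 * (n * mmin d))%N ->
  prob_ge P (1 - expR (- ln p%:R))
    [set w | \sum_o diag_gradient (sample_cov (X ^~ w) - Sigma0) o ^+ 2 <=
             (2 * diag_const * opnorm Sigma0 * Num.sqrt (D%:R / n%:R)) ^+ 2].
Proof.
move=> hD; have K0 : 0 < 2 * C0 by rewrite mulr_gt0.
set th := hw_radius (2 * C0); have th0 : 0 < th by exact: hw_radius_gt0.
set q := hw_var (2 * C0); have q0 : 0 < q by exact: hw_var_gt0.
have a0 := diag_const_gt0; set a := diag_const in a0 *.
have p0 : (0 < dimp d)%N by exact: dimp_gt0.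
have [H Hsqrt Xvec] := model_sqrt model.
have Opd := model_posdef model.
have [s0 _ _] := posdef_opnorm p0 (posdef_inv Opd).
set s := opnorm (invmx (kron_sum Psi)) in s0 *.
have nR : 0 < n%:R :> R by rewrite ltr0n.
have mR : 0 < (mmin d)%:R :> R by rewrite ltr0n mmin_gt0.
pose rn : R := Num.sqrt n%:R.
have rn0 : 0 < rn by rewrite sqrtr_gt0.
have rn2 : rn ^+ 2 = n%:R by rewrite sqr_sqrtr // ltW.
pose rD : R := Num.sqrt D%:R.
have rD0 : 0 < rD by rewrite sqrtr_gt0 ltr0n.
have rD2 : rD ^+ 2 = D%:R by rewrite sqr_sqrtr // ler0n.
pose I : finType := diag_index d.
have cI : #|I| = D by rewrite -card_diag_index.
pose M (h : lattice I) := kron_sum (diag_factors (lcoord R h)).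
pose ok (h : lattice I) :=
  (lweight h <= 2 * #|I|)%N && (\sum_o lcoord R h o ^+ 2 <= 4 * D%:R).
pose u := s * rn * D%:R * a.
pose bad (h : lattice I) :=
  if ok h then [set w | (2 * u <= qdev (fun i => Z i) (H *m M h *m H) w)%R] else set0.
have mbad h : measurable (bad h).
  by rewrite /bad; case: (ok h) => //; exact: measurable_functional.
have Pbad h : (P (bad h) <=
    ((lweight h <= 2 * #|I|)%N%:R * (2 * expR (- (17 * D%:R))))%:E)%E.
  rewrite /bad; case okh : (ok h); last first.
    by rewrite measure0 lee_fin mulr_ge0 ?mulr_ge0 ?expR_ge0 // ler0n.
  have /andP[-> hF] := okh; rewrite mul1r.
  have MF : frobenius (M h) ^+ 2 <= 4 * D%:R.
    exact: le_trans (frobenius_diag_factors d0 _ L0) hF.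
  have MF1 : frobenius (M h) <= 2 * rD.
    rewrite -ler_sqr ?nnegrE ?frobenius_ge0 ?mulr_ge0 ?(ltW rD0) //.
    by apply: le_trans MF _; rewrite exprMn rD2; lra.
  pose e : R := Num.sqrt (L.+1%:R / (mmin d)%:R).
  have e0 : 0 <= e by exact: sqrtr_ge0.
  have Mb : opnorm (M h) <= e * (2 * rD).
    apply: (le_trans (opnorm_kron_sum d0 _)).
    by rewrite ler_wpM2l.
  pose l := th / 3 / (s * rn).
  have l0 : 0 <= l by rewrite divr_ge0 ?divr_ge0 ?mulr_ge0 // ltW.
  have lb : l * (s * (e * (2 * rD))) <= th.
    have -> : l * (s * (e * (2 * rD))) = th * (2 * (e * rD / rn) / 3).
      by rewrite /l; field; rewrite !gt_eqF.
    rewrite ler_piMr ?(ltW th0) // ler_pdivrMr // mul1r.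
    have e_ge0 : 0 <= 2 * (e * rD / rn).
      by rewrite mulr_ge0 // divr_ge0 ?mulr_ge0 ?(ltW rn0) ?(ltW rD0).
    rewrite -ler_sqr ?nnegrE //.
    rewrite exprMn expr_div_n exprMn rD2 rn2 /e sqr_sqrtr; last first.
      by rewrite divr_ge0 ?ler0n.
    have -> : (L.+1%:R / (mmin d)%:R * D%:R / n%:R : R) =
        (L.+1 * D)%:R / (n * mmin d)%:R.
      by rewrite !natrM; field; rewrite !gt_eqF.
    have : (L.+1 * D)%:R / (n * mmin d)%:R <= 2 :> R.
      rewrite ler_pdivrMr ?ltr0n ?muln_gt0 ?n1 ?mmin_gt0 //.
      by rewrite -natrM ler_nat.
    by lra.
  have := functional_tail C00 model Hsqrt u Mb MF l0 lb.
  move=> /le_trans; apply; rewrite lee_fin ler_pM2l // ler_expR -/s -/q -rn2.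
  rewrite le_eqVlt; apply/orP; left; apply/eqP.
  by rewrite /l /u /a /diag_const -/q -/th; field; rewrite !gt_eqF.
have := prob_ge_forall mbad Pbad.
have total : \sum_(h : lattice I) (lweight h <= 2 * #|I|)%N%:R * (2 * expR (- (17 * D%:R))) <=
    expR (- ln p%:R) :> R.
  rewrite -mulr_suml -natr_sum.
  have -> : (\sum_(h : lattice I) (lweight h <= 2 * #|I|)%N =
      #|[set h : lattice I | (lweight h <= 2 * #|I|)%N]%SET|)%N.
    rewrite -sum1_card [RHS]big_mkcond /=; apply: eq_bigr => h _.
    by rewrite inE; case: (lweight h <= _)%N.
  have I0 : (0 < #|I|)%N by rewrite cI.
  have h16 : 16 ^+ #|I| <= expR (15 * D%:R) :> R.
    rewrite cI mulrC expRM_natl; apply: lerXn2r; rewrite ?nnegrE ?expR_ge0 //.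
    by have := expR_ge1Dx (15 : R); lra.
  have h2 : 2 <= expR D%:R :> R.
    have := expR_ge1Dx (D%:R : R); have : 1 <= D%:R :> R by rewrite ler1n.
    lra.
  apply: (@le_trans _ _ (expR (15 * D%:R) * (expR D%:R * expR (- (17 * D%:R))))).
    apply: ler_pM; rewrite ?ler0n ?mulr_ge0 ?expR_ge0 //.
      exact: le_trans (card_lattice_le R I) h16.
    by rewrite ler_wpM2r ?expR_ge0.
  by rewrite -!expRD ler_expR; have := ln_dimp_le; lra.
move=> h; apply: prob_ge_le (prob_ge_sub _ h); first by rewrite lerD2l lerN2.
move=> w good /=.
set g := diag_gradient (sample_cov (X ^~ w) - invmx (kron_sum Psi)).
have I0 : (0 < #|I|)%N by rewrite cI.
have [l [lw l2 lg]] := lattice_rounding I0 g.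
rewrite cI in l2 lg.
have okl : ok l by rewrite /ok lw.
have := good l; rewrite /bad okl /= => /negP; rewrite -ltNge => qu.
have E : \sum_o lcoord R l o * g o = n%:R^-1 * qdev (fun i => Z i) (H *m M l *m H) w.
  by rewrite -(trace_error n1 model Hsqrt Xvec) trace_diag_factors.
set G := Num.sqrt (\sum_o g o ^+ 2) in lg.
have G2 : \sum_o g o ^+ 2 = G ^+ 2.
  by rewrite sqr_sqrtr // sumr_ge0 // => o _; exact: sqr_ge0.
have sq : Num.sqrt (D%:R / n%:R) = rD / rn :> R.
  by rewrite sqrtrM ?ler0n // sqrtrV ?ler0n.
have rhs0 : 0 <= 2 * a * s by exact: mulr_ge0 (mulr_ge0 (ler0n _ 2) (ltW a0)) (ltW s0).
rewrite G2 ler_sqr ?nnegrE ?(mulr_ge0 rhs0) ?sqrtr_ge0 // sq.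
rewrite -(ler_pM2l rD0); apply: (le_trans lg); rewrite E ler_pdivrMl //.
apply: (le_trans (ltW qu)); rewrite le_eqVlt; apply/orP; left; apply/eqP.
by rewrite /u -rD2 -rn2; field; rewrite gt_eqF.
Qed.

End DiagonalError.

(** * Rates of convergence *)
Section Rates.
Variables (R : realType) (L : nat) (d : 'I_L -> nat).
Hypothesis d0 : forall k, (0 < d k)%N.

(** Operator norms are submultiplicative and the identity has norm [1]. *)
Lemma kappa_inv_ge1 n (A : 'M[R]_n) : (0 < n)%N -> posdef A -> 1 <= kappa (invmx A).
Proof.
case: n A => // n A _ Apd; rewrite kappa_inv //.
pose x : 'cV[R]_n.+1 := const_mx 1.
have x0 : 0 < frobenius x.
  rewrite lt_neqAle frobenius_ge0 andbT eq_sym frobenius_eq0.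
  apply/eqP => /matrixP /(_ 0 0); rewrite !mxE => /eqP; by rewrite oner_eq0.
rewrite -(ler_pM2r x0) mul1r -[X in frobenius X <= _](mulKmx (posdef_unit Apd)).
rewrite -mulrA; apply: (le_trans (opnorm_mulmx _ _)).
by rewrite ler_wpM2l ?opnorm_ge0 // opnorm_mulmx.
Qed.

(** As [d k = p / m k], the size of the frame is at most [2 L p / mmin d]; this is
    the origin of the term [L p] in the rate. *)
Lemma sum_dim_mmin_le : (0 < L)%N ->
  ((\sum_k d k).+1 * mmin d <= 2 * (L * dimp d))%N.
Proof.
move=> L0; rewrite mulSn mul2n -addnn leq_add //.
  by apply: (leq_trans (mmin_le_dimp d)); rewrite leq_pmull.
rewrite big_distrl /=; apply: (@leq_trans (\sum_(k < L) dimp d)).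
  by apply: leq_sum => k _; rewrite -(comp_dimE d k) mulnC leq_mul2r mmin_le orbT.
by rewrite sum_nat_const card_ord.
Qed.

(** This converts the number of non-zero entries of the factors into [s / mmin d]. *)
Lemma mmin_sparsity_le (Psi : forall k, 'M[R]_(d k)) :
  (mmin d * \sum_k offdiag_card (Psi k) <= sparsity Psi)%N.
Proof.
rewrite big_distrr /=; apply: leq_sum => k _.
by rewrite leq_mul2r mmin_le orbT.
Qed.

End Rates.

(** A union over [L] exceptional events and one more is absorbed into [L] events
    at the price of halving the exponent, unless the bound is void. *)
Lemma absorb_event (R : realType) (L : nat) (c x : R) : (2 <= L)%N -> 0 < c -> 0 <= x ->
  L%:R * expR (- (Num.min c 1 / 2 * x)) < 1 ->
  L%:R * expR (- (c * x)) + expR (- x) <= L%:R * expR (- (Num.min c 1 / 2 * x)).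
Proof.
move=> L2 c0 x0; set b := Num.min c 1 / 2; set y := expR (- (b * x)) => Ly.
have y0 : 0 < y by exact: expR_gt0.
have LR : 2 <= L%:R :> R by rewrite ler_nat.
have y2 a : Num.min c 1 <= a -> expR (- (a * x)) <= y ^+ 2.
  move=> ca; rewrite expr2 /y -expRD ler_expR.
  have -> : - (b * x) + - (b * x) = - (Num.min c 1 * x) by rewrite /b; field.
  by rewrite lerN2 ler_wpM2r.
have h1 : expR (- (c * x)) <= y ^+ 2 by apply: y2; rewrite ge_min lexx.
have h2 : expR (- x) <= y ^+ 2 by rewrite -[x]mul1r; apply: y2; rewrite ge_min lexx orbT.
apply: (@le_trans _ _ ((L%:R + 1) * y ^+ 2)).
  by rewrite mulrDl mul1r lerD // ler_wpM2l // ler0n.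
rewrite expr2 mulrA ler_pM2r //.
apply: (@le_trans _ _ ((L%:R * y) * 2)); first by nra.
by nra.
Qed.

Section Conclusion.
Variables (R : realType) (L : nat) (d : 'I_L -> nat) (n : nat).
Hypothesis d0 : forall k, (0 < d k)%N.
Hypothesis L0 : (0 < L)%N.
Hypothesis n1 : (1 <= n)%N.
Notation p := (dimp d).
Notation m := (comp_dim d).
Variables (Psi : forall k, 'M[R]_(d k)) (H : 'M[R]_p).
Local Notation Omega0 := (kron_sum Psi).
Local Notation Sigma0 := (invmx Omega0).
Hypothesis Opd : posdef Omega0.
Hypothesis Hsqrt : is_sqrtmx Sigma0 H.
Variables (S : 'M[R]_p) (delta eps : 'I_L -> R) (a c2 eps0 : R).
Hypothesis a0 : 0 < a.
Hypothesis c20 : 0 < c2.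
Hypothesis eps00 : 0 < eps0.
Hypothesis hdelta0 : forall k, 0 <= delta k.
Hypothesis hdelta : forall k, delta k <= c2 * delta_rate n Sigma0 k.
Hypothesis heps : forall k, eps0 <= eps k /\ eps k < 1.
Hypothesis off_error : forall k i j, i != j ->
  `|ptrace (S - Sigma0) k i j| <= (m k)%:R * delta k.
Hypothesis diag_error : \sum_o diag_gradient (S - Sigma0) o ^+ 2 <=
  (2 * a * opnorm Sigma0 * Num.sqrt ((\sum_k d k).+1%:R / n%:R)) ^+ 2.

Definition error_const : R := 9 * (4 * a + 2 * (c2 / eps0)).

Lemma error_const_gt0 : 0 < error_const.
Proof.
have x0 := divr_gt0 c20 eps00; rewrite /error_const.
by rewrite mulr_gt0 // addr_gt0 // mulr_gt0.
Qed.

Local Notation C := error_const.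
Local Notation rate := ((sparsity Psi)%:R * ln p%:R + L%:R * p%:R).
Local Notation argmin := (teralasso S (fun k => delta k / eps k)).

Hypothesis sample_size :
  (2 * C + 1) ^+ 2 * (L.+1)%:R * kappa Sigma0 ^+ 4 * rate <= n%:R * (mmin d)%:R ^+ 2.

(** The radius [r = C K om Q] is of the order of the linear cost divided by the
    strong convexity constant, where [gamma] and the penalty on the support are
    both at most a constant times [s Q]. The sample size makes this radius
    small compared with [1 / (s e)], where [e] is the ratio between the operator
    and Frobenius norms of Kronecker sums; the other two bounds follow from the
    first by the same ratio. *)
Lemma teralasso_rates : argmin !=set0 /\
  forall Omega_hat, argmin Omega_hat ->
  [/\ frobenius (Omega_hat - Omega0) / opnorm Omega0
        <= C * kappa Sigma0 * Num.sqrt (rate / (n%:R * (mmin d)%:R)),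
      opnorm (Omega_hat - Omega0) / opnorm Omega0
        <= C * Num.sqrt (L.+1)%:R * kappa Sigma0 *
           Num.sqrt (rate / (n%:R * (mmin d)%:R ^+ 2)) &
      frobenius (Omega_hat - Omega0) / frobenius Omega0
        <= C * Num.sqrt (L.+1)%:R * kappa Sigma0 *
           Num.sqrt (rate / (n%:R * (mmin d)%:R ^+ 2))].
Proof.
have p0 : (0 < p)%N by exact: dimp_gt0.
have pR : 0 < p%:R :> R by rewrite ltr0n.
have nR : 0 < n%:R :> R by rewrite ltr0n.
have LR : 0 < L%:R :> R by rewrite ltr0n.
have L1R : 0 < L.+1%:R :> R by rewrite ltr0n.
have MR : 0 < (mmin d)%:R :> R by rewrite ltr0n mmin_gt0.
have mR k : 0 < (m k)%:R :> R by rewrite ltr0n comp_dim_gt0.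
have lp0 : 0 <= ln p%:R :> R by exact: ln_nat_ge0.
have [om0 _ _] := posdef_opnorm p0 Opd.
have [s0 _ _] := posdef_opnorm p0 (posdef_inv Opd).
have C0 : 0 < C by exact: error_const_gt0.
have kE := kappa_inv p0 Opd; have size := sample_size.
set K := kappa Sigma0 in kE size *.
set s := opnorm Sigma0 in s0 kE *.
set om := opnorm Omega0 in om0 kE *.
have K0 : 0 < K by rewrite kE mulr_gt0.
set rt := rate in size *.
have rt0 : 0 < rt by rewrite ltr_wpDl ?mulr_ge0 ?mulr_gt0 ?ler0n.
set Q := Num.sqrt (rt / (n%:R * (mmin d)%:R)).
have Q2 : Q ^+ 2 = rt / (n%:R * (mmin d)%:R).
  by rewrite sqr_sqrtr // divr_ge0 ?mulr_ge0 // ltW.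
have Q0 : 0 < Q by rewrite sqrtr_gt0 divr_gt0 ?mulr_gt0.
set e := Num.sqrt (L.+1%:R / (mmin d)%:R : R).
have e0 : 0 < e by rewrite sqrtr_gt0 divr_gt0.
have e2 : e ^+ 2 = L.+1%:R / (mmin d)%:R by rewrite sqr_sqrtr // divr_ge0 ?ltW.
have eQ : e * Q = Num.sqrt L.+1%:R * Num.sqrt (rt / (n%:R * (mmin d)%:R ^+ 2)).
  rewrite /e /Q -(sqrtrM _ (ler0n _ _)) -sqrtrM ?divr_ge0 ?ler0n //.
  by congr Num.sqrt; field; rewrite !gt_eqF.
pose r := C * K * om * Q.
have r0 : 0 < r by exact: mulr_gt0 (mulr_gt0 (mulr_gt0 C0 K0) om0) Q0.
pose rbar := c2 / eps0 * s * Num.sqrt (ln p%:R / n%:R).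
have ce0 : 0 < c2 / eps0 by rewrite divr_gt0.
have rbar0 : 0 <= rbar.
  exact: mulr_ge0 (mulr_ge0 (ltW ce0) (ltW s0)) (sqrtr_ge0 _).
pose gamma := 2 * a * s * Num.sqrt ((\sum_k d k).+1%:R / n%:R).
have gamma0 : 0 <= gamma.
  exact: mulr_ge0 (mulr_ge0 (mulr_ge0 (ler0n _ 2) (ltW a0)) (ltW s0)) (sqrtr_ge0 _).
have lpn : 0 <= ln p%:R / n%:R :> R by rewrite divr_ge0 ?(ltW nR).
have epsP k : 0 < eps k /\ eps k < 1.
  by have [h1 h2] := heps k; split=> //; exact: lt_le_trans h1.
have delta_rho k : delta k <= delta k / eps k.
  by have [h1 h2] := epsP k; rewrite ler_pdivlMr // ler_piMr // ltW.
have rho_rbar k : (m k)%:R * (delta k / eps k) ^+ 2 <= rbar ^+ 2.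
  have [h1 h2] := epsP k; have [h3 _] := heps k.
  have rho_le : delta k / eps k <= c2 / eps0 * delta_rate n Sigma0 k.
    rewrite ler_pdivrMr //; apply: (le_trans (hdelta k)).
    have dr : 0 <= c2 * delta_rate n Sigma0 k by exact: le_trans (hdelta k).
    have -> : c2 / eps0 * delta_rate n Sigma0 k * eps k =
      c2 * delta_rate n Sigma0 k * (eps k / eps0) by ring.
    by rewrite ler_peMr // ler_pdivlMr // mul1r.
  apply: (@le_trans _ _ ((m k)%:R * (c2 / eps0 * delta_rate n Sigma0 k) ^+ 2)).
    rewrite ler_pM2l // ler_sqr // nnegrE.
      by rewrite divr_ge0 // ltW.
    by apply: le_trans rho_le; rewrite divr_ge0 // ltW.
  rewrite /delta_rate -/s /rbar !exprMn !sqr_sqrtr // ?divr_ge0 ?mulr_ge0 ?ler0n //.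
  move: (mR k); move: (m k)%:R => mk mk0.
  by rewrite le_eqVlt; apply/orP; left; apply/eqP; field; rewrite !gt_eqF.
have gamma_le : gamma <= 4 * a * (s * Q).
  rewrite -ler_sqr ?nnegrE //; last exact: mulr_ge0 (mulr_ge0 (ler0n _ 4) (ltW a0)) (mulr_ge0 (ltW s0) (ltW Q0)).
  rewrite /gamma !exprMn sqr_sqrtr ?divr_ge0 ?ler0n // Q2.
  have h : (\sum_k d k).+1%:R / n%:R <= 2 * (rt / (n%:R * (mmin d)%:R)) :> R.
    rewrite ler_pdivrMr //.
    have -> : 2 * (rt / (n%:R * (mmin d)%:R)) * n%:R = 2 * rt / (mmin d)%:R :> R.
      by field; rewrite !gt_eqF.
    rewrite ler_pdivlMr // -natrM.
    apply: (@le_trans _ _ (2 * (L * p))%N%:R); first by rewrite ler_nat sum_dim_mmin_le.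
    by rewrite natrM ler_pM2l // natrM lerDr mulr_ge0 ?ler0n.
  have as0 : 0 <= a ^+ 2 * s ^+ 2 by rewrite mulr_ge0 ?sqr_ge0.
  have := ler_wpM2l as0 h.
  have : 0 <= a ^+ 2 * s ^+ 2 * (rt / (n%:R * (mmin d)%:R)).
    by rewrite mulr_ge0 // divr_ge0 ?mulr_ge0 ?ltW.
  lra.
have pen_le : rbar * Num.sqrt (\sum_k offdiag_card (Psi k))%N%:R <= c2 / eps0 * (s * Q).
  rewrite -ler_sqr ?nnegrE; last first.
  - exact: mulr_ge0 (ltW ce0) (mulr_ge0 (ltW s0) (ltW Q0)).
  - exact: mulr_ge0 rbar0 (sqrtr_ge0 _).
  rewrite /rbar !exprMn (sqr_sqrtr lpn) Q2 sqr_sqrtr ?ler0n //.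
  have h : ln p%:R / n%:R * (\sum_k offdiag_card (Psi k))%N%:R <=
      rt / (n%:R * (mmin d)%:R) :> R.
    rewrite ler_pdivlMr ?mulr_gt0 //.
    have -> : ln p%:R / n%:R * (\sum_k offdiag_card (Psi k))%N%:R * (n%:R * (mmin d)%:R) =
       (mmin d * \sum_k offdiag_card (Psi k))%N%:R * ln p%:R :> R.
      by rewrite natrM; field; rewrite gt_eqF.
    apply: (@le_trans _ _ ((sparsity Psi)%:R * ln p%:R)).
      by rewrite ler_wpM2r // ler_nat mmin_sparsity_le.
    by rewrite lerDl mulr_ge0 ?ler0n.
  have cs0 : 0 <= (c2 / eps0) ^+ 2 * s ^+ 2 by exact: mulr_ge0 (sqr_ge0 _) (sqr_ge0 _).
  have := ler_wpM2l cs0 h; rewrite exprMn; lra.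
have r_large : 8 * om ^+ 2 *
    (gamma + 2 * rbar * Num.sqrt (\sum_k offdiag_card (Psi k))%N%:R) < r.
  apply: (@le_lt_trans _ _ (8 * om ^+ 2 * ((4 * a + 2 * (c2 / eps0)) * (s * Q)))).
    rewrite ler_wpM2l ?mulr_ge0 ?sqr_ge0 //; lra.
  have -> : 8 * om ^+ 2 * ((4 * a + 2 * (c2 / eps0)) * (s * Q)) = 8 / 9 * r.
    by rewrite /r /error_const kE; field; rewrite gt_eqF.
  lra.
have r_small : s * (e * r) <= 2^-1.
  pose y := K ^+ 2 * (e * Q).
  have y0 : 0 <= y by exact: mulr_ge0 (exprn_ge0 _ (ltW K0)) (mulr_ge0 (ltW e0) (ltW Q0)).
  have -> : s * (e * r) = C * y.
    have -> : y = s * om * K * (e * Q) by rewrite -kE -expr2.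
    by rewrite /r; ring.
  have : (2 * C + 1) * y <= 1.
    have C1 : 0 <= 2 * C + 1 by lra.
    rewrite -(@ler_pXn2r _ 2) ?nnegrE ?(mulr_ge0 C1) //.
    rewrite expr1n [leLHS]exprMn /y [(_ * (e * Q)) ^+ 2]exprMn [(e * Q) ^+ 2]exprMn Q2 e2.
    have -> : (2 * C + 1) ^+ 2 * ((K ^+ 2) ^+ 2 *
        (L.+1%:R / (mmin d)%:R * (rt / (n%:R * (mmin d)%:R)))) =
      (2 * C + 1) ^+ 2 * L.+1%:R * K ^+ 4 * rt / (n%:R * (mmin d)%:R ^+ 2).
      by field; rewrite !gt_eqF.
    by rewrite ler_pdivrMr ?mul1r ?size // mulr_gt0 // exprn_gt0.
  lra.
split.
  exact: (teralasso_nonempty d0 L0 Opd Hsqrt hdelta0 delta_rho gamma0 rbar0 rho_rbar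
            off_error diag_error r0 r_large r_small).
move=> Omega_hat hat.
have close := teralasso_close d0 L0 Opd Hsqrt hdelta0 delta_rho gamma0 rbar0 rho_rbar
            off_error diag_error r0 r_large r_small hat.
have opc : opnorm (Omega_hat - Omega0) <= e * frobenius (Omega_hat - Omega0).
  have [B _ <-] := hat; rewrite -kron_sumB; exact: opnorm_kron_sum.
have ome : om <= e * frobenius Omega0 by exact: opnorm_kron_sum.
have fr0 : 0 < frobenius Omega0 by rewrite -(pmulr_rgt0 _ e0) (lt_le_trans om0).
have CK : 0 < C * K by exact: mulr_gt0.
have E2 : C * Num.sqrt L.+1%:R * K * Num.sqrt (rt / (n%:R * (mmin d)%:R ^+ 2)) =
    C * K * (e * Q) by rewrite eQ; ring.
split; rewrite ?E2.
- rewrite ler_pdivrMr //; apply: (le_trans (ltW close)).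
  by rewrite /r mulrAC.
- rewrite ler_pdivrMr //; apply: (le_trans opc).
  apply: (@le_trans _ _ (e * r)); first by rewrite ler_pM2l // ltW.
  by rewrite /r le_eqVlt; apply/orP; left; apply/eqP; ring.
- rewrite ler_pdivrMr //; apply: (le_trans (ltW close)).
  have -> : C * K * (e * Q) * frobenius Omega0 = C * K * Q * (e * frobenius Omega0) by ring.
  rewrite /r mulrAC ler_pM2l //; exact: mulr_gt0.
Qed.

(** The term [L p] of the rate alone gives this, by [sum_dim_mmin_le] and because
    the condition number is at least [1]. *)
Lemma sample_size_diag : (L.+1 * (\sum_k d k).+1 <= 2 * (n * mmin d))%N.
Proof.
have p0 : (0 < p)%N by exact: dimp_gt0.
have M0 := mmin_gt0 d0.
have MR : 0 < (mmin d)%:R :> R by rewrite ltr0n.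
have lp0 : 0 <= ln p%:R :> R by exact: ln_nat_ge0.
have K1 := kappa_inv_ge1 p0 Opd.
have C0 : 0 < C by exact: error_const_gt0.
have h1 : (L.+1 * (L * p))%N%:R <= (n * mmin d ^ 2)%N%:R :> R.
  rewrite [in leRHS]natrM natrX; apply: le_trans sample_size.
  rewrite -mulrA -mulrA mulrCA natrM ler_wpM2l ?ler0n //.
  rewrite natrM mulrA; apply: (@le_trans _ _ (1 * rate)).
    by rewrite mul1r lerDr mulr_ge0 ?ler0n.
  rewrite ler_wpM2r //; first by rewrite addr_ge0 ?mulr_ge0 ?ler0n.
  rewrite -[1]mulr1; apply: ler_pM => //; last exact: exprn_ege1.
  by apply: exprn_ege1; lra.
rewrite ler_nat in h1.
rewrite -(leq_pmul2r M0) -mulnA.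
apply: (@leq_trans (L.+1 * (2 * (L * p)))).
  by rewrite leq_mul2l sum_dim_mmin_le ?orbT.
by rewrite mulnCA -!mulnA leq_mul2l /= -[(mmin d * mmin d)%N]/(mmin d ^ 2)%N.
Qed.

End Conclusion.
(* C0 and the lower bound eps0 on the eps_k are fixed; c1, c2 are the constants
   in delta_{n,k} \asymp ||Sigma0||_2 sqrt(log p / (n m_k)). *)
Theorem theorem2p4 (R : realType) (C0 : R) :
  0 < C0 ->
  (exists2 c1 : R, 0 < c1 & dominating C0 c1) /\
  forall c1 c2 eps0 : R,
  0 < c1 -> c1 <= c2 -> dominating C0 c1 -> 0 < eps0 ->
  exists CA C c : R, [/\ 0 < CA, 0 < C, 0 < c &
  forall (L : nat) (d : 'I_L -> nat) (n : nat)
    (disp : measure_display) (T : measurableType disp) (P : probability T R)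
    (Psi : forall k, 'M[R]_(d k))
    (Z : 'I_n -> {RV P >-> (dimp d).-tuple R}) (X : 'I_n -> T -> tensor R d)
    (delta eps : 'I_L -> R) (k_lo k_hi : R),
  (2 <= L)%N -> (forall k, (0 < d k)%N) -> (1 <= n)%N ->
  kron_sum_model C0 Psi Z X ->
  let p := dimp d in
  let Omega0 := kron_sum Psi in
  let Sigma0 := invmx Omega0 in
  let rate := (sparsity Psi)%:R * ln p%:R + L%:R * p%:R in
  let CL := C * Num.sqrt (L.+1)%:R in
  ln p%:R <= (mmin d)%:R :> R ->
  (forall k, eps0 <= eps k /\ eps k < 1) ->
  (forall k, c1 * delta_rate n Sigma0 k <= delta k /\
             delta k <= c2 * delta_rate n Sigma0 k) ->
  0 < k_lo -> k_lo <= phi_min Omega0 -> phi_max Omega0 <= k_hi ->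
  CA ^+ 2 * (L.+1)%:R * kappa Sigma0 ^+ 4 * rate
    <= n%:R * (mmin d)%:R ^+ 2 ->
  prob_ge P (1 - L%:R * expR (- (c * ln p%:R)))
    [set w |
      let argmin := teralasso (sample_cov (X ^~ w))
                      (fun k => delta k / eps k) in
      argmin !=set0 /\
      forall Omega_hat, argmin Omega_hat ->
      [/\ frobenius (Omega_hat - Omega0) / opnorm Omega0
            <= C * kappa Sigma0 *
               Num.sqrt (rate / (n%:R * (mmin d)%:R)),
          opnorm (Omega_hat - Omega0) / opnorm Omega0
            <= CL * kappa Sigma0 *
               Num.sqrt (rate / (n%:R * (mmin d)%:R ^+ 2)) &
          frobenius (Omega_hat - Omega0) / frobenius Omega0
            <= CL * kappa Sigma0 *
               Num.sqrt (rate / (n%:R * (mmin d)%:R ^+ 2))]]].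
Proof.
move=> C00; split; first exact: dominating_exists.
move=> c1 c2 eps0 c10 c12 [c' c'0 dom] eps00.
have a0 := diag_const_gt0 C00; set a := diag_const C0 in a0.
have c20 : 0 < c2 by exact: lt_le_trans c12.
pose C := error_const a c2 eps0.
(* [CA = 2 C + 1] brings the radius below the range of strong convexity; half of
   the smaller exponent pays for adding the two exceptional events. *)
have C0gt : 0 < C by exact: error_const_gt0.
exists (2 * C + 1), C, (Num.min c' 1 / 2); split=> //.
- by lra.
- by rewrite divr_gt0 // lt_min c'0 ltr01.
move=> L d n disp T P Psi Z X delta eps k_lo k_hi L2 d0 n1 model p Omega0 Sigma0 rate CL
  lpm heps hdelta _ _ _ sample_size.
have p0 : (0 < p)%N by exact: dimp_gt0.
have L0 : (0 < L)%N by exact: ltnW.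
have lp0 : 0 <= ln p%:R :> R by exact: ln_nat_ge0.
have [void|small] := lerP 1 (L%:R * expR (- (Num.min c' 1 / 2 * ln p%:R)) : R).
  by apply: prob_ge_trivial; rewrite subr_le0.
have Opd := model_posdef model.
have [H Hsqrt Xvec] := model_sqrt model.
have off := dom L d n disp T P Psi Z X delta L2 d0 n1 model lpm (fun k => (hdelta k).1).
have size := sample_size_diag d0 L0 Opd a0 c20 eps00 sample_size.
have diag := diag_gradient_tail d0 L0 n1 C00 model size.
apply: prob_ge_le (prob_ge_sub _ (prob_ge_setI off diag)).
  by rewrite lerD2l lerN2; exact: absorb_event.
move=> w [/= woff wdiag].
have rate0 k : 0 <= delta_rate n Sigma0 k by rewrite mulr_ge0 ?opnorm_ge0 ?sqrtr_ge0.
have delta0 k : 0 <= delta k.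
  by apply: le_trans (hdelta k).1; rewrite mulr_ge0 // ltW.
have woff' k (i j : 'I_(d k)) : i != j ->
    `|ptrace (sample_cov (X ^~ w) - Sigma0) k i j| <= (comp_dim d k)%:R * delta k.
  move=> ij; have := woff k i j ij.
  by rewrite (mode_cov_error n1 model Hsqrt Xvec) ler_pdivrMl // ltr0n comp_dim_gt0.
exact: (teralasso_rates d0 L0 n1 Opd Hsqrt a0 c20 eps00 delta0 (fun k => (hdelta k).2)
          heps woff' wdiag sample_size).
Qed.
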